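(* Let $\psi\in C^1(\mathbb{R}^2,\mathbb{R}^2)$, let $\phi\in C(\mathbb{R}\times\mathbb{R}^2\times[0,1],\mathbb{R}^2)$ be $T$-periodic in its first variable, and assume that $\dot x=\psi(x)$ has a limit cycle $x_0$ of smallest period $T>0$ such that the linearized system $\dot y=\psi'(x_0(t))y$ has only one characteristic multiplier equal to $1$. Let $U_0$ be the interior of $x_0$. Let $\widetilde F\in C(\mathbb{R}^2,\mathbb{R}^2)$ be a vector field such that $$\widetilde F(x_0(\theta))=f_0(\theta)\dot x_0(\theta)+f_1(\theta,T)\,\dot x_0(\theta)^\bot,\qquad\theta\in[0,T].$$ Assume that $$\langle\dot x_0(0),z_0(0)\rangle=\langle y_1(0),z_1(0)\rangle=1,$$ $$f_0(\theta)=-f_0(\theta+T/2)\quad\text{and}\quad f_1(\theta,T)=-f_1(\theta+T/2,T)\quad\text{for any }\theta\in[0,T].$$ Moreover, assume that there exists a unique $\theta_0\in[0,T/2)$ such that $f_0(\theta_0)=0$. Finally, assume that the function $f_0$ is strictly monotone at the point $\theta_0$ and that $f_1(\theta_0,T)\neq0$. Then either $d_B(\widetilde F,U_0)=0$ or $d_B(\widetilde F,U_0)=2$.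
   Context: $d_B$ is the Brouwer degree (with respect to $0$). An eigenfunction of a linear $T$-periodic system corresponding to a characteristic multiplier $\rho$ is a nontrivial solution $y$ with $y(t+T)=\rho\,y(t)$. ''Only one characteristic multiplier equal to $1$'' means that $1$ is a simple multiplier. $y_1$ is the eigenfunction of $\dot y=\psi'(x_0(t))y$ corresponding to the multiplier $\rho\neq1$; $z_0$ and $z_1$ are eigenfunctions of the adjoint system $\dot z=-(\psi'(x_0(t)))^*z$ ($*$ = transpose) corresponding to the multipliers $1$ and $\rho_*\neq1$ respectively. Define, for $\theta,s\in\mathbb{R}$, $$f_0(\theta)=\int_0^T\langle z_0(\tau),\phi(\tau-\theta,x_0(\tau),0)\rangle\,d\tau,\qquad f_1(\theta,s)=\int_{s-T}^s\langle z_1(\tau),\phi(\tau-\theta,x_0(\tau),0)\rangle\,d\tau.$$ For $a\in\mathbb{R}^2$, $a^\bot$ is $a$ rotated clockwise by $\pi/2$. The interior of $x_0$ is the bounded component of the complement of the Jordan curve $x_0([0,T])$. ''Strictly monotone at a point'' means strictly increasing or strictly decreasing in a neighborhood of that point. *)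

(* Defs.v *)
From HB Require Import structures.
From mathcomp Require Import all_boot all_order all_algebra.
From mathcomp Require Import all_classical all_reals all_analysis.
Import Order.TTheory GRing.Theory Num.Theory.
Import numFieldNormedType.Exports.

Set Implicit Arguments.
Unset Strict Implicit.
Unset Printing Implicit Defensive.

Local Open Scope classical_set_scope.
Local Open Scope ring_scope.

(* The plane is 'rV[R]_2, points being row vectors.  The library's [jacobian]
   acts on rows from the right, i.e. it is the transpose of the usual matrix of
   partial derivatives; the norm `|.| on 'rV[R]_2 is the maximum norm. *)

Section Plane.
Variable R : realType.
Local Notation plane := 'rV[R]_2.

Definition dotv (u v : plane) : R := \sum_(i < 2) u 0 i * v 0 i.

(* Clockwise rotation by pi/2: (a_1, a_2) |-> (a_2, - a_1). *)
Definition perp (a : plane) : plane :=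
  \row_(i < 2) (if i == 0 then a 0 1 else - a 0 0).

Definition C1_field (g : plane -> plane) : Prop :=
  (forall p, differentiable g p) /\ continuous (jacobian g).

Definition boundary (U : set plane) : set plane := closure U `\` interior U.

(** ** Brouwer degree with respect to 0 *)

Definition degree_domain (F : plane -> plane) (U : set plane) : Prop :=
  [/\ open U, bounded_set U, {within closure U, continuous F}
    & forall y, boundary U y -> F y != 0].

(* A C^1 map g with sup_(closure U) |g - F| < dist (0, F (boundary U)) having 0
   as a regular value on U.  As closure U is compact, both extrema are attained,
   so the comparison may be made pointwise. *)
Definition regular_approx (F : plane -> plane) (U : set plane)
    (g : plane -> plane) : Prop :=
  [/\ C1_field g,
      forall x y, closure U x -> boundary U y -> `|g x - F x| < `|F y|
    & forall x, U x -> g x = 0 -> \det (jacobian g x) != 0].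

(* For a regular approximation of F on a degree domain the zero set below is
   finite, so that this is the usual finite sum of signs (a finitely supported
   sum is 0 by convention when its support is infinite). *)
Definition sign_sum (U : set plane) (g : plane -> plane) : int :=
  \sum_(x \in U `&` [set x | g x = 0]) sgz (\det (jacobian g x)).

(* [brouwer_degree F U d] reads: the degree d_B (F, U) is defined and equal
   to d.  The existence clause makes d unique. *)
Definition brouwer_degree (F : plane -> plane) (U : set plane) (d : int) :
    Prop :=
  [/\ degree_domain F U,
      exists g, regular_approx F U g
    & forall g, regular_approx F U g -> sign_sum U g = d].

(** ** Autonomous systems and limit cycles *)

Definition solution (psi : plane -> plane) (x : R -> plane) : Prop :=
  forall t : R, is_derive t 1 x (psi (x t)).

Definition least_period (x : R -> plane) (T : R) : Prop :=
  [/\ 0 < T, forall t, x (t + T) = x t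
    & forall S, 0 < S -> (forall t, x (t + S) = x t) -> T <= S].

(* Equilibria have no least period, hence are not closed orbits. *)
Definition closed_orbit (psi : plane -> plane) (C : set plane) : Prop :=
  exists x T, [/\ solution psi x, least_period x T & C = range x].

(* A limit cycle is an isolated closed orbit. *)
Definition limit_cycle (psi : plane -> plane) (x : R -> plane) (T : R) : Prop :=
  [/\ solution psi x, least_period x T
    & exists V : set plane, [/\ open V, range x `<=` V
        & forall C, closed_orbit psi C -> C `<=` V -> C = range x]].

Definition jordan_interior (C U : set plane) : Prop :=
  bounded_set U /\
  exists2 p, (~` C) p & U = connected_component (~` C) p.

(** ** Linear periodic systems *)

(* The usual matrix psi'(x(t)), acting on columns. *)
Definition linearization (psi : plane -> plane) (x : R -> plane) (t : R) :
  'M[R]_2 := (jacobian psi (x t))^T.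

Definition adjoint_coef (A : R -> 'M[R]_2) (t : R) : 'M[R]_2 := - (A t)^T.

(* Row-vector form of y' = A(t) y. *)
Definition linear_solution (A : R -> 'M[R]_2) (y : R -> plane) : Prop :=
  forall t : R, is_derive t 1 y (y t *m (A t)^T).

Definition eigenfunction (A : R -> 'M[R]_2) (T rho : R) (y : R -> plane) :
    Prop :=
  [/\ linear_solution A y, exists t, y t != 0
    & forall t, y (t + T) = rho *: y t].

(* Y T is then the monodromy matrix, whose eigenvalues are the characteristic
   multipliers. *)
Definition fundamental_matrix (A : R -> 'M[R]_2) (Y : R -> 'M[R]_2) : Prop :=
  Y 0 = 1%:M /\ forall t : R, is_derive t 1 Y (A t *m Y t).

Definition simple_multiplier (A : R -> 'M[R]_2) (T rho : R) : Prop :=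
  exists2 Y, fundamental_matrix A Y & mup rho (char_poly (Y T)) = 1%N.

(** ** The perturbation and the bifurcation functions *)

(* phi belongs to C (R x R^2 x [0,1], R^2); its values for eps outside [0,1]
   are irrelevant. *)
Definition admissible_perturbation (phi : R -> plane -> R -> plane) (T : R) :
    Prop :=
  {within [set p : R * plane * R | 0 <= p.2 <= 1],
     continuous (fun p : R * plane * R => phi p.1.1 p.1.2 p.2)} /\
  forall t x eps, 0 <= eps <= 1 -> phi (t + T) x eps = phi t x eps.

Definition f0 (phi : R -> plane -> R -> plane) (x0 z0 : R -> plane)
    (T theta : R) : R :=
  \int[lebesgue_measure]_(tau in `[0, T])
    dotv (z0 tau) (phi (tau - theta) (x0 tau) 0).

Definition f1 (phi : R -> plane -> R -> plane) (x0 z1 : R -> plane)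
    (T theta s : R) : R :=
  \int[lebesgue_measure]_(tau in `[s - T, s])
    dotv (z1 tau) (phi (tau - theta) (x0 tau) 0).

Definition strictly_monotone_at (f : R -> R) (a : R) : Prop :=
  exists2 e : R, 0 < e &
    (forall x y, a - e < x -> x < y -> y < a + e -> f x < f y) \/
    (forall x y, a - e < x -> x < y -> y < a + e -> f y < f x).

End Plane.

(* Main.v *)
(* Let v be the velocity of x0 and let sig be the common winding number of the
   loops x0 - p for p in U0.  Comparing the winding numbers about two points
   straddling the curve at a lowest point gives sig = 1 or sig = -1, and the
   loops x0 t - x0 s - e n(s), with n the normal and e small, form a zero-free
   torus whose diagonal winds like v, so v has winding number sig as well.  A
   map without zeros on the closure of U0 has winding number 0 along x0: its
   argument is extended past the curve by Tietze's theorem.  Removing the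
   zeros of a regular approximation one by one, the degree of F in U0 is then
   sig times the winding number of F along x0.  In the moving frame (v, v^perp)
   the field F is the loop f0 - i f1, which is antiperiodic and whose real part
   vanishes once in a half-period, so that it winds k = 1 or k = -1 times.
   Hence the degree is sig (sig + k) = 1 + sig k.  Regular approximations come
   from Bernstein polynomials shifted by a value that a counting argument on a
   grid shows to be non-critical. *)

Require Import Defs.
From HB Require Import structures.
From mathcomp Require Import all_boot all_order all_algebra.
From mathcomp Require Import all_classical all_reals all_analysis.
From mathcomp Require Import complex ring lra zify.
Import Order.TTheory GRing.Theory Num.Theory.
Import numFieldNormedType.Exports.
Local Open Scope classical_set_scope.
Local Open Scope ring_scope.
Local Open Scope complex_scope.

Set Implicit Arguments.
Unset Strict Implicit.
Unset Printing Implicit Defensive.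

(** * Arguments of complex numbers *)

Section Polar.
Variable R : realType.
Implicit Types (a b r : R) (z w : R[i]).

(** All that is given about [U0] is that it is a bounded component of the complement of the curve.
    That its boundary is the whole curve, and that the index is one and the same sign throughout it,
    has to be read off the normals: every point of [U0] is joined inside [U0], along a normal, to a
    nearest point of the curve, hence to one common offset curve. As no contraction of [U0] is at
    hand either, a map without zeros is handled by a detour over a large circle outside the curve.
    The differential equation acts through uniqueness of solutions, which makes [x0] injective on a
    period with non-vanishing velocity. Winding numbers are defined by continuous arguments, since
    [Ftilde] is merely continuous. [brouwer_degree] demands that a regular approximation exists and
    that all of them give the same sum. The second demand is met by a formula valid for every
    regular approximation. The first calls for a quantitative Sard argument, which needs
    second-order control and so starts from polynomials. *)

Definition cre z : R := complex.Re z.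
Definition cim z : R := complex.Im z.

Definition sqn z : R := cre z ^+ 2 + cim z ^+ 2.

Lemma sqn_gt0 z : z != 0 -> 0 < sqn z.
Proof.
case: z => x y; rewrite eq_complex /= negb_and /sqn /= => h.
rewrite lt_neqAle addr_ge0 ?sqr_ge0 // andbT eq_sym paddr_eq0 ?sqr_ge0 //.
by rewrite !expf_eq0 /= negb_and.
Qed.

(** An argument as a relation: no branch is chosen, and the positive modulus builds [z != 0] in. *)
Definition pol z a := exists2 r, 0 < r & z = (r * cos a) +i* (r * sin a).

Lemma pol_neq0 {z a} : pol z a -> z != 0.
Proof.
case=> r r0 ->; apply/eqP => -[] c s.
have := cos2Dsin2 a; have: r != 0 by rewrite gt_eqF.
move/eqP: c; move/eqP: s; rewrite !mulf_eq0 => s c /negbTE r1; move: s c.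
by rewrite r1 /= => /eqP -> /eqP ->; rewrite expr0n /= addr0 => /esym/eqP; rewrite oner_eq0.
Qed.

Lemma polM {z w a b} : pol z a -> pol w b -> pol (z * w) (a + b).
Proof.
case=> r r0 -> [s s0 ->]; exists (r * s); first exact: mulr_gt0.
by rewrite cosD sinD; congr (_ +i* _); ring.
Qed.

Lemma polC {z a} : pol z a -> pol z^* (- a).
Proof.
by case=> r r0 ->; exists r => //; rewrite cosN sinN; congr (_ +i* _); ring.
Qed.

Lemma pol_scale {z a r} : 0 < r -> pol z a -> pol (r%:C * z) a.
Proof.
move=> r0 [s s0 ->]; exists (r * s); first exact: mulr_gt0.
by congr (_ +i* _) => /=; ring.
Qed.

Lemma polN {z a} : pol z a -> pol (- z) (a + pi).
Proof.
by case=> r r0 ->; exists r => //; rewrite cosDpi sinDpi; congr (_ +i* _) => /=; ring.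
Qed.

Lemma pol_cis a : pol (cos a +i* sin a) a.
Proof. by exists 1 => //; rewrite !mul1r. Qed.

Lemma pol_re z : 0 < cre z -> pol z (atan (cim z / cre z)).
Proof.
case: z => x y; rewrite /cre /cim /= => x0.
exists (x / cos (atan (y / x))).
  by rewrite divr_gt0 // cos_gt0_pihalf // atan_gtNpi2 atan_ltpi2.
have c0 : cos (atan (y / x)) != 0.
  by rewrite gt_eqF // cos_gt0_pihalf // atan_gtNpi2 atan_ltpi2.
have := atanK (y / x); rewrite /tan => e.
congr (_ +i* _); first by rewrite divfK.
have x1 : x != 0 by rewrite gt_eqF.
by rewrite mulrAC -mulrA e; field.
Qed.

Lemma pol_ex z : z != 0 -> exists a, pol z a.
Proof.
move=> z0; have := sqn_gt0 z0.
have [h|h|h] := ltgtP (cre z) 0.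
- move=> _; exists (atan (cim (- z) / cre (- z)) + pi).
  rewrite -[z in pol z _]opprK; apply: polN; apply: pol_re.
  by case: z h {z0} => x y /=; rewrite /cre /= oppr_gt0.
- by move=> _; exists (atan (cim z / cre z)); apply: pol_re.
- move: z0 h; case: z => x y; rewrite /sqn /cre /cim /= => z0 ->.
  have [y0|y0|y0] := ltgtP y 0.
  + move=> _; exists (- (pi / 2)); exists (- y); first by rewrite oppr_gt0.
    by rewrite cosN sinN cos_pihalf sin_pihalf; congr (_ +i* _); ring.
  + move=> _; exists (pi / 2); exists y => //.
    by rewrite cos_pihalf sin_pihalf; congr (_ +i* _); ring.
  + by rewrite y0 expr0n /= addr0 ltxx.
Qed.

Lemma cos_sinD2pin a (n : nat) :
  cos (a + pi *+ 2 * n%:R) = cos a /\ sin (a + pi *+ 2 * n%:R) = sin a.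
Proof.
elim: n => [|n [IHc IHs]]; first by rewrite mulr0 addr0.
rewrite -natr1 mulrDr mulr1 addrA cosD2pi sinD2pi; split=> //.
Qed.

Lemma cos_sinD2piz a (k : int) :
  cos (a + pi *+ 2 * k%:~R) = cos a /\ sin (a + pi *+ 2 * k%:~R) = sin a.
Proof.
case: k => n; first exact: cos_sinD2pin.
have [] := cos_sinD2pin (a + pi *+ 2 * (Negz n)%:~R) n.+1.
by rewrite NegzE mulrNz /= mulrN addrNK => <- <-.
Qed.

(** Reduced modulo 2 pi, x lands in [0, 2 pi). Injectivity of the cosine on [0, pi] settles the
    lower half; after y |-> 2 pi - y it excludes the upper half. *)
Lemma cos_eq1 x : cos x = 1 -> exists k : int, x = pi *+ 2 * k%:~R :> R.
Proof.
move=> cx; have pi2 : 0 < (pi : R) *+ 2 by rewrite pmulrn_lgt0 ?pi_gt0.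
set k := Num.floor (x / (pi *+ 2)); exists k.
set y := x - pi *+ 2 * k%:~R.
suff : y = 0 by move/eqP; rewrite subr_eq0 => /eqP.
have [cy _] := cos_sinD2piz x (- k).
rewrite mulrNz mulrN -/y cx in cy.
have /andP[k1 k2] := floor_itv (x / (pi *+ 2)).
have y0 : 0 <= y by rewrite subr_ge0 mulrC -ler_pdivlMr.
have y1 : y < pi *+ 2.
  by rewrite ltrBlDr -{1}[pi *+ 2]mulr1 -mulrDr addrC mulrC -ltr_pdivrMr // -intrD1.
have p0 := @pi_gt0 R.
have i0 : (0 : R) \in `[0, pi] by rewrite in_itv /= lexx ltW.
have [yp|yp] := leP y pi.
  by apply: cos_inj => //; rewrite ?cos0 // in_itv /= y0.
have : pi *+ 2 - y = 0.
  apply: cos_inj => //; first by rewrite in_itv /=; rewrite mulr2n in y1 *; lra.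
  by rewrite addrC cosD2pi cosN cy cos0.
by rewrite mulr2n in y1 *; lra.
Qed.

(** The product of [z] with its conjugate is a positive real that has a - b as an argument, so cos
    (a - b) = 1. *)
Lemma pol_uniq z a b : pol z a -> pol z b ->
  exists k : int, a = b + pi *+ 2 * k%:~R.
Proof.
move=> za zb; have [r r0] := polM za (polC zb).
have -> : z * z^* = (sqn z)%:C.
  by case: z {za zb} => x y; rewrite /sqn /=; congr (_ +i* _); rewrite /cre /cim /=; ring.
have s0 := sqn_gt0 (pol_neq0 za).
case=> e1 e2.
have sn : sin (a - b) = 0.
  by move/esym/eqP: e2; rewrite mulf_eq0 gt_eqF //= => /eqP.
have cs : cos (a - b) = 1.
  have := cos2Dsin2 (a - b); rewrite sn expr0n /= addr0 => /eqP.
  rewrite sqrf_eq1 => /orP[/eqP//|/eqP c]; move: s0; rewrite e1 c mulrN1.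
  by rewrite oppr_gt0 => /(lt_trans r0); rewrite ltxx.
by have [k e] := cos_eq1 cs; exists k; rewrite -e; ring.
Qed.
End Polar.

(** * Continuity of complex-valued maps, tested on real and imaginary parts *)

Section Cont.
Variable R : realType.

Definition cca (X : topologicalType) (u : X -> R[i]) (x : X) :=
  cre (u y) @[y --> x] --> cre (u x) /\ cim (u y) @[y --> x] --> cim (u x).

Definition ccont (X : topologicalType) (u : X -> R[i]) := forall x, cca u x.

Lemma creD (z w : R[i]) : cre (z + w) = cre z + cre w. Proof. by case: z; case: w. Qed.
Lemma cimD (z w : R[i]) : cim (z + w) = cim z + cim w. Proof. by case: z; case: w. Qed.
Lemma creN (z : R[i]) : cre (- z) = - cre z. Proof. by case: z. Qed.
Lemma cimN (z : R[i]) : cim (- z) = - cim z. Proof. by case: z. Qed.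
Lemma creM (z w : R[i]) : cre (z * w) = cre z * cre w - cim z * cim w.
Proof. by case: z; case: w. Qed.
Lemma cimM (z w : R[i]) : cim (z * w) = cre z * cim w + cim z * cre w.
Proof. by case: z => a b; case: w => c d. Qed.
Lemma creC (z : R[i]) : cre z^* = cre z. Proof. by case: z. Qed.
Lemma cimC (z : R[i]) : cim z^* = - cim z. Proof. by case: z. Qed.
Lemma creR (a : R) : cre a%:C = a. Proof. by []. Qed.
Lemma cimR (a : R) : cim a%:C = 0. Proof. by []. Qed.
Lemma creV (z : R[i]) : cre z^-1 = cre z / sqn z. Proof. by case: z. Qed.
Lemma cimV (z : R[i]) : cim z^-1 = - (cim z / sqn z). Proof. by case: z. Qed.
Definition cE := (creD, cimD, creN, cimN, creM, cimM, creC, cimC, creR, cimR, creV, cimV).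

Lemma ceq (z w : R[i]) : cre z = cre w -> cim z = cim w -> z = w.
Proof. by case: z => a b; case: w => c d /= -> ->. Qed.

Section Pointwise.
Variables (X : topologicalType).
Implicit Types (u v : X -> R[i]) (x : X).

Lemma cca_ext u v x : u =1 v -> cca u x -> cca v x.
Proof. by move=> /funext ->. Qed.

Lemma cca_cst c x : cca (fun _ => c) x.
Proof. by split; apply: cst_continuous. Qed.

Lemma ccaD u v x : cca u x -> cca v x -> cca (fun y => u y + v y) x.
Proof.
move=> [a b] [c d]; split.
  by under eq_fun do rewrite creD; rewrite creD; apply: cvgD.
by under eq_fun do rewrite cimD; rewrite cimD; apply: cvgD.
Qed.

Lemma ccaN u x : cca u x -> cca (fun y => - u y) x.
Proof.
move=> [a b]; split.
  by under eq_fun do rewrite creN; rewrite creN; apply: cvgN.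
by under eq_fun do rewrite cimN; rewrite cimN; apply: cvgN.
Qed.

Lemma ccaM u v x : cca u x -> cca v x -> cca (fun y => u y * v y) x.
Proof.
move=> [a b] [c d]; split.
  by under eq_fun do rewrite creM; rewrite creM; apply: cvgB; apply: cvgM.
by under eq_fun do rewrite cimM; rewrite cimM; apply: cvgD; apply: cvgM.
Qed.

Lemma ccaC u x : cca u x -> cca (fun y => (u y)^*) x.
Proof.
move=> [a b]; split.
  by under eq_fun do rewrite creC; rewrite creC.
by under eq_fun do rewrite cimC; rewrite cimC; apply: cvgN.
Qed.

Lemma ccaR (f : X -> R) x : {for x, continuous f} -> cca (fun y => (f y)%:C) x.
Proof. by move=> h; split=> //; apply: cst_continuous. Qed.

Lemma sqn_cont u x : cca u x -> {for x, continuous (fun y => sqn (u y))}.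
Proof. by move=> [a b]; apply: cvgD; rewrite !expr2; apply: cvgM. Qed.

Lemma ccaV u x : u x != 0 -> cca u x -> cca (fun y => (u y)^-1) x.
Proof.
move=> u0 ux; have [a b] := ux.
have s : (sqn (u y))^-1 @[y --> x] --> (sqn (u x))^-1.
  by apply: cvgV; [rewrite gt_eqF// sqn_gt0|apply: sqn_cont].
split.
  by under eq_fun do rewrite creV; rewrite creV; apply: cvgM.
by under eq_fun do rewrite cimV; rewrite cimV; apply: cvgN; apply: cvgM.
Qed.

Lemma cca_cis (f : X -> R) x : {for x, continuous f} ->
  cca (fun y => cos (f y) +i* sin (f y)) x.
Proof.
move=> h; split.
  exact: (continuous_comp (g := cos) h (@continuous_cos R _)).
exact: (continuous_comp (g := sin) h (@continuous_sin R _)).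
Qed.
End Pointwise.

Lemma cca_comp (X Y : topologicalType) (f : X -> Y) (u : Y -> R[i]) x :
  {for x, continuous f} -> cca u (f x) -> cca (fun y => u (f y)) x.
Proof.
move=> fx [a b]; split.
  exact: (continuous_comp (g := fun y => cre (u y)) fx a).
exact: (continuous_comp (g := fun y => cim (u y)) fx b).
Qed.

Definition pt (a b : R) : 'rV[R]_2 := \row_(i < 2) (if i == 0 then a else b).

Lemma pt0 a b : pt a b 0 0 = a. Proof. by rewrite mxE. Qed.
Lemma pt1 a b : pt a b 0 1 = b. Proof. by rewrite mxE. Qed.

Lemma pt_eta (z : 'rV[R]_2) : pt (z 0 0) (z 0 1) = z.
Proof.
apply/rowP => i; rewrite mxE; have [->//|i0] := eqVneq.
by congr (z _ _); apply/val_inj; move: i i0 => [[|[|]]].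
Qed.

Lemma plane_eq (z w : 'rV[R]_2) : z 0 0 = w 0 0 -> z 0 1 = w 0 1 -> z = w.
Proof. by move=> a b; rewrite -[z]pt_eta -[w]pt_eta a b. Qed.

Lemma plane_normP (z : 'rV[R]_2) r :
  reflect (`|z 0 0| <= r /\ `|z 0 1| <= r) (`|z| <= r).
Proof.
apply: (iffP idP) => [h|[h0 h1]].
  split; apply: le_trans h; rewrite /Num.norm /= mx_normrE.
    exact: (le_bigmax _ (fun ij => `|z ij.1 ij.2|) (0, 0)).
  exact: (le_bigmax _ (fun ij => `|z ij.1 ij.2|) (0, 1)).
rewrite /Num.norm /= mx_normrE; apply/bigmax_leP; split.
  by apply: le_trans h0.
case=> i j _ /=; rewrite ord1.
have [->//|j0] := eqVneq j 0; suff -> : j = 1 by [].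
by apply/val_inj; move: j j0 => [[|[|]]].
Qed.

Lemma norm_pt a b : `|pt a b| = Num.max `|a| `|b|.
Proof.
apply/le_anti/andP; split; first by apply/plane_normP; rewrite pt0 pt1 !le_max !lexx orbT.
have /plane_normP := lexx `|pt a b|; rewrite pt0 pt1 ge_max => -[-> ->] //.
Qed.

Lemma pt_cont (X : topologicalType) (a b : X -> R) x :
  {for x, continuous a} -> {for x, continuous b} ->
  {for x, continuous (fun y => pt (a y) (b y))}.
Proof.
move=> ha hb; apply/cvgrPdist_le => /= e e0.
move/cvgrPdist_le: ha => /(_ _ e0); move/cvgrPdist_le: hb => /(_ _ e0).
apply: filterS2 => y h1 h2; apply/plane_normP.
by rewrite !mxE.
Qed.

Definition toC (z : 'rV[R]_2) : R[i] := z 0 0 +i* z 0 1.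

Lemma toC_cont : ccont toC.
Proof. by move=> x; split; apply: coord_continuous. Qed.
End Cont.

(** * Lifting arguments *)

Section Lift.
Variable R : realType.
Local Notation P := 'rV[R]_2.

Lemma compact_square (M : R) : compact [set x : P | `|x| <= M].
Proof.
apply: bounded_closed_compact.
  exists M; split; first exact: num_real.
  by move=> y My x /= /le_trans; apply; exact: ltW.
exact: (closed_comp (fun x _ => @norm_continuous _ _ x) (@closed_le R M)).
Qed.

(** Radial retraction onto the ball of radius M: it lets a lift that is controlled only on this ball
    be continuous on the whole plane. *)
Definition clamp (M : R) (x : P) : P := (M / Num.max M `|x|) *: x.

Lemma clamp_id M x : 0 < M -> `|x| <= M -> clamp M x = x.
Proof. by move=> M0 h; rewrite /clamp max_l // divff ?gt_eqF // scale1r. Qed.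

Lemma clamp_norm M x : 0 < M -> `|clamp M x| <= M.
Proof.
move=> M0; have m0 : 0 < Num.max M `|x| by rewrite lt_max M0.
rewrite /clamp normrZ ger0_norm; last by rewrite divr_ge0 // ltW.
by rewrite mulrAC ler_pdivrMr // ler_pM2l // le_max lexx orbT.
Qed.

Lemma clamp_cont M : 0 < M -> continuous (clamp M).
Proof.
move=> M0 x; have m : Num.max M `|y| @[y --> x] --> Num.max M `|x|.
  have := @continuous_max R P (cst M) (fun y : P => `|y|) x.
  by apply; [exact: cst_continuous | exact: norm_continuous].
have m0 : Num.max M `|x| != 0 by rewrite gt_eqF // lt_max M0.
exact: (cvgZ (cvgM (cvg_cst M) (cvgV m0 m)) cvg_id).
Qed.

(* Write u x as u 0 times the quotients of consecutive values of u along the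
   segment from 0 to x; for a fine subdivision these lie in the right
   half-plane, where the argument is an arctangent. *)
Lemma plane_lift (u : P -> R[i]) M : 0 < M -> ccont u ->
  (forall x, `|x| <= M -> u x != 0) ->
  exists2 th : P -> R, continuous th & forall x, `|x| <= M -> pol (u x) (th x).
Proof.
move=> M0 uc u0.
(* At e = 0 this product is |u (s x)|^2 > 0; compactness of the ball times [0, 1] keeps its real
   part positive for all small e, uniformly. *)
pose q (xs : P * R) (e : R) := u (xs.2 *: xs.1) * (u ((xs.2 - e) *: xs.1))^*.
have qc : ccont (fun p : P * R * R => q p.1 p.2).
  have f2 : continuous (fun p : P * R * R => p.1.2).
    move=> p; apply: (continuous_comp (f := fst) (g := snd)); [exact: cvg_fst|exact: cvg_snd].
  have f1 : continuous (fun p : P * R * R => p.1.1).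
    move=> p; apply: (continuous_comp (f := fst) (g := fst)); exact: cvg_fst.
  move=> p.
  have g1 : {for p, continuous (fun p : P * R * R => p.1.2 *: p.1.1)}.
    exact: (cvgZ (f2 p) (f1 p)).
  have g2 : {for p, continuous (fun p : P * R * R => (p.1.2 - p.2) *: p.1.1)}.
    exact: (cvgZ (cvgB (f2 p) cvg_snd) (f1 p)).
  exact: (ccaM (cca_comp g1 (uc _)) (ccaC (cca_comp g2 (uc _)))).
have cK : compact ([set x : P | `|x| <= M] `*` `[0, 1]%classic : set (P * R)).
  by apply: compact_setX; [exact: compact_square|exact: segment_compact].
have /compact_near_coveringP /(_ R (nbhs (0 : R)) (fun e xs => 0 < cre (q xs e))) := cK.
have seg (x : P) (s : R) : `|x| <= M -> 0 <= s <= 1 -> `|s *: x| <= M.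
  move=> xM /andP[s0 s1]; rewrite normrZ ger0_norm //.
  by apply: le_trans xM; rewrite ler_piMl.
case.
  move=> [x s] [/= xM]; rewrite in_itv /= => s01.
  have [/cvgr_gt h _] := qc ((x, s), 0).
  apply: (h 0); rewrite /q /= subr0 creM creC cimC mulrN opprK -!expr2.
  by apply: sqn_gt0; apply: u0; apply: seg.
move=> e /= e0 he.
pose N := (Num.trunc (e^-1)).+1.
have N0 : (0 : R) < N%:R by rewrite ltr0n.
have eN : `|0 - N%:R^-1| < e.
  rewrite sub0r normrN gtr0_norm ?invr_gt0 // invf_plt ?posrE //.
  exact: truncnS_gt.
pose p (k : nat) (x : P) := (k%:R / N%:R) *: clamp M x.
pose r (k : nat) x := q (clamp M x, k.+1%:R / N%:R) N%:R^-1.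
have rE k x : r k x = u (p k.+1 x) * (u (p k x))^*.
  by rewrite /r /q /=; congr (_ * (u (_ *: _))^*); rewrite -natr1 mulrDl mul1r addrK.
have r0 k x : (k < N)%N -> 0 < cre (r k x).
  move=> kN; apply: (he _ eN); split => /=; first exact: clamp_norm.
  by rewrite in_itv /= divr_ge0 //= ler_pdivrMr // mul1r ler_nat.
have [a0 ua0] : exists a, pol (u 0) a by apply/pol_ex/u0; rewrite normr0 ltW.
pose th n x := a0 + \sum_(k < n) atan (cim (r k x) / cre (r k x)).
have thp n x : (n <= N)%N -> pol (u (p n x)) (th n x).
  elim: n => [|n IH] nN; first by rewrite /p mul0r scale0r /th big_ord0 addr0.
  have {}IH := IH (ltnW nN).
  rewrite /th big_ord_recr /= addrA -/(th n x).
  (* u (p n x) times r n x is |u (p n x)|^2 u (p n.+1 x), so dividing by the squared modulus keeps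
     the argument. *)
  have [s s0 e1] := polM IH (pol_re (r0 n x nN)).
  have sq0 := sqn_gt0 (pol_neq0 IH).
  exists (s / sqn (u (p n x))); first by rewrite divr_gt0.
  have sc (z w : R[i]) : 0 < sqn w -> w * (z * w^*) = (sqn w)%:C * z.
    by move=> _; apply: ceq; rewrite !cE /sqn; ring.
  move: e1; rewrite rE sc // => e1.
  have : (sqn (u (p n x)))%:C != 0 by apply/eqP => -[] /eqP; rewrite gt_eqF.
  move=> /mulfI; apply; rewrite e1; apply: ceq; rewrite !cE /cre /cim /=; field; by rewrite gt_eqF.
have thc n x : (n <= N)%N -> {for x, continuous (th n)}.
  elim: n => [|n IH] nN.
    rewrite (_ : th 0%N = cst a0); first exact: cst_continuous.
    by apply/funext => y; rewrite /th big_ord0 addr0.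
  have cc (s : R) : s *: clamp M y @[y --> x] --> s *: clamp M x.
    exact: (cvgZ (cvg_cst s) (clamp_cont M0 (x := x))).
  have [rc ic] : cca (r n) x.
    have : cca (fun y => u (p n.+1 y) * (u (p n y))^*) x.
      exact: (ccaM (cca_comp (cc _) (uc _)) (ccaC (cca_comp (cc _) (uc _)))).
    by apply: cca_ext => y; rewrite rE.
  have r1 : cre (r n x) != 0 by rewrite gt_eqF // r0.
  have h : {for x, continuous (fun y => cim (r n y) / cre (r n y))}.
    exact: (cvgM ic (cvgV r1 rc)).
  have h' := continuous_comp h (@continuous_atan R _).
  rewrite (_ : th n.+1 = fun y => th n y + atan (cim (r n y) / cre (r n y))).
    exact: (cvgD (IH (ltnW nN)) h').
  by apply/funext => y; rewrite /th big_ord_recr /= addrA.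
exists (th N) => [x|x xM]; first exact: thc.
have := thp N x (leqnn _); rewrite /p divff ?gt_eqF // scale1r clamp_id //.
Qed.
End Lift.

(** * Winding numbers *)

Section Winding.
Variable R : realType.
Local Notation P := 'rV[R]_2.
Implicit Types (f g : R -> R[i]) (T : R) (n m : int).

Lemma twopi_gt0 : 0 < (pi : R) *+ 2.
Proof. by rewrite pmulrn_lgt0 ?pi_gt0. Qed.

Lemma int_between (k : int) : -1 < k%:~R :> R -> k%:~R < 1 :> R -> k = 0.
Proof.
move=> a b; have a' : (- 1 : int)%:~R < k%:~R :> R by rewrite mulrN1z.
have b' : k%:~R < (1 : int)%:~R :> R by [].
by move: a' b'; rewrite !ltr_int; lia.
Qed.

(** [th] is continuous on the whole line but is an argument of [f] on [0, T] only, so the relation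
    sees nothing of [f] elsewhere. *)
Definition wn T f n := exists th : R -> R, [/\ continuous th,
  forall t, 0 <= t <= T -> pol (f t) (th t) & th T = th 0 + pi *+ 2 * n%:~R].

Definition loop T f := [/\ ccont f, forall t, f (t + T) = f t & forall t, f t != 0].

Lemma ivt (d : R -> R) a b v : a <= b -> continuous d ->
  d a <= v <= d b \/ d b <= v <= d a -> exists2 c, a <= c <= b & d c = v.
Proof.
move=> ab dc h; have [||c] := @IVT R d a b v ab.
- exact: continuous_subspaceT.
- by case: h => /andP[h1 h2]; rewrite ge_min le_max h1 h2 ?orbT.
by rewrite in_itv /= => cab <-; exists c.
Qed.

(** Were the end values different multiples of 2 pi, the intermediate value theorem would produce a
    value 2 pi (m + 1/2). This discreteness is behind both uniqueness and homotopy invariance of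
    winding numbers. *)
Lemma int_const (d : R -> R) T : 0 <= T -> continuous d ->
  (forall t, 0 <= t <= T -> exists k : int, d t = pi *+ 2 * k%:~R) -> d T = d 0.
Proof.
move=> T0 dc h; have p0 := twopi_gt0.
have [a da] : exists k : int, d 0 = pi *+ 2 * k%:~R by apply: h; rewrite lexx.
have [b db] : exists k : int, d T = pi *+ 2 * k%:~R by apply: h; rewrite lexx andbT.
have half (m : int) : (exists2 c, 0 <= c <= T & d c = pi *+ 2 * (m%:~R + 2^-1)) -> False.
  move=> [c cT]; have [k ->] := h c cT => /mulfI; rewrite gt_eqF // => /(_ isT) e.
  have : (m%:~R : R) < k%:~R by rewrite e; lra.
  have : (k%:~R : R) < (m + 1)%:~R by rewrite e intrD; lra.
  by rewrite !ltr_int; lia.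
have step (x y : int) : x < y ->
    (pi : R) *+ 2 * x%:~R <= pi *+ 2 * (x%:~R + 2^-1) <= (pi : R) *+ 2 * y%:~R.
  rewrite -lezD1 -(ler_int R) intrD => xy.
  by apply/andP; split; rewrite ler_pM2l //; lra.
have [ab|ab|ab] := ltgtP a b; last by rewrite da db ab.
  by case: (half a); apply: ivt => //; left; rewrite da db step.
by case: (half b); apply: ivt => //; right; rewrite da db step.
Qed.

Lemma wn_uniq T f n m : 0 <= T -> wn T f n -> wn T f m -> n = m.
Proof.
move=> T0 [a [ac ap an]] [b [bc bp bm]].
have : a T - b T = a 0 - b 0.
  apply: (@int_const (fun t => a t - b t)) => // [t|t h]; first exact: cvgB (ac t) (bc t).
  by have [k ->] := pol_uniq (ap t h) (bp t h); exists k; rewrite addrC addKr.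
rewrite an bm => e.
have : (pi : R) *+ 2 * n%:~R = pi *+ 2 * m%:~R by lra.
by move/mulfI; rewrite gt_eqF ?twopi_gt0 // => /(_ isT) /eqP; rewrite eqr_int => /eqP.
Qed.

Lemma wn_ext T f g n : (forall t, 0 <= t <= T -> f t = g t) -> wn T f n -> wn T g n.
Proof. by move=> e [a [ac ap an]]; exists a; split=> // t h; rewrite -e //; apply: ap. Qed.

Lemma wnM T f g n m : wn T f n -> wn T g m -> wn T (fun t => f t * g t) (n + m).
Proof.
move=> [a [ac ap an]] [b [bc bp bm]]; exists (fun t => a t + b t); split.
- by move=> t; exact: cvgD (ac t) (bc t).
- by move=> t h; apply: polM; [apply: ap|apply: bp].
- by rewrite an bm intrD; ring.
Qed.

Lemma wnC T f n : wn T f n -> wn T (fun t => (f t)^*) (- n).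
Proof.
move=> [a [ac ap an]]; exists (fun t => - a t); split.
- by move=> t; exact: cvgN (ac t).
- by move=> t h; apply: polC; apply: ap.
- by rewrite an mulrNz; ring.
Qed.

Lemma wnN T f n : wn T f n -> wn T (fun t => - f t) n.
Proof.
move=> [a [ac ap an]]; exists (fun t => a t + pi); split.
- by move=> t; exact: cvgD (ac t) (cvg_cst pi).
- by move=> t h; apply: polN; apply: ap.
- by rewrite an; ring.
Qed.

Lemma wn_scale T (r : R -> R) f n : (forall t, 0 <= t <= T -> 0 < r t) ->
  wn T f n -> wn T (fun t => (r t)%:C * f t) n.
Proof.
move=> r0 [a [ac ap an]]; exists a; split=> // t h.
by apply: pol_scale; [apply: r0|apply: ap].
Qed.

Lemma wn_cst T (c : R[i]) : c != 0 -> wn T (fun _ => c) 0.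
Proof.
move=> /pol_ex[a ca]; exists (fun _ => a); split=> //.
  by move=> t; exact: cvg_cst.
by rewrite mulr0 addr0.
Qed.

Lemma wn_re T f : ccont f -> (forall t, 0 < cre (f t)) -> f T = f 0 -> wn T f 0.
Proof.
move=> fc fp fT; exists (fun t => atan (cim (f t) / cre (f t))); split.
- move=> t; have [rc ic] := fc t.
  have f0 : cre (f t) != 0 by rewrite gt_eqF.
  have h : {for t, continuous (fun y => cim (f y) / cre (f y))}.
    exact: (cvgM ic (cvgV f0 rc)).
  exact: (continuous_comp h (@continuous_atan R _)).
- by move=> t _; apply: pol_re.
- by rewrite fT mulr0 addr0.
Qed.

(** One-variable case of [plane_lift]: [f] is read as a map of the first coordinate. *)
Lemma path_lift T f : 0 < T -> ccont f -> (forall t, f t != 0) ->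
  exists2 th : R -> R, continuous th & forall t, 0 <= t <= T -> pol (f t) (th t).
Proof.
move=> T0 fc f0; pose u (x : P) := f (x 0 0).
have uc : ccont u.
  by move=> x; apply: (@cca_comp R _ _ (fun y : P => y 0 0) f) => //; exact: coord_continuous.
have [|th thc thp] := @plane_lift R u T T0 uc; first by move=> x _; exact: f0.
exists (fun t => th (pt t 0)).
  move=> t; have h : {for t, continuous (fun y : R => pt y 0)}.
    by apply: pt_cont; [exact: cvg_id|exact: cvg_cst].
  exact: (continuous_comp h (thc _)).
move=> t /andP[t0 tT]; rewrite -[t in f t](pt0 t 0); apply: thp.
by rewrite norm_pt normr0 ger0_norm // ge_max tT ltW.
Qed.

Lemma wn_ex T f : 0 < T -> loop T f -> exists n, wn T f n.
Proof.
move=> T0 [fc fT f0]; have [th thc thp] := path_lift T0 fc f0.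
have p1 : pol (f 0) (th T) by rewrite -(fT 0) add0r; apply: thp; rewrite lexx ltW.
have p0 : pol (f 0) (th 0) by apply: thp; rewrite lexx ltW.
by have [k e] := pol_uniq p1 p0; exists k, th.
Qed.

Definition clamp01 (s : R) : R := Num.max 0 (Num.min s 1).

Lemma clamp01P s : 0 <= clamp01 s <= 1.
Proof. by rewrite /clamp01 le_max lexx /= ge_max ler01 /= ge_min lexx orbT. Qed.

Lemma clamp01_id s : 0 <= s <= 1 -> clamp01 s = s.
Proof. by move=> /andP[s0 s1]; rewrite /clamp01 min_l // max_r. Qed.

Lemma clamp01_cont : continuous clamp01.
Proof.
move=> s.
have h : {for s, continuous (fun x : R => - Num.max (- x) (- 1))}.
  apply: cvgN; apply: (@continuous_max R R (fun x => - x) (cst (-1)) s).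
    by apply: cvgN; exact: cvg_id.
  exact: cst_continuous.
have := @continuous_max R R (cst 0) (fun x => - Num.max (- x) (- 1)) s
   (@cst_continuous _ _ _ _) h.
rewrite (_ : _ \max _ = clamp01) //.
by apply/funext => x /=; rewrite /clamp01 -oppr_min !opprK.
Qed.

Lemma square_lift (H : R * R -> R[i]) M : 0 < M -> ccont H ->
  (forall t s, `|t| <= M -> `|s| <= M -> H (t, s) != 0) ->
  exists2 th : R * R -> R, continuous th &
    forall t s, `|t| <= M -> `|s| <= M -> pol (H (t, s)) (th (t, s)).
Proof.
move=> M0 Hc H0; pose u (x : P) := H (x 0 0, x 0 1).
have uc : ccont u.
  move=> x; apply: (@cca_comp R _ _ (fun y : P => (y 0 0, y 0 1)) H) => //.
  exact: (cvg_pair (@coord_continuous R 1 2 0 0 x) (@coord_continuous R 1 2 0 1 x)).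
have [|th thc thp] := @plane_lift R u M M0 uc.
  by move=> x /plane_normP[a b]; exact: H0.
exists (fun ts => th (pt ts.1 ts.2)).
  move=> ts; have h : {for ts, continuous (fun y : R * R => pt y.1 y.2)}.
    by apply: pt_cont; [exact: cvg_fst|exact: cvg_snd].
  exact: (continuous_comp h (thc _)).
move=> t s tM sM; have := thp (pt t s).
by rewrite /u pt0 pt1; apply; rewrite norm_pt ge_max tM.
Qed.

(** For an argument of H on a square, the increment from t = 0 to t = T is continuous in s with
    values in 2 pi Z, hence constant. [clamp01] replaces H outside the range of s where it is known
    not to vanish. *)
Lemma wn_homotopy T (H : R * R -> R[i]) n : 0 < T -> ccont H ->
  (forall t s, 0 <= s <= 1 -> H (t, s) != 0) ->
  (forall s, 0 <= s <= 1 -> H (T, s) = H (0, s)) ->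
  wn T (fun t => H (t, 0)) n -> wn T (fun t => H (t, 1)) n.
Proof.
move=> T0 Hc H0 HT w.
pose G (ts : R * R) := H (ts.1, clamp01 ts.2).
have Gc : ccont G.
  move=> ts; apply: (@cca_comp R _ _ (fun y : R * R => (y.1, clamp01 y.2)) H) => //.
  have c2 : {for ts, continuous (fun y : R * R => clamp01 y.2)}.
    exact: (continuous_comp (f := snd) cvg_snd (@clamp01_cont _)).
  exact: (cvg_pair cvg_fst c2).
have M0 : 0 < Num.max T 1 by rewrite lt_max T0.
have [|th thc thp] := @square_lift G _ M0 Gc.
  by move=> t s _ _; apply: H0; exact: clamp01P.
have thq t s : 0 <= t <= T -> 0 <= s <= 1 -> pol (H (t, s)) (th (t, s)).
  move=> /andP[t0 t1] s01; have := thp t s; rewrite /G /= clamp01_id //; apply.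
    by rewrite ger0_norm // le_max t1.
  by case/andP: s01 => s0 s1; rewrite ger0_norm // le_max s1 orbT.
have cs t : continuous (fun s => th (t, s)).
  move=> s; apply: (continuous_comp (f := fun s => (t, s))) (thc _).
  exact: (cvg_pair (cvg_cst t) cvg_id).
have ct s : continuous (fun t => th (t, s)).
  move=> t; apply: (continuous_comp (f := fun t => (t, s))) (thc _).
  exact: (cvg_pair cvg_id (cvg_cst s)).
have I0 : (0 : R) <= 0 <= T by rewrite lexx ltW.
have IT : 0 <= T <= T by rewrite lexx ltW.
have J0 : 0 <= (0 : R) <= 1 by rewrite lexx ler01.
have J1 : 0 <= (1 : R) <= 1 by rewrite lexx ler01.
have dz s : 0 <= s <= 1 -> exists k : int, th (T, s) - th (0, s) = pi *+ 2 * k%:~R.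
  move=> s01; have := thq T s IT s01; rewrite HT // => p1.
  by have [k ->] := pol_uniq p1 (thq 0 s I0 s01); exists k; rewrite addrC addKr.
have d01 : th (T, 1) - th (0, 1) = th (T, 0) - th (0, 0).
  apply: (@int_const (fun s => th (T, s) - th (0, s))) => // s.
  exact: cvgB (cs _ _) (cs _ _).
have [m e0] := dz 0 J0.
have wm : wn T (fun t => H (t, 0)) m.
  exists (fun t => th (t, 0)); split=> //; first by move=> t h; exact: thq.
  by rewrite -e0; ring.
rewrite (wn_uniq (ltW T0) w wm); exists (fun t => th (t, 1)); split=> //.
  by move=> t h; exact: thq.
by rewrite -e0 -d01; ring.
Qed.

(** For an argument of H on the square, the increment along the diagonal is the one along two sides
    through the corner (0, T); periodicity moves the side at height T to height 0. *)
Lemma wn_torus T (H : R * R -> R[i]) n m : 0 < T -> ccont H ->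
  (forall t s, H (t, s) != 0) ->
  (forall t s, H (t + T, s) = H (t, s)) -> (forall t s, H (t, s + T) = H (t, s)) ->
  wn T (fun t => H (t, 0)) n -> wn T (fun s => H (0, s)) m ->
  wn T (fun t => H (t, t)) (n + m).
Proof.
move=> T0 Hc H0 H1 H2 wt ws.
have [|th thc thp] := @square_lift H _ T0 Hc; first by move=> t s _ _; apply: H0.
have thq t s : 0 <= t <= T -> 0 <= s <= T -> pol (H (t, s)) (th (t, s)).
  by move=> /andP[t0 t1] /andP[s0 s1]; apply: thp; rewrite ger0_norm.
have I0 : (0 : R) <= 0 <= T by rewrite lexx ltW.
have IT : 0 <= T <= T by rewrite lexx ltW.
have cc (a b : R -> R) : continuous a -> continuous b -> continuous (fun t => th (a t, b t)).
  move=> ac bc t; apply: (continuous_comp (f := fun t => (a t, b t))) (thc _).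
  exact: (cvg_pair (ac t) (bc t)).
have ci : continuous (fun t : R => t) by move=> t; exact: cvg_id.
have c1 (a : R) : continuous (fun t : R => a) by move=> t; exact: cvg_cst.
have [k e1] : exists k : int, th (T, T) = th (0, T) + pi *+ 2 * k%:~R.
  by apply: pol_uniq (thq _ _ I0 IT); rewrite -(H1 0) add0r; exact: thq.
have [l e2] : exists k : int, th (0, T) = th (0, 0) + pi *+ 2 * k%:~R.
  by apply: pol_uniq (thq _ _ I0 I0); rewrite -(H2 0) add0r; exact: thq.
have w1 : wn T (fun t => H (t, 0)) k.
  exists (fun t => th (t, T)); split=> //; first exact: cc.
  by move=> t h; rewrite -(H2 t) add0r; exact: thq.
have w2 : wn T (fun t => H (0, t)) l.
  by exists (fun t => th (0, t)); split=> //; [exact: cc|move=> t h; exact: thq].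
rewrite (wn_uniq (ltW T0) wt w1) (wn_uniq (ltW T0) ws w2).
exists (fun t => th (t, t)); split; first exact: cc.
  by move=> t h; exact: thq.
by rewrite e1 e2 intrD; ring.
Qed.

Lemma wn_shift T f n a : 0 < T -> loop T f -> wn T f n -> wn T (fun t => f (t + a)) n.
Proof.
move=> T0 [fc fT f0] w.
have := @wn_homotopy T (fun ts => f (ts.1 + ts.2 * a)) n T0.
have -> : (fun t => f (t + 1 * a)) = (fun t => f (t + a)).
  by apply/funext => t; rewrite mul1r.
apply=> //=.
- move=> ts; apply: (@cca_comp R _ _ (fun ts : R * R => ts.1 + ts.2 * a) f) => //.
  exact: (cvgD cvg_fst (cvgM cvg_snd (cvg_cst a))).
- by move=> s _; rewrite /= add0r addrC fT.
- by apply: wn_ext w => t _; rewrite mul0r addr0.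
Qed.

(* Along a path in a closed half-plane a lift of the argument cannot leave the
   corresponding interval of length pi. *)
Lemma lift_halfplane (th : R -> R) f a b : a <= b -> continuous th ->
  (forall t, a <= t <= b -> pol (f t) (th t) /\ 0 <= cre (f t)) ->
  exists k : int, forall t, a <= t <= b ->
    - (pi / 2) <= th t - pi *+ 2 * k%:~R <= pi / 2.
Proof.
move=> ab thc h; have p0 := @pi_gt0 R; have pp := twopi_gt0.
(* This k puts th a - 2 pi k into [- pi, pi). *)
pose x := (th a + pi) / (pi *+ 2); pose k := Num.floor x; exists k.
have cosk (s : R) : cos (s - pi *+ 2 * k%:~R) = cos s.
  by have [c _] := cos_sinD2piz s (- k); rewrite mulrNz mulrN in c.
have /andP[k1 k2] := floor_itv x.
have cge t : a <= t <= b -> 0 <= cos (th t - pi *+ 2 * k%:~R).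
  by move=> /h [[r r0 ->]]; rewrite cosk /cre /= pmulr_rge0.
have clt (y : R) : pi / 2 < y <= pi -> cos y < 0.
  move=> /andP[y1 y2]; rewrite -(cos_pihalf R).
  by rewrite ltr_cos // in_itv /=; lra.
have clt' (y : R) : - pi <= y < - (pi / 2) -> cos y < 0.
  by move=> /andP[y1 y2]; rewrite -cosN clt //; lra.
have wa : - pi <= th a - pi *+ 2 * k%:~R <= pi.
  move: k1 k2; rewrite /x ler_pdivlMr // ltr_pdivrMr // intrD => k1 k2.
  by move: k1 k2; rewrite mulr2n; set kk := Num.floor _; move=> *; rewrite /k; apply/andP; split; lra.
have aab : a <= a <= b by rewrite lexx.
have wa' : - (pi / 2) <= th a - pi *+ 2 * k%:~R <= pi / 2.
  have c := cge a aab; case/andP: wa => w1 w2.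
  apply/andP; split; rewrite leNgt; apply/negP => u.
    by have := clt' _ (introT andP (conj w1 u)); rewrite ltNge c.
  by have := clt _ (introT andP (conj u w2)); rewrite ltNge c.
move=> t /andP[at_ tb]; rewrite leNgt [X in _ && X]leNgt -negb_or.
have sub c : a <= c <= t -> a <= c <= b.
  by move=> /andP[-> /le_trans]; apply.
have dc : continuous (fun t => th t - pi *+ 2 * k%:~R).
  by move=> s; exact: (cvgB (thc s) (cvg_cst _)).
case/andP: wa' => w1 w2.
apply/negP => /orP[u|u].
  (* Capping the target at - pi keeps it in [- pi, - pi / 2), where the cosine is negative, however
     far the lift has drifted by time t. *)
  have [|c /sub/cge c1 c2] := @ivt _ a t (Num.max (th t - pi *+ 2 * k%:~R) (- pi)) at_ dc.
    right; rewrite le_max lexx ge_max /=; apply/andP; split; lra.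
  move: c1; rewrite c2 leNgt clt' //.
  by rewrite le_max lexx orbT gt_max u /=; lra.
have [|c /sub/cge c1 c2] := @ivt _ a t (Num.min (th t - pi *+ 2 * k%:~R) pi) at_ dc.
  left; rewrite ge_min lexx le_min /= andbT; apply/andP; split; lra.
move: c1; rewrite c2 leNgt clt //.
by rewrite ge_min lexx orbT lt_min u /=; lra.
Qed.
End Winding.

(** * Winding numbers of loops confined to successive half-planes *)

Section Crossing.
Variable R : realType.
Implicit Types (f w : R -> R[i]) (T : R).

Lemma cos_pihalf_eq (y : R) : - (pi / 2) <= y <= pi / 2 -> cos y = 0 ->
  y = pi / 2 \/ y = - (pi / 2).
Proof.
move=> /andP[a b] c; have [/eqP->|yn] := boolP (y == pi / 2); first by left.
have [/eqP->|ym] := boolP (y == - (pi / 2)); first by right.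
have : 0 < cos y by apply: cos_gt0_pihalf; rewrite !lt_neqAle a b yn eq_sym ym.
by rewrite c ltxx.
Qed.

Lemma cos_subpiz (s : R) (k : int) : cos (s - pi *+ 2 * k%:~R) = cos s.
Proof. by have [c _] := cos_sinD2piz s (- k); rewrite mulrNz mulrN in c. Qed.

Lemma sin_subpiz (s : R) (k : int) : sin (s - pi *+ 2 * k%:~R) = sin s.
Proof. by have [_ c] := cos_sinD2piz s (- k); rewrite mulrNz mulrN in c. Qed.

(** On [0, T / 2] the argument stays in an interval of length pi and is at an end of it at both
    times 0 and T / 2, since f is imaginary there. As f (T / 2) = - f 0 the two ends differ, so the
    increment is pi or - pi; antiperiodicity doubles it. *)
Lemma wn_antiperiodic T f : 0 < T -> loop T f -> (forall t, f (t + T / 2) = - f t) ->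
  cre (f 0) = 0 -> (forall t, 0 <= t <= T / 2 -> 0 <= cre (f t)) ->
  wn T f 1 \/ wn T f (- 1).
Proof.
move=> T0 [fc fT f0] fA r0 rp; have [th thc thp] := path_lift T0 fc f0.
have h0 : 0 <= T / 2 by rewrite divr_ge0 ?ltW.
have [|k hk] := @lift_halfplane R th f 0 (T / 2) h0 thc.
  move=> t th2; split; last exact: rp.
  by apply: thp; case/andP: th2 => -> /=; lra.
have p0 : pol (f 0) (th 0) by apply: thp; rewrite lexx ltW.
have p1 : pol (f (T / 2)) (th (T / 2)) by apply: thp; lra.
have fh : f (T / 2) = - f 0 by rewrite -(fA 0) add0r.
have [y0|y0] : th 0 - pi *+ 2 * k%:~R = pi / 2 \/ th 0 - pi *+ 2 * k%:~R = - (pi / 2).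
- apply: cos_pihalf_eq; first by apply: hk; rewrite lexx.
  case: p0 => r rr e; move: r0; rewrite e /cre /= => /eqP; rewrite mulf_eq0 gt_eqF //=.
  by rewrite cos_subpiz => /eqP.
all: have [y1|y1] : th (T / 2) - pi *+ 2 * k%:~R = pi / 2 \/
      th (T / 2) - pi *+ 2 * k%:~R = - (pi / 2).
1,4: apply: cos_pihalf_eq; first by apply: hk; rewrite lexx andbT.
1,2: case: p1 => r rr e; move: r0; rewrite -[f 0]opprK -fh e /cre /= => /eqP;
  rewrite oppr_eq0 mulf_eq0 gt_eqF //= => /eqP; by rewrite cos_subpiz.
(* th (t + T / 2) - th t - pi takes values in 2 pi Z, so the two halves of the period have equal
   increments. *)
all: have d : th T - th (T / 2) = th (T / 2) - th 0.
1,3,5,7: have := @int_const R (fun t => th (t + T / 2) - th t - pi) (T / 2) h0;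
  rewrite -splitr add0r => H; apply: (addIr (- pi)); apply: H.
1,3,5,7: move=> t; apply: cvgB; last exact: cvg_cst;
  apply: cvgB; last exact: thc;
  apply: (continuous_comp (f := fun t => t + T / 2)) (thc _);
  exact: (cvgD cvg_id (cvg_cst _)).
1-4: move=> t /andP[t0 t1]; have q1 : pol (f (t + T / 2)) (th (t + T / 2)) by [apply: thp; lra];
  have q0 : pol (f t) (th t) by [apply: thp; lra];
  move: q1; rewrite fA => q1; have [j ->] := pol_uniq q1 (polN q0);
  exists j; ring.
(* Equal reduced arguments at 0 and T / 2 would put f 0 and its opposite on the same half of the
   imaginary axis. *)
- exfalso; case: p0 p1 => r rr e [s ss e']; move: fh; rewrite e e' => -[_].
  have -> : sin (th 0) = 1 by rewrite -(sin_subpiz _ k) y0 sin_pihalf.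
  have -> : sin (th (T / 2)) = 1 by rewrite -(sin_subpiz _ k) y1 sin_pihalf.
  lra.
- right; exists th; split=> //; rewrite mulrN1z mulr2n; lra.
- left; exists th; split=> //; rewrite mulr2n /= mulr1; lra.
- exfalso; case: p0 p1 => r rr e [s ss e']; move: fh; rewrite e e' => -[_].
  have -> : sin (th 0) = -1 by rewrite -(sin_subpiz _ k) y0 sinN sin_pihalf.
  have -> : sin (th (T / 2)) = -1 by rewrite -(sin_subpiz _ k) y1 sinN sin_pihalf.
  lra.
Qed.

Lemma creMi (z : R[i]) : cre ((0 +i* 1) * z) = - cim z.
Proof. by rewrite creM /cre /cim /=; ring. Qed.

Lemma creMNi (z : R[i]) : cre ((0 +i* -1) * z) = cim z.
Proof. by rewrite creM /cre /cim /=; ring. Qed.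

Lemma pol_i : pol (0 +i* 1 : R[i]) (pi / 2).
Proof. by exists 1 => //; rewrite cos_pihalf sin_pihalf mulr0 mulr1. Qed.

Lemma pol_Ni : pol (0 +i* -1 : R[i]) (- (pi / 2)).
Proof. by exists 1 => //; rewrite cosN sinN cos_pihalf sin_pihalf mulr0 mul1r. Qed.

(** The loop leaves the negative real axis through the upper half-plane, crosses the right one and
    returns through the lower one, so its argument falls from pi to - pi. Factors - i and i turn the
    upper and lower half-planes into the right one, where [lift_halfplane] applies. *)
Lemma wn_cross T w d : 0 < d -> d <= T - d -> loop T w ->
  cre (w 0) < 0 -> cim (w 0) = 0 ->
  (forall t, 0 <= t <= d -> 0 <= cim (w t)) ->
  (forall t, d <= t <= T - d -> 0 <= cre (w t)) ->
  (forall t, T - d <= t <= T -> cim (w t) <= 0) -> wn T w (- 1).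
Proof.
move=> d0 dT [wc wT w0] rn i0 h1 h2 h3; have T0 : 0 < T by lra.
have [th thc thp] := path_lift T0 wc w0.
have c1 : continuous (fun t => - (pi / 2) + th t).
  by move=> t; exact: (cvgD (cvg_cst _) (thc t)).
have c3 : continuous (fun t => pi / 2 + th t).
  by move=> t; exact: (cvgD (cvg_cst _) (thc t)).
have [|k1 hk1] := @lift_halfplane R _ (fun t => (0 +i* -1) * w t) 0 d (ltW d0) c1.
  move=> t ht; rewrite creMNi h1 //; split=> //; apply: (polM pol_Ni).
  by apply: thp; case/andP: ht => *; lra.
have [|k2 hk2] := @lift_halfplane R _ w d (T - d) dT thc.
  by move=> t ht; rewrite h2 //; split=> //; apply: thp; case/andP: ht => *; lra.
have Td : T - d <= T by lra.
have [|k3 hk3] := @lift_halfplane R _ (fun t => (0 +i* 1) * w t) (T - d) T Td c3.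
  move=> t ht; rewrite creMi oppr_ge0 h3 //; split=> //; apply: (polM pol_i).
  by apply: thp; case/andP: ht => *; lra.
have p0 := @pi_gt0 R.
(* At time d the lift lies in [2 pi k1, 2 pi k1 + pi] and in [2 pi k2 - pi / 2, 2 pi k2 + pi / 2];
   these meet only if k1 = k2. *)
have e12 : k1 = k2.
  have /andP[a1 a2] := hk1 d (introT andP (conj (ltW d0) (lexx d))).
  have /andP[b1 b2] := hk2 d (introT andP (conj (lexx d) dT)).
  apply/eqP; rewrite -subr_eq0; apply/eqP; apply: (@int_between R); rewrite intrB.
    by rewrite -(ltr_pM2l (twopi_gt0 R)) mulrBr mulrN1; lra.
  by rewrite -(ltr_pM2l (twopi_gt0 R)) mulrBr mulr1; lra.
have e23 : k3 = k2.
  have /andP[a1 a2] := hk3 (T - d) (introT andP (conj (lexx _) Td)).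
  have /andP[b1 b2] := hk2 (T - d) (introT andP (conj dT (lexx _))).
  apply/eqP; rewrite -subr_eq0; apply/eqP; apply: (@int_between R); rewrite intrB.
    by rewrite -(ltr_pM2l (twopi_gt0 R)) mulrBr mulrN1; lra.
  by rewrite -(ltr_pM2l (twopi_gt0 R)) mulrBr mulr1; lra.
have neg z a (y : R) : pol z a -> cre z < 0 -> cim z = 0 -> y = a \/ y = - a -> 
   cos y < 0 /\ sin y = 0.
  move=> [r r0 ->]; rewrite /cre /cim /= pmulr_rlt0 // => c /eqP; rewrite mulf_eq0 gt_eqF //=.
  by move=> /eqP s [->|->] //; rewrite cosN sinN s oppr0.
have q0 : pol (w 0) (th 0) by apply: thp; rewrite lexx ltW.
have qT : pol (w 0) (th T) by rewrite -(wT 0) add0r; apply: thp; rewrite lexx ltW.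
have edge (y : R) : - (pi / 2) <= y - pi / 2 <= pi / 2 -> cos y < 0 -> sin y = 0 -> y = pi.
  move=> ya yc ys; have : y - pi / 2 = pi / 2 \/ y - pi / 2 = - (pi / 2).
    by apply: cos_pihalf_eq => //; rewrite cosBpihalf.
  case=> e; first by lra.
  by move: yc; rewrite (_ : y = 0); [rewrite cos0 ltr10|lra].
have f0 : th 0 - pi *+ 2 * k1%:~R = pi.
  have := hk1 0; rewrite lexx ltW // => /(_ isT) b0.
  have [u v] := neg _ _ _ q0 rn i0 (or_introl erefl).
  apply: edge; rewrite ?cos_subpiz ?sin_subpiz //; lra.
have fT : pi *+ 2 * k3%:~R - th T = pi.
  have := hk3 T; rewrite lexx andbT Td => /(_ isT) b0.
  have [u v] := neg _ _ _ qT rn i0 (or_introl erefl).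
  rewrite -opprB; apply: edge; rewrite ?cosN ?sinN ?cos_subpiz ?sin_subpiz ?v ?oppr0 //; lra.
exists th; split=> //; rewrite mulrN1z; rewrite e12 in f0; rewrite e23 in fT.
by rewrite mulr2n in f0 fT *; lra.
Qed.
End Crossing.

(** * The limit cycle *)

Section ODE.
Variable R : realType.
Local Notation P := 'rV[R]_2.
Variables (psi : P -> P) (psiC1 : C1_field psi).

Lemma ord2_1 : lift ord0 ord0 = 1 :> 'I_2. Proof. exact/val_inj. Qed.

Lemma dotvE (u v : P) : dotv u v = u 0 0 * v 0 0 + u 0 1 * v 0 1.
Proof. by rewrite /dotv !big_ord_recl big_ord0 addr0 ord2_1. Qed.

Lemma mulmx2E (v : P) (A : 'M[R]_2) j : (v *m A) 0 j = v 0 0 * A 0 j + v 0 1 * A 1 j.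
Proof. by rewrite mxE !big_ord_recl big_ord0 addr0 ord2_1. Qed.

Lemma deriv_coord (x : R -> P) t v : is_derive t (1 : R) x v ->
  forall j, is_derive t (1 : R) (fun s => x s 0 j) (v 0 j).
Proof.
move=> xv j; have dx : derivable x t 1 by [].
have dj : derivable (fun s => x s 0 j) t 1 by apply/(derivable_mxP x t 1).1.
apply: DeriveDef => //; have := derive_mx dx; rewrite derive_val => ->.
by rewrite mxE.
Qed.

Lemma deriv_cont (V : normedModType R) (x : R -> V) t v :
  is_derive t (1 : R) x v -> {for t, continuous x}.
Proof.
by move=> xv; apply: differentiable_continuous; apply/derivable1_diffP.
Qed.

Lemma deriv_line (q v : P) s :
  is_derive s (1 : R) (fun s => psi (q + s *: v)) (v *m jacobian psi (q + s *: v)).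
Proof.
have dp : differentiable psi (q + s *: v) by case: psiC1.
have dv : derivable psi (q + s *: v) v by exact: diff_derivable.
have e : (fun h : R => h^-1 *: ((fun s => psi (q + s *: v)) (h *: (1 : R) + s) - psi (q + s *: v)))
   = (fun h : R => h^-1 *: (psi (h *: v + (q + s *: v)) - psi (q + s *: v))).
  apply/funext => h; congr (_ *: (psi _ - _)).
  have h1 : h *: (1 : R) = h by exact: mulr1.
  by rewrite h1 scalerDl addrCA.
apply: DeriveDef.
  by rewrite /derivable /= e.
by rewrite -(deriveEjacobian v dp) /derive /= e.
Qed.

Lemma compact_bound (X : topologicalType) (K : set X) (f : X -> R) :
  compact K -> continuous f -> exists2 B, 0 <= B & forall x, K x -> `|f x| <= B.
Proof.
move=> cK cf; have [->|/set0P K0] := eqVneq K set0; first by exists 0.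
have [|c _ hc] := @compact_EVT_max _ _ (fun x => `|f x|) K K0 cK.
  apply: continuous_subspaceT => x.
  exact: (continuous_comp (g := fun y : R => `|y|) (cf x) (@norm_continuous _ _ _)).
by exists `|f c| => // x Kx; apply: hc; rewrite inE.
Qed.

(** Mean value theorem for s |-> <p - q, psi (q + s (p - q))>, whose derivative is a quadratic form
    in p - q with coefficients bounded on the convex square |.| <= M. Pairing with p - q keeps the
    estimate scalar, in the form that the derivative of |x - y|^2 calls for. *)
Lemma one_sided_lipschitz M : exists2 L, 0 <= L & forall p q : P, `|p| <= M -> `|q| <= M ->
  dotv (p - q) (psi p - psi q) <= L * dotv (p - q) (p - q).
Proof.
have ce i j : continuous (fun p : P => jacobian psi p i j).
  move=> p; apply: (continuous_comp (g := fun A : 'M[R]_2 => A i j)).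
    by case: psiC1 => _; apply.
  exact: coord_continuous.
have [B B0 hB] : exists2 B, 0 <= B & forall p : P, `|p| <= M -> forall i j, `|jacobian psi p i j| <= B.
  have h i j := compact_bound (@compact_square R M) (ce i j).
  have [a a0 ha] := h 0 0; have [b b0 hb] := h 0 1.
  have [c c0 hc] := h 1 0; have [d d0 hd] := h 1 1.
  exists (a + b + c + d); first by lra.
  move=> p pM i j; have := ha p pM; have := hb p pM; have := hc p pM; have := hd p pM.
  have I2 (k : 'I_2) : k = 0 \/ k = 1.
    by case: k => [[|[|]]] // ?; [left|right]; apply/val_inj.
  by case: (I2 i) => ->; case: (I2 j) => ->; lra.
exists (2 * B); first by lra.
move=> p q pM qM; set v := p - q.
pose phi s := dotv v (psi (q + s *: v)).
pose dphi s := dotv v (v *m jacobian psi (q + s *: v)).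
have dd s : is_derive s (1 : R) phi (dphi s).
  have h := deriv_coord (deriv_line q v s).
  have -> : phi = (fun s => v 0 0 * psi (q + s *: v) 0 0 + v 0 1 * psi (q + s *: v) 0 1).
    by apply/funext => r; rewrite /phi dotvE.
  rewrite /dphi dotvE.
  exact: (is_deriveD (is_deriveZ (v 0 0) (h 0)) (is_deriveZ (v 0 1) (h 1))).
have pc : {within `[0, 1], continuous phi}.
  by apply: continuous_subspaceT => x; exact: deriv_cont (dd x).
have [c] := MVT_segment ler01 (fun x _ => dd x) pc.
rewrite in_itv /= => /andP[c0 c1]; rewrite subr0 mulr1 => e.
have -> : dotv v (psi p - psi q) = phi 1 - phi 0.
  rewrite /phi scale1r scale0r addr0 [q + v]addrC subrK /dotv -sumrB.
  by apply: eq_bigr => i _; rewrite !mxE mulrBr.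
rewrite e /dphi.
have cM : `|q + c *: v| <= M.
  have -> : q + c *: v = (1 - c) *: q + c *: p.
    by rewrite /v scalerBr scalerBl scale1r; rewrite addrCA addrC -addrA [- _ + _]addrC.
  apply: le_trans (ler_normD _ _) _; rewrite !normrZ !ger0_norm ?subr_ge0 //.
  have := ler_wpM2l c0 pM; have := @ler_wpM2l _ (1 - c) _ _ _ qM; rewrite subr_ge0 => /(_ c1).
  lra.
have := hB _ cM; set J := jacobian _ _ => hJ.
rewrite !dotvE !mulmx2E.
have := hJ 0 0; have := hJ 0 1; have := hJ 1 0; have := hJ 1 1; rewrite !ler_norml.
set a := v 0 0; set b := v 0 1.
move=> /andP[_ j4] /andP[j31 j32] /andP[j21 j22] /andP[_ j1].
have t1 : a * a * J 0 0 <= a * a * B by apply: ler_wpM2l => //; rewrite -expr2 sqr_ge0.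
have t4 : b * b * J 1 1 <= b * b * B by apply: ler_wpM2l => //; rewrite -expr2 sqr_ge0.
(* With s = J 0 1 + J 1 0 and |s| <= 2 B, the inequality (a + b)^2 (2 B - s) + (a - b)^2 (2 B + s)
   >= 0 reads 4 a b s <= 4 B (a^2 + b^2). *)
have t3 : 2 * (a * b * (J 0 1 + J 1 0)) <= 2 * ((a * a + b * b) * B).
  have := sqr_ge0 (a - b); have := sqr_ge0 (a + b); rewrite sqrrB sqrrD => u1 u2.
  have u3 : 0 <= (a * a + a * b *+ 2 + b * b) * (2 * B - (J 0 1 + J 1 0)).
    by apply: mulr_ge0; [rewrite -!expr2; lra|lra].
  have u4 : 0 <= (a * a - a * b *+ 2 + b * b) * (2 * B + (J 0 1 + J 1 0)).
    by apply: mulr_ge0; [rewrite -!expr2; lra|lra].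
  lra.
lra.
Qed.

(** Gronwall's argument: E = |x - y|^2 satisfies E' <= 2 L E, so E exp (- 2 L t) does not increase
    from its value 0 at a. The one-sided estimate yields uniqueness forward in time only. *)
Lemma solution_unique (x y : R -> P) M a : solution psi x -> solution psi y ->
  (forall t, `|x t| <= M) -> (forall t, `|y t| <= M) -> x a = y a ->
  forall t, a <= t -> x t = y t.
Proof.
move=> sx sy xM yM xya t at_.
have [L L0 hL] := one_sided_lipschitz M.
pose E s := (x s 0 0 - y s 0 0) ^+ 2 + (x s 0 1 - y s 0 1) ^+ 2.
pose dE s := 2 * dotv (x s - y s) (psi (x s) - psi (y s)).
have dEd s : is_derive s (1 : R) E (dE s).
  have hx := deriv_coord (sx s); have hy := deriv_coord (sy s).
  have h j := is_deriveB (hx j) (hy j).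
  apply: (is_derive_eq (is_deriveD (is_deriveX 2 (h 0)) (is_deriveX 2 (h 1)))).
  by rewrite /dE dotvE !mxE /GRing.scale /= !fctE; ring.
pose g (s : R) := expR (- (2 * L) * s).
have dg s : is_derive s (1 : R) g (- (2 * L) * g s).
  have h : is_derive s (1 : R) (fun s : R => - (2 * L) * s) (- (2 * L)).
    apply: (is_derive_eq (@is_deriveZ _ _ _ (id : R -> R) (- (2 * L)) s 1 1 (is_derive_id _ _))).
    by rewrite /GRing.scale /= mulr1.
  apply: (is_derive_eq (is_derive1_comp (is_derive_expR (- (2 * L) * s)) h)).
  by rewrite mulrC.
have dG s : is_derive s (1 : R) (fun s => E s * g s) (g s * (dE s - 2 * L * E s)).
  apply: (is_derive_eq (is_deriveM (dEd s) (dg s))).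
  by rewrite /GRing.scale /=; ring.
have pc : {within `[a, t], continuous (fun s => E s * g s)}.
  by apply: continuous_subspaceT => s; exact: deriv_cont (dG s).
have [c _] := MVT_segment at_ (fun s _ => dG s) pc.
have -> : E a = 0 by rewrite /E xya !subrr expr0n /= addr0.
rewrite mul0r subr0 => e.
have Ed s : E s = dotv (x s - y s) (x s - y s).
  by rewrite /E dotvE !mxE; ring.
have : E t * g t <= 0.
  rewrite e; apply: mulr_le0_ge0; last by rewrite subr_ge0.
  apply: mulr_ge0_le0; first exact: expR_ge0.
  rewrite /dE Ed; have := hL _ _ (xM c) (yM c); lra.
rewrite pmulr_lle0 ?expR_gt0 // /E => Et.
have z0 : (x t 0 0 - y t 0 0) ^+ 2 = 0.
  by apply/eqP; rewrite eq_le sqr_ge0 andbT; have := sqr_ge0 (x t 0 1 - y t 0 1); lra.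
have z1 : (x t 0 1 - y t 0 1) ^+ 2 = 0.
  by apply/eqP; rewrite eq_le sqr_ge0 andbT; have := sqr_ge0 (x t 0 0 - y t 0 0); lra.
by apply: plane_eq; apply/eqP; rewrite -subr_eq0 -sqrf_eq0; [rewrite z0|rewrite z1].
Qed.

Lemma periodic_nat (X : Type) (x : R -> X) T : (forall t, x (t + T) = x t) ->
  forall (n : nat) t, x (t + n%:R * T) = x t.
Proof.
move=> xT; elim=> [|n IH] t; first by rewrite mul0r addr0.
by rewrite -natr1 mulrDl mul1r addrA xT IH.
Qed.

Lemma periodic_reduce (X : Type) (x : R -> X) T : 0 < T -> (forall t, x (t + T) = x t) ->
  forall t, exists2 s, 0 <= s < T & x s = x t.
Proof.
move=> T0 xT t; pose k := Num.floor (t / T).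
have /andP[k1 k2] := floor_itv (t / T); rewrite -/k in k1 k2.
have xk : x (t - k%:~R * T) = x t.
  case: k {k1 k2} => n.
    by rewrite -[in RHS](subrK (n%:R * T) t) (periodic_nat xT).
  by rewrite NegzE mulrNz mulNr opprK /= (periodic_nat xT).
exists (t - k%:~R * T) => //; rewrite subr_ge0 -ler_pdivlMr // k1 /= ltrBlDr.
by rewrite intrD in k2; rewrite -{1}[T]mul1r -mulrDl addrC -ltr_pdivrMr.
Qed.

Variables (x0 : R -> P) (T : R).
Hypotheses (x0sol : solution psi x0) (x0per : least_period x0 T).

Lemma x0_cont : continuous x0.
Proof. by move=> t; exact: deriv_cont (x0sol t). Qed.

Lemma x0_bounded : exists M, forall t, `|x0 t| <= M.
Proof.
have [T0 xT _] := x0per.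
have nc : continuous (fun t => `|x0 t|).
  by move=> t; exact: (cvg_norm (@x0_cont t)).
have [B B0 hB] := compact_bound (@segment_compact R 0 T) nc.
exists B => t; have [s /andP[s0 sT] <-] := periodic_reduce T0 xT t.
by have := hB s; rewrite normr_id; apply; rewrite /= in_itv /= s0 ltW.
Qed.

Lemma solution_shift a : solution psi (fun t => x0 (t + a)).
Proof.
move=> t; have := x0sol (t + a).
have e : (fun h : R => h^-1 *: (x0 (h *: (1 : R) + t + a) - x0 (t + a))) =
         (fun h : R => h^-1 *: (x0 (h *: (1 : R) + (t + a)) - x0 (t + a))).
  by apply/funext => h; rewrite addrA.
move=> [dx vx]; apply: DeriveDef.
  by move: dx; rewrite /derivable /= -e.
by rewrite -[RHS]vx /derive /= -e.
Qed.

(** If x0 s = x0 t, then x0 and its translate by t - s agree from time s on, hence always by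
    periodicity, and t - s is a period. *)
Lemma x0_inj s t : s < t -> x0 s = x0 t -> T <= t - s.
Proof.
move=> st e; have [T0 xT xmin] := x0per; apply: xmin; first by rewrite subr_gt0.
have [M xM] := x0_bounded.
have fw := @solution_unique (fun r => x0 (r + (t - s))) x0 M s (solution_shift _) x0sol
  (fun _ => xM _) xM.
(* n periods carry r beyond s, where forward uniqueness applies. *)
move=> r; pose n := (Num.trunc (`|s - r| / T)).+1.
rewrite -(periodic_nat xT n r) -(periodic_nat xT n (r + (t - s))) addrAC; apply: fw.
  by rewrite addrC subrK e.
have : `|s - r| / T < n%:R by exact: truncnS_gt.
rewrite ltr_pdivrMr // => h; have := ler_norm (s - r); lra.
Qed.

(** From an equilibrium the solution would stay constant, so x0 t = x0 (t + T / 2), against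
    [x0_inj]. *)
Lemma x0_speed t : psi (x0 t) != 0.
Proof.
apply/eqP => e; have [T0 xT xmin] := x0per; have [M xM] := x0_bounded.
have sc : solution psi (fun _ => x0 t).
  by move=> s; rewrite e; exact: is_derive_cst.
have := solution_unique sc x0sol (fun _ => xM t) xM erefl (t := t + T / 2).
rewrite lerDl divr_ge0 ?(ltW T0) // => /(_ isT) h.
by have := @x0_inj t (t + T / 2); rewrite ltrDl divr_gt0 // => /(_ isT h); lra.
Qed.
End ODE.

(** * Geometry of a regular simple closed curve: secants, normals, nearest points *)

Section Curve.
Variable R : realType.
Local Notation P := 'rV[R]_2.
Variables (x v : R -> P) (T : R).
Hypotheses (T0 : 0 < T) (xd : forall t, is_derive t (1 : R) x (v t))
  (vc : continuous v) (xT : forall t, x (t + T) = x t) (vT : forall t, v (t + T) = v t)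
  (v0 : forall t, v t != 0) (xinj : forall s t, s < t -> x s = x t -> T <= t - s).

Definition nv t := perp (v t).

Lemma xc : continuous x.
Proof. by move=> t; exact: deriv_cont (xd t). Qed.

Lemma dotvC (a b : P) : dotv a b = dotv b a.
Proof. by rewrite !dotvE; ring. Qed.
Lemma dotvBl (a b c : P) : dotv (a - b) c = dotv a c - dotv b c.
Proof. by rewrite !dotvE !mxE; ring. Qed.
Lemma dotvZl (k : R) (a b : P) : dotv (k *: a) b = k * dotv a b.
Proof. by rewrite !dotvE !mxE; ring. Qed.
Lemma perp0 (a : P) : perp a 0 0 = a 0 1. Proof. by rewrite mxE. Qed.
Lemma perp1 (a : P) : perp a 0 1 = - a 0 0. Proof. by rewrite mxE. Qed.
Lemma dotv_perp (a : P) : dotv (perp a) a = 0.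
Proof. by rewrite dotvE perp0 perp1; ring. Qed.
Lemma dotv_ge0 (a : P) : 0 <= dotv a a.
Proof. by rewrite dotvE -!expr2 addr_ge0 ?sqr_ge0. Qed.
Lemma dotv_gt0 (a : P) : a != 0 -> 0 < dotv a a.
Proof.
move=> a0; rewrite lt_neqAle dotv_ge0 andbT; apply: contraNneq a0 => /esym.
rewrite dotvE -!expr2 => e; apply/eqP/plane_eq; rewrite mxE; apply/eqP; rewrite -sqrf_eq0;
  by have h1 := sqr_ge0 (a 0 0); have h2 := sqr_ge0 (a 0 1); apply/eqP; lra.
Qed.
Lemma dotv_pp (a : P) : dotv (perp a) (perp a) = dotv a a.
Proof. by rewrite !dotvE perp0 perp1; ring. Qed.

Lemma orth_perp (a w : P) : a != 0 -> dotv w a = 0 ->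
  w = (dotv w (perp a) / dotv a a) *: perp a.
Proof.
move=> a0 o; have e0 : dotv a a != 0 by rewrite gt_eqF // dotv_gt0.
apply: plane_eq; rewrite !mxE /=; apply: (mulIf e0); rewrite mulrAC divfK //.
  have -> : w 0 0 * dotv a a = w 0 0 * dotv a a - a 0 0 * dotv w a.
    by rewrite o mulr0 subr0.
  by rewrite !dotvE perp0 perp1; ring.
have -> : w 0 1 * dotv a a = w 0 1 * dotv a a - a 0 1 * dotv w a.
  by rewrite o mulr0 subr0.
by rewrite !dotvE perp0 perp1; ring.
Qed.

Lemma dotv_cont (X : topologicalType) (a b : X -> P) (y : X) :
  {for y, continuous a} -> {for y, continuous b} ->
  {for y, continuous (fun z => dotv (a z) (b z))}.
Proof.
move=> ha hb.
have c i (f : X -> P) : {for y, continuous f} -> {for y, continuous (fun z => f z 0 i)}.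
  by move=> hf; apply: (continuous_comp (g := fun p : P => p 0 i) hf); exact: coord_continuous.
rewrite (_ : (fun z => _) = (fun z => a z 0 0 * b z 0 0 + a z 0 1 * b z 0 1)).
  exact: (cvgD (cvgM (c 0 _ ha) (c 0 _ hb)) (cvgM (c 1 _ ha) (c 1 _ hb))).
by apply/funext => z; rewrite dotvE.
Qed.

Lemma perp_cont : continuous (@perp R).
Proof.
move=> a; apply: (@pt_cont R _ (fun y : P => y 0 1) (fun y : P => - y 0 0) a).
  exact: coord_continuous.
exact: (cvgN (@coord_continuous R 1 2 0 0 a)).
Qed.

Lemma nvc : continuous nv.
Proof. by move=> t; exact: (continuous_comp (@vc t) (@perp_cont _)). Qed.

Lemma nvT t : nv (t + T) = nv t. Proof. by rewrite /nv vT. Qed.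

Lemma nv_neq0 t : nv t != 0.
Proof.
apply/eqP => e; have := dotv_gt0 (v0 t).
by rewrite -dotv_pp -/(nv t) e dotvE !mxE !mul0r addr0 ltxx.
Qed.

Lemma per_bound (f : R -> R) : continuous f -> (forall t, f (t + T) = f t) ->
  exists2 B, 0 <= B & forall t, `|f t| <= B.
Proof.
move=> fc fT; have [B B0 hB] := compact_bound (@segment_compact R 0 T) fc.
exists B => // t; have [s /andP[s0 sT] <-] := periodic_reduce T0 fT t.
by apply: hB; rewrite /= in_itv /= s0 ltW.
Qed.

(* The secant based at s makes an acute angle with the velocity for small
   increments, uniformly in s. *)
Lemma secant_local : exists2 d, 0 < d & forall s u, `|u| <= d -> u != 0 ->
  0 < u * dotv (x (s + u) - x s) (v s).
Proof.
have := @segment_compact R 0 T => /compact_near_coveringP.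
move=> /(_ R (nbhs (0 : R)) (fun e s => 0 < dotv (v (s + e)) (v s)) _).
case.
  move=> s _; have cs : {for (s, (0 : R)), continuous (fun p : R * R => dotv (v (p.1 + p.2)) (v p.1))}.
    apply: dotv_cont.
      by apply: (continuous_comp (f := fun p : R * R => p.1 + p.2)) (@vc _); exact: (cvgD cvg_fst cvg_snd).
    exact: (continuous_comp (f := fun p : R * R => p.1) cvg_fst (@vc _)).
  have /cvgr_gt := cs; apply; rewrite /= addr0; exact: dotv_gt0.
move=> d /= d0 hd; exists (d / 2); first exact: divr_gt0.
have hd' s e : `|e| <= d / 2 -> 0 < dotv (v (s + e)) (v s).
  move=> ed; have hT t : dotv (v (t + T + e)) (v (t + T)) = dotv (v (t + e)) (v t).
    by rewrite addrAC !vT.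
  have [s' /andP[s0 sT] es] := periodic_reduce T0 hT s.
  rewrite -es; apply: (hd e); last by rewrite /= in_itv /= s0 ltW.
  by rewrite /= sub0r normrN; apply: le_lt_trans ed _; lra.
move=> s u ud u0.
pose phi r := dotv (x (s + r * u)) (v s).
have dphi r : is_derive r (1 : R) phi (u * dotv (v (s + r * u)) (v s)).
  have e : is_derive r (1 : R) (fun r : R => s + r * u) u.
    have h1 : is_derive r (1 : R) (fun r : R => r * u) u.
      by apply: (is_derive_eq (is_deriveM (is_derive_id r (1 : R)) (is_derive_cst u r (1 : R))));
        rewrite /GRing.scale /=; ring.
    by apply: (is_derive_eq (is_deriveD (is_derive_cst s r (1 : R)) h1)); rewrite add0r.
  have hx j : is_derive r (1 : R) (fun r => x (s + r * u) 0 j) (v (s + r * u) 0 j * u).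
    exact: (@is_derive1_comp R (fun s => x s 0 j) (fun r => s + r * u) r _ _ (deriv_coord (xd (s + r * u)) j) e).
  have -> : phi = (fun r => v s 0 0 * x (s + r * u) 0 0 + v s 0 1 * x (s + r * u) 0 1).
    by apply/funext => q; rewrite /phi dotvE; ring.
  apply: (is_derive_eq (is_deriveD (is_deriveZ (v s 0 0) (hx 0)) (is_deriveZ (v s 0 1) (hx 1)))).
  by rewrite dotvE /GRing.scale /=; ring.
have pc : {within `[0, 1], continuous phi}.
  by apply: continuous_subspaceT => r; exact: deriv_cont (dphi r).
have [c] := MVT_segment ler01 (fun r _ => dphi r) pc.
rewrite in_itv /= => /andP[c0 c1]; rewrite subr0 mulr1 => e.
have -> : dotv (x (s + u) - x s) (v s) = phi 1 - phi 0.
  by rewrite /phi mul1r mul0r addr0 dotvBl.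
rewrite e mulrA -expr2 mulr_gt0 //.
  by rewrite lt_neqAle sqr_ge0 eq_sym sqrf_eq0 u0.
apply: hd'; apply: le_trans ud; rewrite normrM ger0_norm // ler_piMl //.
Qed.

(** Injectivity within a period keeps these secants from vanishing; the minimum over a compact set
    of (s, u) is then positive. *)
Lemma secant_far d : 0 < d -> exists2 c, 0 < c & forall s u, d <= u <= T - d ->
  c <= dotv (x (s + u) - x s) (x (s + u) - x s).
Proof.
move=> d0; pose f (p : R * R) := dotv (x (p.1 + p.2) - x p.1) (x (p.1 + p.2) - x p.1).
have fc : continuous f.
  move=> p; have a1 : {for p, continuous (fun p : R * R => x (p.1 + p.2))}.
    by apply: (continuous_comp (f := fun p : R * R => p.1 + p.2)) (@xc _); exact: (cvgD cvg_fst cvg_snd).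
  have a2 : {for p, continuous (fun p : R * R => x p.1)}.
    exact: (continuous_comp (f := fun p : R * R => p.1) cvg_fst (@xc _)).
  exact: (dotv_cont (cvgB a1 a2) (cvgB a1 a2)).
have [dT|dT] := leP d (T - d); last first.
  by exists 1 => // s u /andP[a b]; have := le_trans a b; rewrite leNgt dT.
have cK : compact (`[0, T]%classic `*` `[d, T - d]%classic : set (R * R)).
  by apply: compact_setX; exact: segment_compact.
have K0 : (`[0, T]%classic `*` `[d, T - d]%classic : set (R * R)) !=set0.
  by exists (0, d); split; rewrite /= in_itv /= ?lexx ?dT // ltW.
have [[s0 u0]] := compact_EVT_min K0 cK (continuous_subspaceT fc).
rewrite inE => -[/= i1 i2] hmin; rewrite !in_itv /= in i1 i2.
exists (f (s0, u0)).
  apply: dotv_gt0 => /=; rewrite subr_eq0; apply/eqP => e.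
  have : s0 < s0 + u0 by rewrite ltrDl; lra.
  by move/xinj => /(_ (esym e)); lra.
move=> s u udT.
have hT t : dotv (x (t + T + u) - x (t + T)) (x (t + T + u) - x (t + T)) =
    dotv (x (t + u) - x t) (x (t + u) - x t) by rewrite addrAC !xT.
have [s' /andP[a b] <-] := periodic_reduce T0 hT s.
by apply: (hmin (s', u)); rewrite inE; split; rewrite /= in_itv //= a ltW.
Qed.

Lemma range_reduce s t : exists2 u, 0 <= u < T & x s = x (t + u).
Proof.
have h r : x (t + (r + T)) = x (t + r) by rewrite addrA xT.
have [u u0 e] := periodic_reduce T0 h (s - t).
by exists u => //; rewrite e addrC subrK.
Qed.

(** Suppose x (t + u) - x t = e nv t. For u near 0 or T this contradicts [secant_local], because nv
    t is orthogonal to v t; for other u the squared length is at least c by [secant_far], too much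
    for small e. *)
Lemma tube : exists2 e0, 0 < e0 & forall e, 0 < `|e| -> `|e| <= e0 ->
  forall s t, x s != x t + e *: nv t.
Proof.
have [d d0 hd] := secant_local; have [c c0 hc] := secant_far d0.
have [B B0 hB] : exists2 B, 0 <= B & forall t, `|dotv (nv t) (nv t)| <= B.
  apply: per_bound => t; last by rewrite nvT.
  exact: (dotv_cont (@nvc t) (@nvc t)).
pose e0 := Num.min 1 (c / (2 * (B + 1))).
have B1 : 0 < 2 * (B + 1) by lra.
exists e0; first by rewrite lt_min ltr01 divr_gt0.
move=> e e1 e2 s t; apply/eqP; have [u /andP[u0 uT] ->] := range_reduce s t => E.
have Eu : x (t + u) - x t = e *: nv t by rewrite E addrC addKr.
have Z r : x (t + r) = x (t + u) -> r != 0 -> `|r| <= d -> False.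
  move=> er r0 rd; have := hd t r rd r0; rewrite er Eu dotvZl /nv dotv_perp !mulr0.
  by rewrite ltxx.
have [u1|u1] := leP u d.
  have [ue|ue] := eqVneq u 0; last by apply: (Z u) => //; rewrite ger0_norm.
  move: Eu; rewrite ue addr0 subrr => /esym/eqP; rewrite scaler_eq0 (negbTE (nv_neq0 t)) orbF.
  by move=> /eqP ee; rewrite ee normr0 ltxx in e1.
have [u2|u2] := leP u (T - d); last first.
  by apply: (Z (u - T)); [rewrite -(xT (t + (u - T))) -addrA subrK|lra|rewrite ler0_norm; lra].
have := hc t u; rewrite u2 (ltW u1) => /(_ isT); rewrite Eu dotvZl dotvC dotvZl.
have := hB t; rewrite ger0_norm ?dotv_ge0 // => hBt.
have eB : `|e| * (2 * (B + 1)) <= c.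
  by rewrite -ler_pdivlMr //; apply: le_trans e2 _; rewrite ge_min lexx orbT.
have e11 : `|e| <= 1 by apply: le_trans e2 _; rewrite ge_min lexx.
rewrite mulrA -expr2 -[e ^+ 2]real_normK ?num_real // => hce.
have n0 := dotv_ge0 (nv t).
have : `|e| ^+ 2 * dotv (nv t) (nv t) <= `|e| * B.
  apply: ler_pM => //.
  by rewrite expr2 ler_piMl.
by have := mulr_ge0 (ltW e1) B0; lra.
Qed.

(** At a point x t of the curve nearest to p, p - x t is orthogonal to the velocity, hence a
    multiple of the normal. A curve point on the half-open segment from x t to p would be strictly
    nearer to p. *)
Lemma nearest p : (forall s, x s != p) -> exists t c, [/\ c != 0, p = x t + c *: nv t
  & forall r s, 0 < r <= 1 -> x s != x t + (r * c) *: nv t].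
Proof.
move=> pC; pose D t := dotv (p - x t) (p - x t).
have dD t : is_derive t (1 : R) D (- 2 * dotv (p - x t) (v t)).
  have h j := is_deriveB (is_derive_cst (p 0 j) t (1 : R)) (deriv_coord (xd t) j).
  have -> : D = (fun t => (p 0 0 - x t 0 0) ^+ 2 + (p 0 1 - x t 0 1) ^+ 2).
    by apply/funext => s; rewrite /D dotvE !mxE; ring.
  apply: (is_derive_eq (is_deriveD (is_deriveX 2 (h 0)) (is_deriveX 2 (h 1)))).
  by rewrite dotvE !mxE /GRing.scale /= !fctE; ring.
have Dc : continuous D by move=> t; exact: deriv_cont (dD t).
have [t _ tmin] := EVT_min (ltW T0) (continuous_subspaceT Dc).
have tm s : D t <= D s.
  have DT r : D (r + T) = D r by rewrite /D xT.
  have [s' /andP[s0 sT] <-] := periodic_reduce T0 DT s.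
  by apply: tmin; rewrite in_itv /= s0 ltW.
have orth : dotv (p - x t) (v t) = 0.
  have [||||_ d0] := @derive1_at_min R D (t - 1) (t + 1) t.
  - lra.
  - by [].
  - by rewrite in_itv /=; lra.
  - by move=> s _; exact: tm.
  have := derive_val (is_derive := dD t); rewrite d0; lra.
set w := p - x t in orth.
pose c := dotv w (nv t) / dotv (v t) (v t).
have wE : w = c *: nv t := orth_perp (v0 t) orth.
have w0 : w != 0 by rewrite subr_eq0 eq_sym.
exists t, c; split.
- by apply: contraNneq w0 => c0; rewrite wE c0 scale0r.
- by rewrite -wE addrC subrK.
move=> r s /andP[r0 r1]; rewrite -scalerA -wE; apply/eqP => e.
have := tm s; rewrite /D e opprD addrA -/w -[w in w - _]scale1r -scalerBl.
rewrite dotvZl dotvC dotvZl mulrA => h.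
have := dotv_gt0 w0; set m := dotv w w in h *; move=> m0.
have : (1 - r) * (1 - r) < 1 by have := mulr_gt0 r0 r0; have : r * r <= r; [rewrite ler_piMl // ltW|lra].
by rewrite -(ltr_pM2r m0) mul1r => /(le_lt_trans h); rewrite ltxx.
Qed.
End Curve.

(** * Winding numbers around interior points *)

Section Interior.
Variable R : realType.
Local Notation P := 'rV[R]_2.

Lemma toCB (a b : P) : toC (a - b) = toC a - toC b.
Proof. by apply: ceq; rewrite !cE /toC /cre /cim /= !mxE. Qed.
Lemma toCD (a b : P) : toC (a + b) = toC a + toC b.
Proof. by apply: ceq; rewrite !cE /toC /cre /cim /= !mxE. Qed.
Lemma toCZ (k : R) (a : P) : toC (k *: a) = k%:C * toC a.
Proof. by apply: ceq; rewrite !cE /toC /cre /cim /= !mxE; ring. Qed.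
Lemma toC_perp (a : P) : toC (perp a) = (0 +i* -1) * toC a.
Proof. by apply: ceq; rewrite !cE /toC /cre /cim /= ?perp0 ?perp1; ring. Qed.
Lemma toC_eq0 (a : P) : (toC a == 0) = (a == 0).
Proof.
apply/eqP/eqP => [|->]; last by apply: ceq; rewrite /toC /cre /cim /= !mxE.
by case=> h0 h1; apply: plane_eq; rewrite mxE.
Qed.

Lemma wn_im T (f : R -> R[i]) : ccont f -> (forall t, 0 < cim (f t)) -> f T = f 0 -> wn T f 0.
Proof.
move=> fc fp fT.
have h : wn T (fun t => (0 +i* -1) * f t) 0.
  apply: wn_re; last by rewrite fT.
    by move=> t; apply: ccaM; [exact: cca_cst|exact: fc].
  by move=> t; rewrite creMNi.
have i0 : (0 +i* 1 : R[i]) != 0 by rewrite eq_complex /= oner_eq0 andbF.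
have := wnM (wn_cst T i0) h; rewrite addr0.
apply: wn_ext => t _; apply: ceq; rewrite !cE /cre /cim /=; ring.
Qed.

Variables (x v : R -> P) (T : R).
Hypotheses (T0 : 0 < T) (xd : forall t, is_derive t (1 : R) x (v t))
  (vc : continuous v) (xT : forall t, x (t + T) = x t) (vT : forall t, v (t + T) = v t)
  (v0 : forall t, v t != 0) (xinj : forall s t, s < t -> x s = x t -> T <= t - s).
Local Notation nv := (nv v).

Let xcont : continuous x := xc xd.
Let nvcont : continuous nv := nvc vc.
Let nvper : forall t, nv (t + T) = nv t := nvT vT.

Lemma curveE : x @` `[0, T] = range x.
Proof.
apply/seteqP; split=> [p [s _ <-]|p [s _ <-]]; first by exists s.
have [u /andP[u0 uT] <-] := periodic_reduce T0 xT s.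
by exists u; rewrite //= in_itv /= u0 ltW.
Qed.

Lemma range_neqP p : ~ range x p <-> forall s, x s != p.
Proof.
split=> [h s|h [s _ /eqP e]]; last by have := h s; rewrite e.
by apply/eqP => e; apply: h; exists s.
Qed.

Lemma curve_compact : compact (range x).
Proof.
rewrite -curveE; apply: continuous_compact; last exact: segment_compact.
exact: continuous_subspaceT.
Qed.

Lemma curve_closed : closed (range x).
Proof. by apply: compact_closed; [exact: norm_hausdorff|exact: curve_compact]. Qed.

Definition gz (z : P) (t : R) : R[i] := toC (x t - z).

Lemma gz_loop z : (forall s, x s != z) -> loop T (gz z).
Proof.
move=> h; split=> [t|t|t]; last by rewrite /gz toC_eq0 subr_eq0.
  apply: (@cca_comp R _ _ (fun t => x t - z) (@toC R)); last exact: toC_cont.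
  exact: (cvgB (@xcont t) (cvg_cst z)).
by rewrite /gz xT.
Qed.

Lemma wn_gz_path (f : R -> P) n : continuous f ->
  (forall t s, 0 <= t <= 1 -> x s != f t) ->
  wn T (gz (f 0)) n -> wn T (gz (f 1)) n.
Proof.
move=> fc h; apply: (@wn_homotopy R T (fun ts => toC (x ts.1 - f ts.2))) => //.
- move=> ts; apply: (@cca_comp R _ _ (fun ts : R * R => x ts.1 - f ts.2) (@toC R)); last exact: toC_cont.
  have c1 : {for ts, continuous (fun p : R * R => x p.1)}.
    exact: (continuous_comp (f := fun p : R * R => p.1) cvg_fst (@xcont _)).
  have c2 : {for ts, continuous (fun p : R * R => f p.2)}.
    exact: (continuous_comp (f := fun p : R * R => p.2) cvg_snd (fc _)).
  exact: (cvgB c1 c2).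
- by move=> t s s01; rewrite toC_eq0 subr_eq0 h.
- by move=> s _; rewrite /= -{1}[T]add0r xT.
Qed.

(* The product of one loop with the conjugate of the other has real part
   |x t - x s0|^2 - e^2 |nv s0|^2 and imaginary part 2 e <x t - x s0, v s0>, so it
   crosses the negative real axis once. *)
Lemma jump s0 : exists2 e1, 0 < e1 & forall e, 0 < e -> e <= e1 -> forall n m,
  wn T (gz (x s0 + e *: nv s0)) n -> wn T (gz (x s0 - e *: nv s0)) m -> n - m = - 1.
Proof.
have [e0 e00 he0] := tube T0 xd vc xT vT v0 xinj.
have [d' d0' hd'] := secant_local T0 xd vc vT v0.
pose d := Num.min d' (T / 2).
have d0 : 0 < d by rewrite lt_min d0' divr_gt0.
have dd : d <= d' by rewrite ge_min lexx.
have dT : d <= T - d.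
  have : d <= T / 2 by rewrite ge_min lexx orbT.
  by lra.
have [c c0 hc] := secant_far T0 xd xT xinj d0.
pose N := dotv (nv s0) (nv s0).
have N0 : 0 < N by apply: dotv_gt0; exact: nv_neq0.
(* e0 keeps both base points off the curve; with 1 and c / N one gets e^2 N <= e N <= c, so the real
   part is nonnegative on [d, T - d]. *)
pose e1 := Num.min e0 (Num.min 1 (c / N)).
exists e1; first by rewrite !lt_min e00 ltr01 divr_gt0.
move=> e ep ee n m wn_ wm_.
have ee0 : e <= e0 by apply: le_trans ee _; rewrite ge_min lexx.
have e11 : e <= 1 by apply: le_trans ee _; rewrite !ge_min lexx orbT.
have ec : e * N <= c.
  by rewrite -ler_pdivlMr //; apply: le_trans ee _; rewrite !ge_min lexx !orbT.
have pe : `|e| = e by rewrite gtr0_norm.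
have hp s : x s != x s0 + e *: nv s0 by apply: he0; rewrite pe.
have hm s : x s != x s0 - e *: nv s0 by rewrite -scaleNr; apply: he0; rewrite normrN pe.
pose zz t := x (s0 + t) - x s0.
pose w t := gz (x s0 + e *: nv s0) (t + s0) * (gz (x s0 - e *: nv s0) (t + s0))^*.
have ww : wn T w (n - m).
  by apply: wnM; [|apply: wnC]; apply: wn_shift => //; apply: gz_loop.
have wre t : cre (w t) = dotv (zz t) (zz t) - e ^+ 2 * N.
  rewrite /w /gz /zz /N [t + s0]addrC !cE /toC /cre /cim /= !dotvE !mxE; ring.
have wim t : cim (w t) = 2 * (e * dotv (zz t) (v s0)).
  rewrite /w /gz /zz /N [t + s0]addrC !cE /toC /cre /cim /= !dotvE !mxE /=; ring.
have [pc pT p0] := gz_loop hp; have [mc mT m0] := gz_loop hm.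
have wl : loop T w.
  split.
  - have sc t : {for t, continuous (fun t : R => t + s0)} by exact: (cvgD cvg_id (cvg_cst s0)).
    by move=> t; apply: ccaM; last apply: ccaC; apply: cca_comp (sc t) _; [exact: pc|exact: mc].
  - by move=> t; rewrite /w addrAC pT mT.
  - by move=> t; rewrite mulf_neq0 // ?p0 //; apply/eqP => /(congr1 (fun z => z^*));
      rewrite conjcK rmorph0 => /eqP; rewrite (negbTE (m0 _)).
have zz0' : dotv (zz 0) (v s0) = 0 by rewrite /zz addr0 subrr dotvE !mxE !mul0r addr0.
have zz0 : dotv (zz 0) (zz 0) = 0 by rewrite /zz addr0 subrr dotvE !mxE !mul0r addr0.
have sq : 0 < e ^+ 2 * N by rewrite mulr_gt0 // exprn_gt0.
have ecN : e ^+ 2 * N <= c.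
  apply: le_trans ec; rewrite ler_pM2r // expr2 ler_piMr // ltW //.
apply: (wn_uniq (ltW T0) ww); apply: (@wn_cross R T w d d0 dT wl).
- by rewrite wre zz0; lra.
- by rewrite wim zz0'; lra.
- move=> t /andP[t0 t1]; rewrite wim; do 2![apply: mulr_ge0 => //]; first exact: ltW.
  have [->|tn] := eqVneq t 0; first by rewrite zz0'.
  have := hd' s0 t; rewrite ger0_norm // (le_trans t1 dd) => /(_ isT tn).
  have tp : 0 < t by rewrite lt_neqAle eq_sym tn.
  by rewrite pmulr_rgt0 // => /ltW.
- move=> t td; rewrite wre subr_ge0; apply: le_trans ecN _; exact: hc.
- move=> t /andP[t0 t1]; rewrite wim.
  apply: mulr_ge0_le0 => //; apply: mulr_ge0_le0; first exact: ltW.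
  have -> : zz t = x (s0 + (t - T)) - x s0 by rewrite /zz -[in RHS]xT addrA subrK.
  have [->|tn] := eqVneq t T; first by rewrite subrr -/(zz 0) zz0'.
  have tT : t - T < 0 by rewrite subr_lt0 lt_neqAle tn.
  have := hd' s0 (t - T); rewrite ltr0_norm // lt_eqF // => H.
  have : 0 < (t - T) * dotv (x (s0 + (t - T)) - x s0) (v s0) by apply: H => //; lra.
  by rewrite nmulr_rgt0 // => /ltW.
Qed.

Variables (U : set P) (Uj : jordan_interior (range x) U).

Lemma U_connected (A : set P) : connected A -> (forall p, A p -> forall s, x s != p) ->
  A `&` U !=set0 -> A `<=` U.
Proof.
move=> cA AC [a [Aa]]; have [_ [p _ ->]] := Uj => pa.
rewrite (same_connected_component pa); apply: connected_component_max => //.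
by move=> q /AC /range_neqP.
Qed.

Lemma U_path (f : R -> P) (I : set R) t0 : continuous f -> is_interval I ->
  (forall t s, I t -> x s != f t) -> I t0 -> U (f t0) -> forall t, I t -> U (f t).
Proof.
move=> fc ii h It0 Ut0 t It; apply: (@U_connected (f @` I)); last by exists t.
- by apply: connected_continuous_connected; [apply/connected_intervalP|exact: continuous_subspaceT].
- by move=> p [r Ir <-] s; exact: h.
- by exists (f t0); split=> //; exists t0.
Qed.

Lemma U_off p : U p -> forall s, x s != p.
Proof.
have [_ [q _ ->]] := Uj; move=> /connected_component_sub h; exact/range_neqP.
Qed.

Lemma U_segment p q : U p -> (forall r s, 0 <= r <= 1 -> x s != p + r *: (q - p)) -> U q.
Proof.
move=> Up h; have fc : continuous (fun r : R => p + r *: (q - p)).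
  by move=> r; exact: (cvgD (cvg_cst p) (cvgZ cvg_id (cvg_cst (q - p)))).
have e1 : p + 1 *: (q - p) = q by rewrite scale1r addrC subrK.
have e0 : p + 0 *: (q - p) = p by rewrite scale0r addr0.
rewrite -e1; apply: (@U_path (fun r => p + r *: (q - p)) `[0, 1]%classic 0) => //.
- exact: interval_is_interval.
all: by rewrite ?e0 //= in_itv /= lexx ler01.
Qed.

Lemma off_ball p : (forall s, x s != p) -> exists2 r, 0 < r & forall q, `|q - p| < r -> forall s, x s != q.
Proof.
move=> /range_neqP pC; have := closed_openC curve_closed.
rewrite openE => /(_ p pC) /nbhs_ballP[r /= r0 hr]; exists r => // q qr.
by apply/range_neqP/hr; rewrite -ball_normE /= distrC.
Qed.

Lemma near_segment (p q : P) (r t : R) : `|q - p| < r -> 0 <= t <= 1 -> `|p + t *: (q - p) - p| < r.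
Proof.
move=> h /andP[t0 t1]; rewrite addrC addKr normrZ ger0_norm //.
by apply: le_lt_trans h; rewrite ler_piMl.
Qed.

Lemma U_open : open U.
Proof.
rewrite openE => p Up; have [r r0 hr] := off_ball (U_off Up).
apply/nbhs_ballP; exists r => //= q; rewrite -ball_normE /= distrC => qr.
by apply: (U_segment Up) => t s t01; apply: hr; exact: near_segment.
Qed.

Lemma U_closure p : closure U p -> U p \/ range x p.
Proof.
move=> cp; have [|pC] := pselect (range x p); first by right.
left; have [r r0 hr] := off_ball ((range_neqP p).1 pC).
have [q [Uq /=]] : U `&` ball p r !=set0 by apply: cp; exact: nbhsx_ballx.
rewrite -ball_normE /= => pq; apply: (U_segment Uq) => t s t01; apply: hr.
have -> : q + t *: (p - q) - p = (1 - t) *: (q - p).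
  by apply: plane_eq; rewrite !mxE; ring.
case/andP: t01 => t0 t1; rewrite normrZ ger0_norm ?subr_ge0 // distrC.
by apply: le_lt_trans pq; rewrite ler_piMl // lerBlDr lerDl.
Qed.
Lemma U_bounded : exists2 M, 0 <= M & forall p, U p -> `|p| <= M.
Proof.
have [[M [_ hM]] _] := Uj; exists (Num.max M 0 + 1).
  by rewrite addr_ge0 // le_max lexx orbT.
move=> p; apply: hM; apply: (@le_lt_trans _ _ (Num.max M 0)); first by rewrite le_max lexx.
by rewrite ltrDl.
Qed.

Lemma half_itv (c : R) : is_interval [set r : R | 0 < r <= c].
Proof.
move=> y z /= /andP[y0 _] /andP[_ z1] w /andP[w0 w1].
by rewrite (lt_le_trans y0) // (le_trans w1).
Qed.

Lemma convex_between (y z u : R) : 0 < y -> y <= z -> 0 <= u <= 1 ->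
  0 < (1 - u) * z + u * y <= z /\ 0 < (1 - u) * y + u * z <= z.
Proof.
move=> y0 yz /andP[u0 u1].
have k1 : 0 <= u * (z - y) by rewrite mulr_ge0 // subr_ge0.
have k2 : 0 <= (1 - u) * (z - y) by rewrite mulr_ge0 // subr_ge0.
by split; apply/andP; split; lra.
Qed.

Lemma lowest : exists2 s0, v s0 0 1 = 0 & forall t, x s0 0 1 <= x t 0 1.
Proof.
have dy t := deriv_coord (xd t) 1.
have yc : continuous (fun t => x t 0 1) by move=> t; exact: deriv_cont (dy t).
have [s0 _ smin] := EVT_min (ltW T0) (continuous_subspaceT yc).
have sm t : x s0 0 1 <= x t 0 1.
  have [s' /andP[a b] <-] := periodic_reduce T0 xT t.
  by apply: smin; rewrite in_itv /= a ltW.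
exists s0 => //.
have [||||_ d0] := @derive1_at_min R (fun t => x t 0 1) (s0 - 1) (s0 + 1) s0.
- lra.
- by [].
- by rewrite in_itv /=; lra.
- by move=> s _; exact: sm.
by have := derive_val (is_derive := dy s0); rewrite d0.
Qed.

(** The open ray going down from a lowest point misses the curve, so it would lie in U entirely if
    it met U, while U is bounded. *)
Lemma ray_off s0 y : (forall t, x s0 0 1 <= x t 0 1) -> 0 <= y -> ~ U (x s0 - pt 0 y).
Proof.
move=> sm; rewrite le_eqVlt => /orP[/eqP <-|y0] Uy.
  have := U_off Uy s0; rewrite (_ : pt 0 0 = 0) ?subr0 ?eqxx //.
  by apply: plane_eq; rewrite !mxE.
have [M M0 hM] := U_bounded.
have Y0 : 0 < M + 1 + `|x s0 0 1| by have := normr_ge0 (x s0 0 1); lra.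
have : U (x s0 - pt 0 (M + 1 + `|x s0 0 1|)).
  have fc : continuous (fun y : R => x s0 - pt 0 y).
    move=> z; apply: (cvgB (cvg_cst (x s0))).
    by apply: pt_cont; [exact: cvg_cst|exact: cvg_id].
  have ii : is_interval [set y : R | 0 < y].
    by move=> a b /= a0 b0 z /andP[az _]; exact: lt_le_trans az.
  have off z s : [set y : R | 0 < y] z -> x s != x s0 - pt 0 z.
    by move=> /= z0; apply/eqP => e; have := sm s; rewrite e !mxE /=; lra.
  exact: (U_path fc ii off y0 Uy Y0).
move/hM => /plane_normP[_]; rewrite !mxE /= ler_norml => /andP[h _].
by have := ler_norm (x s0 0 1); lra.
Qed.

(* The side of the curve on which U lies is detected at a lowest point: the
   other side is joined to infinity by a vertical ray. *)
Lemma interior_winding : exists sig : int, [/\ sig = 1 \/ sig = - 1,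
  forall p, U p -> wn T (gz p) sig, wn T (fun t => toC (v t)) sig
  & forall t, closure U (x t)].
Proof.
have [s0 vs0 sm] := lowest.
have [e0 e00 he0] := tube T0 xd vc xT vT v0 xinj.
have [e1 e10 he1] := jump s0.
have [M M0 hM] := U_bounded.
pose a := v s0 0 0.
have a0 : a != 0.
  by apply: contraNneq (v0 s0) => h; apply/eqP/plane_eq; rewrite mxE.
(* At s0 the normal is vertical with second coordinate - a, so g nv s0 points upward, away from the
   ray; sig = - g is the winding number that [jump] will give on that side. *)
have [g [sig [ga gs sg]]] : exists g : R, exists sig : int,
   [/\ 0 < g * - a, g = 1 \/ g = -1 & sig%:~R = - g].
  have [h|h|h] := ltgtP a 0; last by rewrite h eqxx in a0.
    by exists 1, (- 1); split; [lra|left|].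
  by exists (- 1), 1; split; [lra|right|rewrite opprK].
have gg : g * g = 1 by case: gs => ->; lra.
have gn : `|g| = 1 by case: gs => ->; rewrite ?normrN normr1.
have fc e : continuous (fun t => x t + e *: nv t).
  by move=> t; exact: (cvgD (@xcont t) (cvgZ (cvg_cst e) (@nvcont t))).
(* An offset curve that meets U lies in U. On the side opposite to g, its point at s0 would be on
   the downward ray. *)
have side t e : 0 < `|e| -> `|e| <= e0 -> U (x t + e *: nv t) ->
    0 < g * e /\ forall t', U (x t' + e *: nv t').
  move=> ep ee Ut.
  have all t' : U (x t' + e *: nv t').
    have off r s : [set: R] r -> x s != x r + e *: nv r by move=> _; exact: he0.
    have ii : is_interval [set: R] by [].
    exact: (U_path (fc e) ii off I Ut I).
  split=> //; rewrite ltNge; apply/negP => ge.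
  have ea : 0 <= e * a.
    by case: gs ga ge => -> ga ge; [apply: mulr_le0|apply: mulr_ge0]; lra.
  apply: (ray_off sm ea); have := all s0; congr U.
  by apply: plane_eq; rewrite !mxE /=; [rewrite vs0|rewrite -/a]; ring.
(* Every point of U hangs on the curve by a normal segment, and always from the side g. *)
have nearU p : U p -> exists t c, [/\ 0 < c, p = x t + (g * c) *: nv t &
     forall r s, 0 < r -> r <= c -> x s != x t + (g * r) *: nv t].
  move=> Up; have [t [c [c0 pE hc]]] := nearest T0 xd xT v0 (U_off Up).
  have nc : 0 < `|c| by rewrite normr_gt0.
  have Ur r : 0 < r <= 1 -> U (x t + (r * c) *: nv t).
    move=> r01.
    have pc : continuous (fun r : R => x t + (r * c) *: nv t).
      move=> z; apply: (cvgD (cvg_cst (x t))).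
      exact: (cvgZ (cvgM cvg_id (cvg_cst c)) (cvg_cst (nv t))).
    have off r' s : [set r : R | 0 < r <= 1] r' -> x s != x t + (r' * c) *: nv t by exact: hc.
    have i1 : [set r : R | 0 < r <= 1] 1 by rewrite /= ltr01 lexx.
    have U1 : U (x t + (1 * c) *: nv t) by rewrite mul1r -pE.
    exact: (U_path pc (@half_itv 1) off i1 U1 r01).
  have gc : 0 < g * c.
    pose r := Num.min 1 (e0 / `|c|).
    have r0 : 0 < r by rewrite lt_min ltr01 divr_gt0.
    have r1 : r <= 1 by rewrite ge_min lexx.
    have rc : `|r * c| <= e0.
      by rewrite normrM gtr0_norm // -ler_pdivlMr // ge_min lexx orbT.
    have [||+ _] := side t (r * c) _ rc.
    - by rewrite normr_gt0 mulf_neq0 // gt_eqF.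
    - by apply: Ur; rewrite r0.
    by rewrite mulrCA pmulr_rgt0.
  exists t, (g * c); rewrite mulrA gg mul1r; split=> // r s r0 rc.
  have := hc (r / (g * c)) s; rewrite divr_gt0 //= ler_pdivrMr // mul1r => /(_ rc).
  rewrite (_ : r / (g * c) * c = g * r) //.
  have g0 : g != 0 by rewrite -normr_eq0 gn oner_eq0.
  apply: (mulfI g0); rewrite [in RHS]mulrA gg mul1r mulrCA divfK // gt_eqF //.
have [p0 Up0] : exists p, U p.
  have [_ [p pC UE]] := Uj; exists p; rewrite UE; exact: connected_component_refl.
have [t1 [c1 [c10 p0E hc1]]] := nearU _ Up0.
pose E := Num.min e0 (Num.min e1 c1).
have E0 : 0 < E by rewrite !lt_min e00 e10.
have Ee0 : E <= e0 by rewrite ge_min lexx.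
have Ee1 : E <= e1 by rewrite !ge_min lexx orbT.
have Ec1 : E <= c1 by rewrite !ge_min lexx !orbT.
have ng e : 0 < e -> `|g * e| = e by move=> ep; rewrite normrM gn mul1r gtr0_norm.
(* Descend along the normal from p0 to offset e, then follow the offset curve. *)
have tubeU e t : 0 < e -> e <= E -> U (x t + (g * e) *: nv t).
  move=> ep eE; have Ut1 : U (x t1 + (g * e) *: nv t1).
    have pc : continuous (fun r : R => x t1 + (g * r) *: nv t1).
      move=> z; apply: (cvgD (cvg_cst (x t1))).
      exact: (cvgZ (cvgM (cvg_cst g) cvg_id) (cvg_cst (nv t1))).
    have off r s : [set r : R | 0 < r <= c1] r -> x s != x t1 + (g * r) *: nv t1.
      by move=> /andP[u w]; exact: hc1.
    have i1 : [set r : R | 0 < r <= c1] c1 by rewrite /= c10 lexx.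
    have U1 : U (x t1 + (g * c1) *: nv t1) by rewrite -p0E.
    have ie : [set r : R | 0 < r <= c1] e by rewrite /= ep (le_trans eE).
    exact: (U_path pc (@half_itv c1) off i1 U1 ie).
  by have [||_] := side t1 (g * e) _ _ Ut1; rewrite ?ng // (le_trans eE).
have tubeoff e s t : 0 < e -> e <= E -> x s != x t + (g * e) *: nv t.
  by move=> ep eE; apply: he0; rewrite ng // (le_trans eE).
pose zup := x s0 + (g * E) *: nv s0; pose zdn := x s0 - (g * E) *: nv s0.
have zup_off s : x s != zup by exact: tubeoff.
have zdn_off s : x s != zdn.
  by rewrite /zdn -scaleNr; apply: he0; rewrite normrN ng.
(* zdn lies below the whole curve, so x t - zdn has positive imaginary part. *)
have wdn : wn T (gz zdn) 0.
  have [lc lT l0] := gz_loop zdn_off.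
  apply: wn_im => //; last by rewrite -[in LHS](add0r T) lT.
  move=> t; rewrite /gz /zdn /toC /cim /= !mxE -/a /=.
  have := sm t; have := mulr_gt0 ga E0; lra.
have wup : wn T (gz zup) sig.
  have [n wn_] := wn_ex T0 (gz_loop zup_off).
  suff <- : n = sig by [].
  apply: (mulrIz (oner_neq0 R)); rewrite sg.
  (* [jump] compares the two sides of nv; for g = -1 the points zup and zdn exchange roles. *)
  move: wn_ wdn; rewrite /zup /zdn; case: gs => ->.
    rewrite mul1r => w1 w2; have := he1 E E0 Ee1 _ _ w1 w2.
    by rewrite subr0 => ->; rewrite mulrN1z.
  rewrite mulN1r scaleNr opprK => w1 w2; have := he1 E E0 Ee1 _ _ w2 w1.
  by rewrite sub0r opprK => /oppr_inj ->.
exists sig; split.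
- have : sig%:~R = 1 :> R \/ sig%:~R = -1 :> R by case: gs => e; rewrite sg e; [right|left; rewrite opprK].
  case=> h; [left|right]; apply: (mulrIz (oner_neq0 R)); rewrite h ?mulrN1z //.
- move=> p Up; have [t [c [c0 pE hc]]] := nearU _ Up.
  pose E' := Num.min E c.
  have E'0 : 0 < E' by rewrite lt_min E0.
  have E'E : E' <= E by rewrite ge_min lexx.
  have E'c : E' <= c by rewrite ge_min lexx orbT.
  pose st (u : R) := (1 - u) * s0 + u * t.
  pose se (u : R) := (1 - u) * E + u * E'.
  pose sf (u : R) := (1 - u) * E' + u * c.
  have aff (y z : R) : continuous (fun u : R => (1 - u) * y + u * z).
    move=> u; have k1 : {for u, continuous (fun w : R => 1 - w)}.
      exact: (cvgB (cvg_cst (1 : R)) cvg_id).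
    have k2 : {for u, continuous (fun w : R => (1 - w) * y)}.
      exact: (cvgM k1 (cvg_cst y)).
    have k3 : {for u, continuous (fun w : R => w * z)}.
      exact: (cvgM cvg_id (cvg_cst z)).
    exact: (cvgD k2 k3).
  (* From zup the base point slides along the tube to the foot of p while its offset shrinks from E
     to E'; the path after that climbs the normal to p. *)
  have w1 : wn T (gz (x t + (g * E') *: nv t)) sig.
    pose F u := x (st u) + (g * se u) *: nv (st u).
    have F0 : F 0 = zup by rewrite /F /st /se !subr0 !mul1r !mul0r !addr0.
    have F1 : F 1 = x t + (g * E') *: nv t by rewrite /F /st /se !subrr !mul1r !mul0r !add0r.
    rewrite -F1; apply: wn_gz_path; last by rewrite F0.
      move=> u; have c2 : {for u, continuous (fun u => x (st u))}.
        exact: (continuous_comp (@aff s0 t u) (@xcont _)).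
      have c3 : {for u, continuous (fun u => nv (st u))}.
        exact: (continuous_comp (@aff s0 t u) (@nvcont _)).
      exact: (cvgD c2 (cvgZ (cvgM (cvg_cst g) (@aff E E' u)) c3)).
    move=> u s u01; have [/andP[k1 k2] _] := convex_between E'0 E'E u01.
    exact: tubeoff.
  pose F u := x t + (g * sf u) *: nv t.
  have F0 : F 0 = x t + (g * E') *: nv t by rewrite /F /sf subr0 mul1r mul0r addr0.
  have F1 : F 1 = p by rewrite /F /sf subrr mul1r mul0r add0r -pE.
  rewrite -F1; apply: wn_gz_path; last by rewrite F0.
    move=> u; exact: (cvgD (cvg_cst (x t)) (cvgZ (cvgM (cvg_cst g) (@aff E' c u)) (cvg_cst (nv t)))).
  move=> u s u01; have [_ /andP[k1 k2]] := convex_between E'0 E'c u01.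
  exact: hc.
- have vl : loop T (fun t => toC (v t)).
    split=> [t|t|t]; [|by rewrite vT|by rewrite toC_eq0].
    by apply: (@cca_comp R _ _ v (@toC R)); [exact: vc|exact: toC_cont].
  have [n wv] := wn_ex T0 vl; suff <- : n = sig by [].
  pose G t := x t + (g * E) *: nv t.
  (* On this torus the first circle winds sig times, as the curve seen from zup, and the diagonal is
     - g E nv, a complex constant times v. *)
  pose H (ab : R * R) := toC (x (ab.1 + s0) - G (ab.2 + s0)).
  have cs (f : R -> P) : continuous f -> continuous (fun t => f (t + s0)).
    move=> cf t; have k : {for t, continuous (fun t => t + s0)} by exact: (cvgD cvg_id (cvg_cst s0)).
    exact: (continuous_comp (f := fun t => t + s0) (g := f) k (cf _)).
  have Gc : continuous G := fc _.
  have Hc : ccont H.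
    move=> ts; apply: (@cca_comp R _ _ (fun ts : R * R => x (ts.1 + s0) - G (ts.2 + s0)) (@toC R));
      last exact: toC_cont.
    have k1 : {for ts, continuous (fun p : R * R => x (p.1 + s0))}.
      exact: (continuous_comp (f := fun p : R * R => p.1) cvg_fst (@cs _ xcont _)).
    have k2 : {for ts, continuous (fun p : R * R => G (p.2 + s0))}.
      exact: (continuous_comp (f := fun p : R * R => p.2) cvg_snd (@cs _ Gc _)).
    exact: (cvgB k1 k2).
  have H0 t s : H (t, s) != 0 by rewrite toC_eq0 subr_eq0; exact: tubeoff.
  have GT t : G (t + T) = G t by rewrite /G xT nvper.
  have HT1 t s : H (t + T, s) = H (t, s) by rewrite /H /= addrAC xT.
  have HT2 t s : H (t, s + T) = H (t, s) by rewrite /H /= [s + T + _]addrAC GT.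
  have w1 : wn T (fun t => H (t, 0)) sig.
    have := wn_shift s0 T0 (gz_loop zup_off) wup.
    by apply: wn_ext => t _; rewrite /H /= add0r.
  have l2 : loop T (fun s => H (0, s)).
    split=> [s|s|s]; [|exact: HT2|exact: H0].
    have k : {for s, continuous (fun s : R => (0 : R, s))} by exact: (cvg_pair (cvg_cst 0) cvg_id).
    exact: (cca_comp k (Hc _)).
  have [m w2] := wn_ex T0 l2.
  (* The second circle is the inner offset curve seen from x s0. Moving x s0 down the ray never
     meets U, and at depth Y it is below all of U, where the winding number is 0. *)
  have m0 : m = 0.
    pose Y := M + 1 + `|x s0 0 1|.
    have Y0 : 0 <= Y by rewrite /Y; have := normr_ge0 (x s0 0 1); lra.
    pose K (ty : R * R) := toC (x s0 - pt 0 (Y * ty.2) - G (ty.1 + s0)).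
    have K1 : wn T (fun t => K (t, 1)) m.
      apply: (@wn_homotopy R T K _ T0).
      - move=> ts; apply: (@cca_comp R _ _ (fun ts : R * R => x s0 - pt 0 (Y * ts.2) - G (ts.1 + s0)) (@toC R));
          last exact: toC_cont.
        have k1 : {for ts, continuous (fun p : R * R => pt 0 (Y * p.2))}.
          by apply: pt_cont; [exact: cvg_cst|exact: (cvgM (cvg_cst Y) cvg_snd)].
        have k2 : {for ts, continuous (fun p : R * R => G (p.1 + s0))}.
          exact: (continuous_comp (f := fun p : R * R => p.1) cvg_fst (@cs _ Gc _)).
        exact: (cvgB (cvgB (cvg_cst (x s0)) k1) k2).
      - move=> t s /andP[s1 s2]; rewrite toC_eq0 subr_eq0; apply/eqP => e.
        have Ys : 0 <= Y * s by apply: mulr_ge0.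
        by apply: (ray_off sm Ys); rewrite e; exact: tubeU.
      - by move=> s _; rewrite /K /= [T + _]addrC GT add0r.
      - apply: wn_ext w2 => t _; rewrite /K /H /= mulr0 add0r.
        by congr (toC (_ - _)); apply: plane_eq; rewrite !mxE subr0.
    suff : wn T (fun t => K (t, 1)) 0 by exact: wn_uniq (ltW T0) K1.
    have : wn T (fun t => - K (t, 1)) 0.
      apply: wn_im.
      - move=> t; apply: ccaN.
        apply: (@cca_comp R _ _ (fun t : R => x s0 - pt 0 (Y * 1) - G (t + s0)) (@toC R)); last exact: toC_cont.
        exact: (cvgB (cvg_cst (x s0 - pt 0 (Y * 1))) (@cs _ Gc t)).
      - move=> t; rewrite cimN oppr_gt0 /K /toC /cim /= !mxE /=.
        have := hM _ (tubeU E (t + s0) E0 (lexx E)).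
        move=> /plane_normP[_]; rewrite ler_norml !mxE /= /Y => /andP[h _].
        have := ler_norm (x s0 0 1); lra.
      - by rewrite /K /= [T + _]addrC GT add0r.
    by move/wnN; apply: wn_ext => t _; rewrite opprK.
  have := wn_torus T0 Hc H0 HT1 HT2 w1 w2; rewrite m0 addr0 => wd.
  have cst0 : - ((g * E)%:C * (0 +i* -1)) != 0 :> R[i].
    rewrite oppr_eq0 mulf_neq0 //; apply/eqP => -[].
      by move/eqP; rewrite mulf_eq0 (gt_eqF E0) orbF -normr_eq0 gn oner_eq0.
    by move/eqP; rewrite oppr_eq0 oner_eq0.
  have := wnM (wn_cst T cst0) (wn_shift s0 T0 vl wv); rewrite add0r => wd'.
  apply: (wn_uniq (ltW T0) wd'); apply: wn_ext wd => t _.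
  by rewrite /H /G /= opprD addNKr -scaleNr toCZ toC_perp mulrA rmorphN mulNr.
- move=> t B /nbhs_ballP[r /= r0 hr].
  pose N := `|nv t| + 1; have N0 : 0 < N by rewrite ltr_wpDl.
  pose e := Num.min E (r / 2 / N).
  have ep : 0 < e by rewrite lt_min E0 !divr_gt0.
  exists (x t + (g * e) *: nv t); split; first by apply: tubeU; rewrite // ge_min lexx.
  apply: hr; rewrite -ball_normE /= opprD addNKr normrN normrZ ng //.
  have eN : e * N <= r / 2 by rewrite -ler_pdivlMr // ge_min lexx orbT.
  have : e * `|nv t| <= e * N by rewrite ler_pM2l // lerDl.
  lra.
Qed.
End Interior.

(** * Maps without zeros inside the curve *)

Section Extension.
Variable R : realType.
Local Notation P := 'rV[R]_2.

Lemma cca_near (X : topologicalType) (u w : X -> R[i]) z :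
  (\forall y \near z, w y = u y) -> w z = u z -> cca u z -> cca w z.
Proof.
move=> n e [a b]; split; rewrite e.
  by apply: cvg_trans a; apply: near_eq_cvg; apply: filterS n => y ->.
by apply: cvg_trans b; apply: near_eq_cvg; apply: filterS n => y ->.
Qed.

Lemma cca_paste (X : topologicalType) (u1 u2 w : X -> R[i]) z :
  (forall y, w y = u1 y \/ w y = u2 y) -> u1 z = u2 z ->
  cca u1 z -> cca u2 z -> cca w z.
Proof.
move=> h e [a1 b1] [a2 b2]; have wz : w z = u1 z by case: (h z) => ->.
split; rewrite wz; apply/cvgrPdist_lt => /= r r0.
  move/cvgrPdist_lt: a1 => /(_ _ r0); move/cvgrPdist_lt: a2 => /(_ _ r0) /=.
  by apply: filterS2 => y k2 k1; case: (h y) => ->; rewrite // e.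
move/cvgrPdist_lt: b1 => /(_ _ r0); move/cvgrPdist_lt: b2 => /(_ _ r0) /=.
by apply: filterS2 => y k2 k1; case: (h y) => ->; rewrite // e.
Qed.

(** On the curve the given map and its extension agree only up to a positive factor, so they are
    glued after normalisation. *)
Definition un (w : R[i]) : R[i] := ((Num.sqrt (sqn w))^-1)%:C * w.

Lemma sqrt_sqn_gt0 (w : R[i]) : w != 0 -> 0 < Num.sqrt (sqn w).
Proof. by move=> w0; rewrite sqrtr_gt0 sqn_gt0. Qed.

Lemma un_neq0 w : w != 0 -> un w != 0.
Proof.
move=> w0; rewrite mulf_neq0 //; apply/eqP => -[] /eqP.
by rewrite invr_eq0 gt_eqF // sqrt_sqn_gt0.
Qed.

Lemma un_cca (X : topologicalType) (u : X -> R[i]) z : u z != 0 -> cca u z -> cca (fun y => un (u y)) z.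
Proof.
move=> u0 uc; apply: ccaM => //; apply: ccaR.
have k : {for z, continuous (fun y => Num.sqrt (sqn (u y)))}.
  exact: (continuous_comp (sqn_cont uc) (@sqrt_continuous R _)).
by apply: cvgV k; rewrite gt_eqF // sqrt_sqn_gt0.
Qed.

Lemma un_scale (r : R) w : 0 < r -> un (r%:C * w) = un w.
Proof.
move=> r0; rewrite /un mulrA; congr (_ * _).
have -> : sqn (r%:C * w) = r ^+ 2 * sqn w by rewrite /sqn !cE; ring.
rewrite sqrtrM ?sqr_ge0 // sqrtr_sqr gtr0_norm // invfM.
by rewrite -rmorphM mulrAC mulVf ?mul1r // gt_eqF.
Qed.

(** Negative powers are powers of the conjugate: same winding number, no division, and continuity at
    0. [Negz n] stands for - (n + 1). *)
Definition cpow (w : R[i]) (k : int) : R[i] :=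
  match k with Posz n => w ^+ n | Negz n => (w^*) ^+ n.+1 end.

Lemma cpow_neq0 w k : w != 0 -> cpow w k != 0.
Proof.
by move=> w0; case: k => n; rewrite /cpow expf_neq0 // conjc_eq0.
Qed.

Lemma cca_exp (X : topologicalType) (u : X -> R[i]) n z : cca u z -> cca (fun y => u y ^+ n) z.
Proof.
move=> uc; elim: n => [|n IH]; first exact: cca_cst.
by apply: cca_ext (ccaM uc IH) => y; rewrite exprS.
Qed.

Lemma cca_cpow (X : topologicalType) (u : X -> R[i]) k z : cca u z -> cca (fun y => cpow (u y) k) z.
Proof. by move=> uc; case: k => n; apply: cca_exp => //; apply: ccaC. Qed.

Lemma wn_exp T (f : R -> R[i]) n m : wn T f m -> wn T (fun t => f t ^+ n) (n%:Z * m).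
Proof.
move=> w; elim: n => [|n IH].
  by rewrite mul0r; apply: wn_cst; exact: oner_neq0.
have := wnM w IH; rewrite intS mulrDl mul1r.
by apply: wn_ext => t _; rewrite exprS.
Qed.

Lemma wn_cpow T (f : R -> R[i]) k m : wn T f m -> wn T (fun t => cpow (f t) k) (k * m).
Proof.
move=> w; case: k => n; first exact: wn_exp.
by have := wn_exp n.+1 (wnC w); rewrite NegzE mulrN mulNr.
Qed.

(** With w the maximum norm, cos^2 + sin^2 = 1 gives 1 <= 2 w^2 <= (2 w)^2. It serves to push a
    large circle out of U. *)
Lemma norm_cis (y : R) : 1 <= 2 * `|pt (cos y) (sin y)|.
Proof.
have /plane_normP := lexx `|pt (cos y) (sin y)|; rewrite pt0 pt1 => -[b1 b2].
have n0 := normr_ge0 (pt (cos y) (sin y)); have e1 := cos2Dsin2 y.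
move: b1 b2 n0; move: `|pt _ _| => w b1 b2 n0.
have h1 : cos y ^+ 2 <= w ^+ 2 by rewrite -[leLHS]real_normK ?num_real // ler_sqr ?nnegrE.
have h2 : sin y ^+ 2 <= w ^+ 2 by rewrite -[leLHS]real_normK ?num_real // ler_sqr ?nnegrE.
have h3 : 1 <= (2 * w) ^+ 2 by rewrite exprMn; lra.
by rewrite -(@ler_pXn2r _ 2) ?nnegrE ?expr1n //; lra.
Qed.

Variables (x : R -> P) (T : R) (U : set P) (sig : int) (q : P).
Hypotheses (T0 : 0 < T) (xc : continuous x) (xT : forall t, x (t + T) = x t)
  (xinj : forall s t, s < t -> x s = x t -> T <= t - s)
  (Uopen : open U) (Ubd : exists2 M, 0 <= M & forall p, U p -> `|p| <= M)
  (Ucl : forall p, closure U p -> U p \/ range x p) (Uoff : forall p, U p -> forall s, x s != p)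
  (Ux : forall t, closure U (x t)) (Uq : U q)
  (sig1 : sig = 1 \/ sig = - 1) (ind : forall p, U p -> wn T (gz x p) sig).

(** Injectivity on a period together with th T = th 0 makes th a function on the curve. It is
    continuous because the preimage of a closed set is the image under x of a compact set of times;
    Tietze's theorem extends it. *)
Lemma curve_function (th : R -> R) : continuous th -> th T = th 0 ->
  exists2 a : P -> R, continuous a & forall t, 0 <= t <= T -> a (x t) = th t.
Proof.
move=> thc thT.
have cK : compact (range x).
  rewrite -(curveE T0 xT); apply: continuous_compact; last exact: segment_compact.
  exact: continuous_subspaceT.
have clK : closed (range x) by apply: compact_closed; [exact: norm_hausdorff|].
(* The default 0 only matters off the curve. *)
pose tau z := xget 0 [set t | 0 <= t < T /\ x t = z].
pose a z := th (tau z).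
have aE t : 0 <= t <= T -> a (x t) = th t.
  move=> /andP[t0 tT]; rewrite /a.
  have [] : 0 <= tau (x t) < T /\ x (tau (x t)) = x t.
    have [s sT e] := periodic_reduce T0 xT t.
    by apply: (@xgetPex _ 0 [set s | 0 <= s < T /\ x s = x t]); exists s.
  move: (tau _) => y /andP[y0 yT] e.
  (* Two distinct times of [0, T] at one point of the curve can only be 0 and T, where th takes
     equal values. *)
  have [yt|yt|-> //] := ltgtP y t.
    have h := xinj yt e; have -> : t = T by lra.
    by rewrite thT; congr th; lra.
  by have := xinj yt (esym e); lra.
have ac : {within range x, continuous a}.
  apply/continuous_closedP => B clB; apply/closed_subspaceP.
  exists (x @` (`[0, T] `&` th @^-1` B)).
    apply: compact_closed; first exact: norm_hausdorff.
    apply: continuous_compact; first exact: continuous_subspaceT.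
    apply: compact_closedI; first exact: segment_compact.
    by move/continuous_closedP: thc; exact.
  apply/seteqP; split=> z /=.
    move=> [[t [tT thB] <-] _]; split; last by exists t.
    have tt : 0 <= t <= T by move: tT; rewrite /= in_itv.
    by change (B (a (x t))); rewrite aE.
  move=> [az [s _ sz]]; split; last by exists s.
  have [t /andP[t0 tT] e] := periodic_reduce T0 xT s.
  exists t; last by rewrite e.
  split; first by rewrite /= in_itv /= t0 ltW.
  have tt : 0 <= t <= T by rewrite t0 ltW.
  by move: az; rewrite -sz -e; change (B (a (x t)) -> B (th t)); rewrite aE.
have [B B0 hB] := compact_bound (@segment_compact R 0 T) thc.
have B1 : 0 < B + 1 by lra.
have ab z : range x z -> `|a z| <= B + 1.
  move=> [s _ <-]; have [t /andP[t0 tT] <-] := periodic_reduce T0 xT s.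
  have tt : 0 <= t <= T by rewrite t0 ltW.
  by rewrite aE //; have := hB t; rewrite /= in_itv /= => /(_ tt); lra.
have [b [eqb bc _]] := continuous_bounded_extension (@pseudometric_normal R P) clK B1 ac ab.
exists b => // t tT; rewrite -eqb ?aE // inE; by exists t.
Qed.

(** Let u wind m times along the curve. Divided by the power k = sig m of z - q it winds 0 times, so
    the quotient has an argument on the curve, extended to [a] on the plane. Taking u on U and cis
    (a) (z - q)^k elsewhere gives, after normalisation, a zero-free continuous map of the whole
    plane: on a large circle it winds 0 times, but also k times. *)
Lemma wn_fill (u : P -> R[i]) : ccont u -> (forall p, closure U p -> u p != 0) ->
  wn T (fun t => u (x t)) 0.
Proof.
move=> uc u0.
have ul : loop T (fun t => u (x t)).
  split=> [t|t|t]; [|by rewrite xT|exact: u0].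
  exact: (cca_comp (@xc t) (uc _)).
have [m wm] := wn_ex T0 ul.
have sig2 : sig * sig = 1 by case: sig1 => ->.
pose k := sig * m; pose d (z : P) := cpow (toC (z - q)) k.
have dc : ccont d.
  move=> z; apply: cca_cpow.
  have kk : {for z, continuous (fun z : P => z - q)} by exact: (cvgB cvg_id (cvg_cst q)).
  exact: (cca_comp kk (@toC_cont R _)).
have d0 z : z != q -> d z != 0.
  by move=> zq; apply: cpow_neq0; rewrite toC_eq0 subr_eq0.
have wd : wn T (fun t => d (x t)) m.
  have := wn_cpow k (ind Uq).
  by rewrite /k mulrAC sig2 mul1r; apply: wn_ext.
pose h t := u (x t) * (d (x t))^*.
have wh : wn T h 0 by have := wnM wm (wnC wd); rewrite subrr.
have [th [thc thp thT]] := wh; rewrite mulr0 addr0 in thT.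
have [a ac aE] := curve_function thc thT.
pose e z : R[i] := (cos (a z) +i* sin (a z)) * d z.
have ec : ccont e by move=> z; apply: ccaM => //; apply: cca_cis; exact: ac.
have cis0 y : cos y +i* sin y != 0 :> R[i] := pol_neq0 (pol_cis y).
have e0 z : z != q -> e z != 0 by move=> zq; rewrite mulf_neq0 // d0.
pose G z := if pselect (U z) then un (u z) else un (e z).
have agree z : range x z -> un (u z) = un (e z).
  move=> [s _ <-]; have [t /andP[t0 tT] <-] := periodic_reduce T0 xT s.
  have tt : 0 <= t <= T by rewrite t0 ltW.
  have [r r0] := thp t tt; rewrite /h -(aE t tt) => E.
  have xq : x t != q by exact: Uoff.
  have s0 := sqn_gt0 (d0 _ xq).
  rewrite -(un_scale (u (x t)) s0) -(un_scale (e (x t)) r0); congr un.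
  have -> : (sqn (d (x t)))%:C * u (x t) = u (x t) * (d (x t))^* * d (x t).
    by apply: ceq; rewrite !cE /sqn; ring.
  by rewrite E /e mulrA; congr (_ * _); apply: ceq; rewrite !cE /cre /cim /=; ring.
have unU z : U z -> G z = un (u z) by move=> Uz; rewrite /G; case: pselect.
have unN z : ~ U z -> G z = un (e z) by move=> Uz; rewrite /G; case: pselect.
have Nq z : ~ U z -> z != q by move=> Uz; apply/eqP => zq; apply: Uz; rewrite zq.
have Gc : ccont G.
  move=> z; have [Uz|Uz] := pselect (U z).
    apply: (@cca_near _ (fun z => un (u z))); [|exact: unU|].
      by apply: filterS (open_nbhs_nbhs (conj Uopen Uz)) => y; exact: unU.
    by apply: un_cca => //; apply: u0; exact: subset_closure.
  have [cz|cz] := pselect (closure U z).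
    have rz : range x z by case: (Ucl cz).
    apply: (@cca_paste _ (fun z => un (u z)) (fun z => un (e z))); last 3 first.
    - exact: agree.
    - by apply: un_cca => //; exact: u0.
    - by apply: un_cca => //; apply: e0; exact: Nq.
    by move=> y; rewrite /G; case: pselect; [left|right].
  apply: (@cca_near _ (fun z => un (e z))); [|exact: unN|].
    have oc : open (~` closure U) by apply: closed_openC; exact: closed_closure.
    by apply: filterS (open_nbhs_nbhs (conj oc cz)) => y yc; apply: unN => /subset_closure.
  by apply: un_cca => //; apply: e0; exact: Nq.
have G0 z : G z != 0.
  have [Uz|Uz] := pselect (U z); first by rewrite unU // un_neq0 // u0 //; exact: subset_closure.
  by rewrite unN // un_neq0 // e0 // Nq.
have [M M0 hM] := Ubd.
(* By [norm_cis] a point of this circle is at distance at least Rr / 2 > M + |q| from q, hence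
   outside U. *)
pose Rr := 2 * (M + `|q|) + 1.
have Rr0 : 0 < Rr by rewrite /Rr; have := normr_ge0 q; lra.
pose om t := pi *+ 2 / T * t.
pose c t : P := q + Rr *: pt (cos (om t)) (sin (om t)).
have omc : continuous om by move=> t; exact: (cvgM (cvg_cst (pi *+ 2 / T)) cvg_id).
have cc : continuous c.
  move=> t; have k1 : {for t, continuous (fun t : R => cos (om t))}.
    exact: (continuous_comp (omc t) (@continuous_cos R _)).
  have k2 : {for t, continuous (fun t : R => sin (om t))}.
    exact: (continuous_comp (omc t) (@continuous_sin R _)).
  exact: (cvgD (cvg_cst q) (cvgZ (cvg_cst Rr) (pt_cont k1 k2))).
have omT : om T = pi *+ 2 by rewrite /om divfK // gt_eqF.
have om0 : om 0 = 0 by rewrite /om mulr0.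
have cT : c T = c 0 by rewrite /c omT om0 cos2pi sin2pi cos0 sin0.
have cU t : ~ U (c t).
  move=> /hM; rewrite /c; set w := pt _ _ => cM.
  have w2 : 1 <= 2 * `|w| by exact: norm_cis.
  have : `|Rr *: w| <= M + `|q|.
    have := ler_normB (q + Rr *: w) q; rewrite addrC addKr; lra.
  rewrite normrZ gtr0_norm // => h1.
  have : Rr * 1 <= Rr * (2 * `|w|) by rewrite ler_pM2l.
  by rewrite mulr1 {1}/Rr; lra.
(* G has an argument on a square containing the circle, and c T = c 0. *)
have wG0 : wn T (fun t => G (c t)) 0.
  have K0 : 0 < `|q| + Rr by have := normr_ge0 q; lra.
  have [|Th Thc Thp] := @plane_lift R G (`|q| + Rr) K0 Gc; first by move=> *; exact: G0.
  exists (fun t => Th (c t)); split.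
  - by move=> t; exact: (continuous_comp (cc t) (Thc _)).
  - move=> t _; apply: Thp; apply: le_trans (ler_normD _ _) _; rewrite lerD2l normrZ gtr0_norm //.
    apply: ler_piMr; [exact: ltW|]; apply/plane_normP; rewrite pt0 pt1 !ler_norml.
    by rewrite cos_geN1 cos_le1 sin_geN1 sin_le1.
  - by rewrite cT mulr0 addr0.
have wc : wn T (fun t => toC (c t - q)) 1.
  exists om; split=> //; last by rewrite omT om0 add0r mulr1.
  move=> t _; exists Rr => //.
  by apply: ceq; rewrite /c /toC /cre /cim /= !mxE /=; ring.
have wdc := wn_cpow k wc; rewrite mulr1 -/(d _) in wdc.
have wec : wn T (fun t => e (c t)) k.
  rewrite -[k]add0r; apply: wnM; last exact: wdc.
  exists (fun t => a (c t)); split; last by rewrite cT mulr0 addr0.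
    by move=> t; exact: (continuous_comp (cc t) (ac _)).
  by move=> t _; exact: pol_cis.
have wGk : wn T (fun t => G (c t)) k.
  have := wn_scale (r := fun t => (Num.sqrt (sqn (e (c t))))^-1) _ wec.
  move=> H; apply: wn_ext (H _) => t _; first by rewrite unN.
  by rewrite invr_gt0 sqrt_sqn_gt0 // e0 // Nq.
have k0 : k = 0 := wn_uniq (ltW T0) wGk wG0.
suff <- : m = 0 by [].
by have : sig * k = 0 by [rewrite k0 mulr0]; rewrite /k mulrA sig2 mul1r.
Qed.
End Extension.

(** * Removing simple zeros *)

Section Zeros.
Variable R : realType.
Local Notation P := 'rV[R]_2.

Definition nrm (z : R[i]) : R := Num.sqrt (sqn z).

Lemma nrmE z : nrm z = ComplexField.Normc.normc z. Proof. by case: z. Qed.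
Lemma nrmM z w : nrm (z * w) = nrm z * nrm w.
Proof. by rewrite !nrmE ComplexField.Normc.normcM. Qed.
Lemma nrmD z w : nrm (z + w) <= nrm z + nrm w.
Proof. by rewrite !nrmE; exact: le_normcD. Qed.
Lemma nrmN z : nrm (- z) = nrm z.
Proof. by rewrite /nrm /sqn creN cimN !sqrrN. Qed.
Lemma nrmC z : nrm z^* = nrm z.
Proof. by rewrite /nrm /sqn creC cimC sqrrN. Qed.
Lemma nrm0 : nrm 0 = 0. Proof. by rewrite nrmE ComplexField.Normc.normc0. Qed.
Lemma nrm_ge0 z : 0 <= nrm z. Proof. exact: sqrtr_ge0. Qed.
Lemma nrm_gt0 z : z != 0 -> 0 < nrm z. Proof. exact: sqrt_sqn_gt0. Qed.
Lemma nrm0_eq z : nrm z = 0 -> z = 0.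
Proof. by move=> h; apply/eqP/contraT => /nrm_gt0; rewrite h ltxx. Qed.
Lemma nrm_re z : `|cre z| <= nrm z.
Proof. by rewrite /nrm -sqrtr_sqr ler_wsqrtr // /sqn lerDl sqr_ge0. Qed.
Lemma nrm_im z : `|cim z| <= nrm z.
Proof. by rewrite /nrm -sqrtr_sqr ler_wsqrtr // /sqn lerDr sqr_ge0. Qed.
Lemma nrmR (a : R) : 0 <= a -> nrm a%:C = a.
Proof. by move=> a0; rewrite /nrm /sqn !cE expr0n /= addr0 sqrtr_sqr ger0_norm. Qed.
Lemma nrm_le z : nrm z <= `|cre z| + `|cim z|.
Proof.
have e : z = (cre z)%:C + (0 +i* 1) * (cim z)%:C.
  by apply: ceq; rewrite !cE /cre /cim /=; ring.
rewrite {1}e; apply: le_trans (nrmD _ _) _; rewrite nrmM.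
have nr (y : R) : nrm y%:C = `|y| by rewrite /nrm /sqn !cE expr0n /= addr0 sqrtr_sqr.
have -> : nrm (0 +i* 1) = 1 by rewrite /nrm /sqn /cre /cim /= expr0n add0r expr1n sqrtr1.
by rewrite !nr mul1r.
Qed.

Lemma nrm_cont : forall (X : topologicalType) (u : X -> R[i]) z, cca u z ->
  {for z, continuous (fun y => nrm (u y))}.
Proof.
by move=> X u z uc; exact: (continuous_comp (sqn_cont uc) (@sqrt_continuous R _)).
Qed.

Lemma cca_nrm (X : topologicalType) (u : X -> R[i]) z :
  (forall e, 0 < e -> \forall y \near z, nrm (u y - u z) <= e) -> cca u z.
Proof.
move=> h; split; apply/cvgrPdist_le => /= e /h; apply: filterS => y ye.
  by apply: le_trans ye; apply: le_trans (nrm_re _); rewrite creD creN distrC.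
by apply: le_trans ye; apply: le_trans (nrm_im _); rewrite cimD cimN distrC.
Qed.

Lemma nrm_toC (z : P) : `|z| <= nrm (toC z) <= 2 * `|z|.
Proof.
apply/andP; split.
  by apply/plane_normP; split; [exact: (nrm_re (toC z))|exact: (nrm_im (toC z))].
apply: le_trans (nrm_le _) _; have /plane_normP := lexx `|z|.
by rewrite /toC /cre /cim /= => -[a b]; lra.
Qed.

Definition tw (p : P) (e : int) (z : P) : R[i] := cpow (toC (z - p)) e.

Lemma nrm_tw p e z : e = 1 \/ e = - 1 -> nrm (tw p e z) = nrm (toC (z - p)).
Proof. by case=> ->; rewrite /tw /cpow /= expr1 // nrmC. Qed.

Lemma tw_cont p e : ccont (tw p e).
Proof.
move=> z; apply: cca_cpow.
have k : {for z, continuous (fun z : P => z - p)} by exact: (cvgB cvg_id (cvg_cst p)).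
exact: (cca_comp k (@toC_cont R _)).
Qed.

Lemma tw_neq0 p e z : z != p -> tw p e z != 0.
Proof. by move=> zp; apply: cpow_neq0; rewrite toC_eq0 subr_eq0. Qed.

(* p is a zero of g near which g is close to a multiple of z - p (for e = 1) or
   of its conjugate (for e = -1). *)
Definition simple_zero (g : P -> R[i]) (p : P) (e : int) :=
  (e = 1 \/ e = - 1) /\ exists a k r, [/\ a != 0, 0 <= k < 1, 0 < r &
    forall z, `|z - p| < r -> nrm (g z - a * tw p e z) <= k * nrm a * nrm (toC (z - p))].

(** The leading coefficient becomes a c (p), and k is enlarged to (1 + k) / 2 < 1 to absorb the
    oscillation of c near p. *)
Lemma simple_zero_mul g g' c p e : simple_zero g p e -> cca c p -> c p != 0 ->
  (\forall z \near p, g' z = g z * c z) -> simple_zero g' p e.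
Proof.
move=> [e1 [a [k [r [a0 /andP[k0 k1] r0 hr]]]]] cc c0 gg'.
split=> //; exists (a * c p), ((1 + k) / 2).
have na := nrm_gt0 a0; have nc := nrm_gt0 c0.
(* Chosen so that k (C + eta) + eta <= (1 + k) / 2 C with C = |c (p)|; since 1 + k <= 2, a quarter
   of (1 - k) C suffices. *)
pose eta := (1 - k) / 4 * nrm (c p).
have eta0 : 0 < eta by rewrite mulr_gt0 // divr_gt0 // subr_gt0.
have cn : {for p, continuous (fun z => nrm (c z - c p))}.
  by apply: nrm_cont; apply: ccaD => //; exact: cca_cst.
have near1 : \forall z \near p, nrm (c z - c p) < eta.
  by have /cvgr_lt := cn; apply; rewrite subrr nrm0.
have : \forall z \near p, g' z = g z * c z /\ nrm (c z - c p) < eta by exact: filterI.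
move=> /nbhs_ballP[r1 /= r10 h1].
exists (Num.min r r1); split.
- exact: mulf_neq0.
- by apply/andP; split; lra.
- by rewrite lt_min r0.
move=> z; rewrite lt_min => /andP[zr zr1].
have [-> ce] : g' z = g z * c z /\ nrm (c z - c p) < eta.
  by apply: h1; rewrite -ball_normE /= distrC.
have -> : g z * c z - a * c p * tw p e z =
  (g z - a * tw p e z) * c z + a * tw p e z * (c z - c p) by ring.
apply: le_trans (nrmD _ _) _; rewrite !nrmM nrm_tw //.
have cz : nrm (c z) <= nrm (c p) + eta.
  have -> : c z = c p + (c z - c p) by ring.
  by apply: le_trans (nrmD _ _) _; rewrite lerD2l ltW.
have nz := nrm_ge0 (toC (z - p)).
set A := nrm a; set C := nrm (c p); set Z := nrm (toC (z - p)).
have A0 : 0 < A by []. 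
have s1 : nrm (g z - a * tw p e z) * nrm (c z) <= k * A * Z * (C + eta).
  by apply: ler_pM => //; [exact: nrm_ge0|exact: nrm_ge0|exact: hr].
have s2 : A * Z * nrm (c z - c p) <= A * Z * eta.
  by apply: ler_wpM2l; [rewrite mulr_ge0 // ltW|exact: ltW].
apply: le_trans (lerD s1 s2) _.
have -> : (1 + k) / 2 * (A * C) * Z = A * Z * ((1 + k) / 2 * C) by ring.
have -> : k * A * Z * (C + eta) + A * Z * eta = A * Z * (k * (C + eta) + eta) by ring.
apply: ler_wpM2l; first by rewrite mulr_ge0 // ltW.
rewrite /eta -/C.
have : 0 <= (1 - k) * (1 - k) * C by rewrite !mulr_ge0 // ?subr_ge0 ltW.
by lra.
Qed.

(* Interpolating g / (z - p) linearly with its limit value on a small disc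
   removes the zero p without creating any other. *)
Lemma remove_zero g p e r0 : ccont g -> simple_zero g p e -> 0 < r0 ->
  exists g', [/\ ccont g', forall z, r0 <= `|z - p| -> g z = g' z * tw p e z
    & forall z, g' z = 0 -> g z = 0 /\ z <> p].
Proof.
move=> gc [e1 [a [k [r [a0 /andP[k0 k1] rp hr]]]]] r00.
have na := nrm_gt0 a0.
pose r1 := Num.min r r0 / 2.
have r10 : 0 < r1 by rewrite divr_gt0 // lt_min rp.
have r1r : r1 < r by have : Num.min r r0 <= r; [rewrite ge_min lexx|rewrite /r1; have := r10; rewrite /r1; lra].
have r1r0 : r1 <= r0 by have : Num.min r r0 <= r0; [rewrite ge_min lexx orbT|rewrite /r1; have := r10; rewrite /r1; lra].
pose m z := Num.min 1 (`|z - p| / r1).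
(* At p the quotient is 0, the inverse of 0 being 0, so h p = - a; the factor m p = 0 discards this
   value. *)
pose h z := g z / tw p e z - a.
pose g' z := a + (m z)%:C * h z.
have m0 z : 0 <= m z by rewrite le_min ler01 divr_ge0 // ltW.
have m1 z : m z <= 1 by rewrite ge_min lexx.
have hb z : `|z - p| < r -> nrm (h z) <= Num.max k 1 * nrm a.
  move=> zr; have [->|zp] := eqVneq z p.
    have tp : tw p e p = 0.
      apply: nrm0_eq; rewrite nrm_tw // subrr (_ : toC 0 = 0) ?nrm0 //.
      by apply/eqP; rewrite toC_eq0.
    rewrite /h tp.
    rewrite invr0 mulr0 sub0r nrmN ler_peMl ?nrm_ge0 // le_max lexx orbT //.
  have t0 := nrm_gt0 (tw_neq0 e zp).
  rewrite -(ler_pM2r t0) -nrmM mulrBl divfK ?tw_neq0 //.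
  apply: le_trans (hr _ zr) _; rewrite nrm_tw //.
  apply: ler_wpM2r; first exact: nrm_ge0.
  by apply: ler_wpM2r; [exact: nrm_ge0|rewrite le_max lexx].
have hk z : z != p -> `|z - p| < r -> nrm (h z) <= k * nrm a.
  move=> zp zr; have t0 := nrm_gt0 (tw_neq0 e zp).
  rewrite -(ler_pM2r t0) -nrmM mulrBl divfK ?tw_neq0 //.
  by apply: le_trans (hr _ zr) _; rewrite nrm_tw.
have mp : m p = 0 by rewrite /m subrr normr0 mul0r min_r ?ler01.
have mc : continuous m.
  move=> z; have k3 : {for z, continuous (fun z : P => z - p)} by exact: (cvgB cvg_id (cvg_cst p)).
  have k4 : {for z, continuous (fun z : P => - (`|z - p| / r1))}.
    exact: (cvgN (cvgM (cvg_norm k3) (cvg_cst r1^-1))).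
  have k5 := @continuous_max R P (cst (-1)) (fun z => - (`|z - p| / r1)) z
    (@cst_continuous _ _ _ _) k4.
  have -> : m = (fun z => - (cst (-1) \max (fun z => - (`|z - p| / r1))) z).
    by apply/funext => y /=; rewrite /m -oppr_min opprK.
  exact: (cvgN k5).
have g'p : g' p = a by rewrite /g' mp mul0r addr0.
exists g'; split.
- move=> z; have [->|zp] := eqVneq z p; last first.
    apply: ccaD; first exact: cca_cst.
    apply: ccaM; first by apply: ccaR; exact: mc.
    apply: ccaD; last exact: cca_cst.
    apply: ccaM; first exact: gc.
    by apply: ccaV; [exact: tw_neq0|exact: tw_cont].
  apply: cca_nrm => d d0; pose K := Num.max k 1 * nrm a.
  have K0 : 0 < K by rewrite mulr_gt0 // lt_max ltr01 orbT.
  apply/nbhs_ballP; exists (Num.min r (d * r1 / K)).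
    by rewrite /= lt_min rp divr_gt0 // mulr_gt0.
  move=> y; rewrite -ball_normE /= distrC lt_min => /andP[zr zd].
  rewrite g'p /g' addrC addKr nrmM nrmR //.
  apply: (@le_trans _ _ (`|y - p| / r1 * K)).
    apply: ler_pM => //; [exact: nrm_ge0|by rewrite ge_min lexx orbT|exact: hb].
  by rewrite mulrAC ler_pdivrMr // -ler_pdivlMr // ltW.
- move=> z zr0; have mz : m z = 1.
    by rewrite /m min_l // ler_pdivlMr // mul1r (le_trans r1r0).
  have zp : z != p by apply: contraTneq zr0 => ->; rewrite subrr normr0 -ltNge.
  by rewrite /g' mz mul1r addrC subrK divfK // tw_neq0.
- move=> z gz0.
  have zp : z != p by apply/eqP => zp; move: gz0; rewrite zp g'p => /eqP; rewrite (negbTE a0).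
  split; last exact/eqP.
  have [zr|zr] := ltP `|z - p| r1.
    (* A zero of g' near p means a = - m h, whereas |m h| <= k |a| < |a|. *)
    exfalso; have : nrm a <= k * nrm a.
      have ne : nrm a = nrm ((m z)%:C * h z).
        by rewrite -[in RHS]nrmN; congr nrm; apply/eqP; rewrite -subr_eq0 opprK; apply/eqP.
      have mh : m z * nrm (h z) <= nrm (h z) by rewrite ler_piMl ?nrm_ge0.
      by rewrite {1}ne nrmM nrmR //; apply: (le_trans mh); apply: hk zp (lt_trans zr r1r).
    by rewrite leNgt -{2}[nrm a]mul1r ltr_pM2r // k1.
  have mz : m z = 1 by rewrite /m min_l // ler_pdivlMr // mul1r.
  move: gz0; rewrite /g' mz mul1r addrC subrK => /eqP.
  by rewrite mulf_eq0 invr_eq0 (negbTE (tw_neq0 e zp)) orbF => /eqP.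
Qed.

Lemma separate (p : P) (s : seq P) r : 0 < r -> p \notin s ->
  exists r0, [/\ 0 < r0, r0 <= r & forall q, q \in s -> r0 < `|q - p|].
Proof.
move=> r0; elim: s => [|q s IH]; first by exists r.
rewrite inE negb_or => /andP[pq /IH[r1 [r10 r1r h]]].
have d0 : 0 < `|q - p| by rewrite normr_gt0 subr_eq0 eq_sym.
exists (Num.min r1 (`|q - p| / 2)); split.
- by rewrite lt_min r10 divr_gt0.
- by rewrite ge_min r1r.
move=> y; rewrite inE => /orP[/eqP ->|/h ys]; rewrite gt_min.
  by apply/orP; right; lra.
by rewrite ys.
Qed.

Variables (x : R -> P) (T : R) (U : set P) (sig : int) (q : P).
Hypotheses (T0 : 0 < T) (xc : continuous x) (xT : forall t, x (t + T) = x t)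
  (xinj : forall s t, s < t -> x s = x t -> T <= t - s)
  (Uopen : open U) (Ubd : exists2 M, 0 <= M & forall p, U p -> `|p| <= M)
  (Ucl : forall p, closure U p -> U p \/ range x p) (Uoff : forall p, U p -> forall s, x s != p)
  (Ux : forall t, closure U (x t)) (Uq : U q)
  (sig1 : sig = 1 \/ sig = - 1) (ind : forall p, U p -> wn T (gz x p) sig).

(** Induction on the list of zeros, from [wn_fill]. Splitting off p contributes the winding number e
    sig of the model factor; near the other zeros the quotient differs from g by a continuous
    non-vanishing factor, so they stay simple with the same sign. *)
Lemma zeros_sum (s : seq (P * int)) (g : P -> R[i]) : ccont g -> uniq (map fst s) ->
  (forall pe, pe \in s -> U pe.1 /\ simple_zero g pe.1 pe.2) ->
  (forall z, closure U z -> g z = 0 -> z \in map fst s) ->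
  wn T (fun t => g (x t)) (sig * \sum_(pe <- s) pe.2).
Proof.
elim: s g => [|[p e] s IH] g gc us hs hz.
  rewrite big_nil mulr0.
  apply: (wn_fill T0 xc xT xinj Uopen Ubd Ucl Uoff Ux Uq sig1 ind) => // z cz.
  by apply/eqP => /(hz z cz).
have [/= Up gp] := hs (p, e) (mem_head _ _).
move: us => /= /andP[ps us].
have [r r0 hr] : exists2 r, 0 < r & forall z, `|z - p| < r -> U z.
  have := Uopen; rewrite openE => /(_ p Up) /nbhs_ballP[r /= r0 hr].
  by exists r => // z zr; apply: hr; rewrite -ball_normE /= distrC.
(* The disc of radius r1 lies in U, so g = g' tw holds on the curve, and it stays away from the
   remaining zeros. *)
have [r1 [r10 r1r h1]] := separate r0 ps.
have [g' [g'c gg' g'0]] := remove_zero gc gp r10.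
have w' : wn T (fun t => g' (x t)) (sig * \sum_(pe <- s) pe.2).
  apply: IH => //.
    move=> pe pes; have [Upe gpe] := hs pe (mem_behead (s := (p, e) :: s) pes).
    split=> //; have hpe : r1 < `|pe.1 - p| by apply: h1; exact: map_f.
    have pp : pe.1 != p by apply: contraTneq hpe => ->; rewrite subrr normr0 -leNgt ltW.
    have c0 := tw_neq0 e pp.
    apply: (simple_zero_mul (c := fun z => (tw p e z)^-1) gpe).
    - by apply: ccaV => //; exact: tw_cont.
    - by rewrite invr_eq0.
    have k3 : {for pe.1, continuous (fun z : P => z - p)} by exact: (cvgB cvg_id (cvg_cst p)).
    have : \forall z \near pe.1, r1 < `|z - p| by exact: (cvgr_gt _ (cvg_norm k3) r1 hpe).
    apply: filterS => z zr; rewrite (gg' z (ltW zr)) mulfK // tw_neq0 //.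
    by apply: contraTneq zr => ->; rewrite subrr normr0 -leNgt ltW.
  move=> z cz /g'0[gz0 zp]; have := hz z cz gz0; rewrite inE => /orP[/eqP //|//].
have wt : wn T (fun t => tw p e (x t)) (e * sig) := wn_cpow e (ind Up).
have := wnM w' wt; rewrite big_cons /= mulrDr addrC [e * sig]mulrC.
apply: wn_ext => t _; rewrite -gg' // leNgt; apply/negP => xr.
by have := Uoff (hr _ (lt_le_trans xr r1r)) t; rewrite eqxx.
Qed.
End Zeros.

(** * The degree formula *)

Section Degree.
Variable R : realType.
Local Notation P := 'rV[R]_2.

Lemma diff_expansion (g : P -> P) p : differentiable g p -> forall e, 0 < e ->
  exists2 r, 0 < r & forall z, `|z - p| < r ->
    `|g z - g p - (z - p) *m jacobian g p| <= e * `|z - p|.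
Proof.
move=> dg e e0; have /diff_locallyP[_ /eqaddoP/(_ e e0)] := dg.
move=> /nbhs_ballP[r /= r0 hr]; exists r => // z zr.
have := hr (z - p); rewrite -ball_normE /= sub0r normrN => /(_ zr).
by rewrite !fctE /= /shift subrK opprD addrA /jacobian mul_rV_lin1.
Qed.

Lemma det2 (A : 'M[R]_2) : \det A = A 0 0 * A 1 1 - A 0 1 * A 1 0.
Proof.
rewrite (expand_det_row _ ord0) !big_ord_recl big_ord0 addr0 ord2_1 /cofactor !det_mx11 !mxE.
rewrite /= expr0 expr1 mul1r.
have -> : lift 0 0 = 1 :> 'I_2 by exact/val_inj.
have -> : lift 1 0 = 0 :> 'I_2 by exact/val_inj.
by rewrite mulN1r mulrN.
Qed.

(* A real-linear map of the plane is w |-> A w + B w^*, with determinant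
   |A|^2 - |B|^2. *)
Lemma C1_simple_zero (g : P -> P) p : differentiable g p -> g p = 0 ->
  \det (jacobian g p) != 0 ->
  simple_zero (fun z => toC (g z)) p (sgz (\det (jacobian g p))).
Proof.
move=> dg gp; set J := jacobian g p; set D := \det J => D0.
pose A : R[i] := ((J 0 0 + J 1 1) / 2) +i* ((J 0 1 - J 1 0) / 2).
pose B : R[i] := ((J 0 0 - J 1 1) / 2) +i* ((J 0 1 + J 1 0) / 2).
have lin z : toC (z *m J) = A * toC z + B * (toC z)^*.
  by apply: ceq; rewrite !cE /A /B /toC /cre /cim /= !mulmx2E; field.
have DE : D = sqn A - sqn B by rewrite /D det2 /sqn /cre /cim /=; field.
have key (a b : R[i]) e (w' : P -> R[i]) : (e = 1 \/ e = - 1) -> sqn b < sqn a ->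
    (forall z, nrm (w' z) = nrm (toC (z - p))) ->
    (forall z, toC ((z - p) *m J) = a * tw p e z + b * w' z) ->
    simple_zero (fun z => toC (g z)) p e.
  move=> e1 ba nw dec; split=> //.
  (* With eta = (|a| - |b|) / 4 the error is at most |b| + 2 eta = (|a| + |b|) / 2 times the
     distance, a proportion of |a| below 1. The factor 2 is the cost of passing from maximum to
     Euclidean norm. *)
  have lt_ba : nrm b < nrm a by rewrite ltr_sqrt //; apply: le_lt_trans ba; rewrite addr_ge0 ?sqr_ge0.
  have b0 := nrm_ge0 b; have a0 : 0 < nrm a by exact: le_lt_trans lt_ba.
  pose eta := (nrm a - nrm b) / 4.
  have eta0 : 0 < eta by rewrite divr_gt0 // subr_gt0.
  have [r r0 hr] := diff_expansion dg eta0.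
  exists a, ((nrm a + nrm b) / (2 * nrm a)), r; split=> //.
  - by apply: contraTneq a0 => ->; rewrite nrm0 ltxx.
  - have a2 : 0 < 2 * nrm a by rewrite mulr_gt0.
    apply/andP; split; first by rewrite divr_ge0 ?addr_ge0 // ltW.
    by rewrite ltr_pdivrMr //; lra.
  move=> z zr.
  have -> : toC (g z) - a * tw p e z = toC (g z - g p - (z - p) *m J) + b * w' z.
    by rewrite toCB gp subr0 dec; ring.
  apply: le_trans (nrmD _ _) _; rewrite nrmM nw.
  have /andP[_ n1] := nrm_toC (g z - g p - (z - p) *m J).
  have /andP[n2 _] := nrm_toC (z - p).
  have := hr z zr; set X := `|_ - _ *m _| in n1 *; move=> hX.
  set Z := nrm (toC (z - p)) in n2 *.
  have h1 : eta * `|z - p| <= eta * Z by rewrite ler_pM2l.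
  have -> : (nrm a + nrm b) / (2 * nrm a) * nrm a * Z = (nrm a + nrm b) / 2 * Z.
    by field; rewrite gt_eqF.
  have -> : (nrm a + nrm b) / 2 * Z = 2 * (eta * Z) + nrm b * Z by rewrite /eta; field.
  by rewrite lerD2r; lra.
have [Dn|Dp|/eqP] := ltgtP D 0; last by rewrite (negbTE D0).
- rewrite ltr0_sgz //.
  apply: (key B A _ (fun z => toC (z - p))); [by right|by rewrite -subr_lt0 -DE|by []|].
  by move=> z; rewrite lin addrC /tw /cpow /= expr1.
- rewrite gtr0_sgz //.
  apply: (key A B _ (fun z => (toC (z - p))^*)); [by left|by rewrite -subr_gt0 -DE| |].
    by move=> z; rewrite nrmC.
  by move=> z; rewrite lin /tw /cpow /= expr1.
Qed.

(** Finitely many of the balls cover K, and each contains no point of Z but possibly its centre. *)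
Lemma finite_isolated (K Z : set P) : compact K ->
  (forall p, K p -> exists2 r, 0 < r & forall z, Z z -> `|z - p| < r -> z = p) ->
  Z `<=` K -> finite_set Z.
Proof.
move=> cK iso ZK.
have /choice[rad hrad] : forall p, exists r, K p -> 0 < r /\ forall z, Z z -> `|z - p| < r -> z = p.
  move=> p; have [/iso[r r0 hr]|nK] := pselect (K p); first by exists r.
  by exists 0.
have := cK; rewrite compact_cover => /(_ _ K (fun p => ball p (rad p))).
case.
- by move=> p /hrad[r0 _]; exact: ball_open.
- by move=> p Kp; exists p => //; apply: ballxx; case: (hrad p Kp).
move=> D DK cov; apply: sub_finite_set (finite_fset D).
move=> z Zz; have [p pD] := cov z (ZK z Zz); rewrite -ball_normE /= distrC => zp.
have Kp : K p by have := DK p pD; rewrite inE.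
by have [_ h] := hrad p Kp; rewrite (h z Zz zp).
Qed.

Variables (x : R -> P) (T : R) (U : set P) (sig : int) (q : P).
Hypotheses (T0 : 0 < T) (xc : continuous x) (xT : forall t, x (t + T) = x t)
  (xinj : forall s t, s < t -> x s = x t -> T <= t - s)
  (Uopen : open U) (Ubd : exists2 M, 0 <= M & forall p, U p -> `|p| <= M)
  (Ucl : forall p, closure U p -> U p \/ range x p) (Uoff : forall p, U p -> forall s, x s != p)
  (Ux : forall t, closure U (x t)) (Uq : U q)
  (sig1 : sig = 1 \/ sig = - 1) (ind : forall p, U p -> wn T (gz x p) sig).

Lemma boundaryE : boundary U = range x.
Proof.
rewrite /boundary (interior_id _).1 //; apply/seteqP; split=> p.
  by move=> [/Ucl[]].
by move=> [s _ <-]; split; [exact: Ux|move=> /Uoff/(_ s); rewrite eqxx].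
Qed.

Lemma closure_compact : compact (closure U).
Proof.
apply: bounded_closed_compact; last exact: closed_closure.
have [M M0 hM] := Ubd; exists M; split; first exact: num_real.
move=> y My p; have cM : closed [set p : P | `|p| <= M].
  exact: (closed_comp (fun x _ => @norm_continuous _ _ x) (@closed_le R M)).
have UM : U `<=` [set p : P | `|p| <= M] by move=> z /hM.
move=> /(closure_subset UM); rewrite -(closure_id _).1 //= => pM.
exact: le_trans pM (ltW My).
Qed.

(** At a boundary point |g - F| < |F|, so the straight homotopy from F to g has no zero on the curve
    and g also winds n times. Regular zeros are isolated, hence finitely many by compactness, and
    [zeros_sum] gives n = sig times the sum of signs; finally sig^2 = 1. *)
Lemma degree_formula (F : P -> P) n : continuous F -> (forall t, F (x t) != 0) ->
  wn T (fun t => toC (F (x t))) n ->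
  forall g, regular_approx F U g -> sign_sum U g = sig * n.
Proof.
move=> Fc F0 wF g [[gd Jc] ga greg].
have gc : continuous g by move=> p; exact: differentiable_continuous.
have gx t : `|g (x t) - F (x t)| < `|F (x t)|.
  by apply: ga; [exact: Ux|rewrite boundaryE; exists t].
have gx0 t s : 0 <= s <= 1 -> F (x t) + s *: (g (x t) - F (x t)) != 0.
  move=> /andP[s0 s1]; apply/eqP => e.
  have : `|F (x t)| = `|s *: (g (x t) - F (x t))|.
    by rewrite -[in LHS](subr0 (F _)) -e opprD addNKr normrN.
  rewrite normrZ ger0_norm // => e1.
  have := gx t; rewrite {1}e1 ltNge ler_piMl //.
have wg : wn T (fun t => toC (g (x t))) n.
  pose H (ts : R * R) := toC (F (x ts.1) + ts.2 *: (g (x ts.1) - F (x ts.1))).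
  have : wn T (fun t => H (t, 1)) n.
    apply: (@wn_homotopy R T H n T0).
    - move=> ts.
      have kx : {for ts, continuous (fun p : R * R => x p.1)}.
        exact: (continuous_comp (f := fun p : R * R => p.1) cvg_fst (@xc _)).
      have kF : {for ts, continuous (fun p : R * R => F (x p.1))}.
        exact: (continuous_comp kx (@Fc _)).
      have kg : {for ts, continuous (fun p : R * R => g (x p.1))}.
        exact: (continuous_comp kx (@gc _)).
      have kk : {for ts, continuous (fun p : R * R => F (x p.1) + p.2 *: (g (x p.1) - F (x p.1)))}.
        exact: (cvgD kF (cvgZ cvg_snd (cvgB kg kF))).
      exact: (cca_comp kk (@toC_cont R _)).
    - by move=> t s s01; rewrite toC_eq0 gx0.
    - by move=> s _; rewrite /H /= -(add0r T) xT.
    - by apply: wn_ext wF => t _; rewrite /H /= scale0r addr0.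
  by apply: wn_ext => t _; rewrite /H /= scale1r addrC subrK.
have gnz t : g (x t) != 0.
  by have := gx0 t 1; rewrite lexx ler01 scale1r addrC subrK; exact.
pose Z := U `&` [set p | g p = 0].
have cZ p : closure U p -> g p = 0 -> Z p.
  by move=> /Ucl[//|[s _ <-] e]; have := gnz s; rewrite e eqxx.
have sz p : Z p -> simple_zero (fun z => toC (g z)) p (sgz (\det (jacobian g p))).
  by move=> [Up gp]; apply: C1_simple_zero => //; exact: greg.
have fZ : finite_set Z.
  apply: (finite_isolated closure_compact); last by move=> p [/subset_closure].
  move=> p cp; have [gp|gp] := eqVneq (g p) 0.
    have [e1 [a [k [r [a0 /andP[k0 k1] r0 hr]]]]] := sz p (cZ p cp gp).
    exists r => // z [_ /= gz0] zr; apply/eqP; rewrite -subr_eq0 -toC_eq0; apply/contraT => zp.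
    have := hr z zr; rewrite gz0 (_ : toC 0 = 0); last by apply/eqP; rewrite toC_eq0.
    rewrite sub0r nrmN nrmM nrm_tw // ler_pM2r ?nrm_gt0 //.
    by rewrite leNgt -[X in _ < X]mul1r ltr_pM2r ?nrm_gt0 // k1.
  have ng : 0 < `|g p| by rewrite normr_gt0.
  have : \forall z \near p, 0 < `|g z| by exact: (cvgr_gt _ (cvg_norm (gc p)) 0 ng).
  move=> /nbhs_ballP[r /= r0 hr]; exists r => // z [_ /= gz0] zr.
  by have := hr z; rewrite -ball_normE /= distrC gz0 normr0 ltxx => /(_ zr).
pose s := [seq (p, sgz (\det (jacobian g p))) | p <- finmap.enum_fset (fset_set Z)].
have fs : map fst s = finmap.enum_fset (fset_set Z) by rewrite -map_comp map_id.
have ws := zeros_sum T0 xc xT xinj Uopen Ubd Ucl Uoff Ux Uq sig1 ind (s := s)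
  (g := fun z => toC (g z)).
have gC : ccont (fun z => toC (g z)) by move=> z; exact: (cca_comp (gc z) (@toC_cont R _)).
have memZ p : p \in finmap.enum_fset (fset_set Z) -> Z p by rewrite in_fset_set // inE.
have {ws} := ws gC.
rewrite fs => ws; have {ws} ws := ws (finmap.fset_uniq _).
have {}ws : wn T (fun t => toC (g (x t))) (sig * \sum_(pe <- s) pe.2).
  apply: ws.
    by move=> pe /mapP[p /memZ Zp ->] /=; split; [case: Zp|exact: sz].
  move=> z cz /eqP; rewrite toC_eq0 => /eqP /(cZ z cz) Zz.
  by rewrite in_fset_set // inE.
have e := wn_uniq (ltW T0) wg ws.
rewrite /sign_sum -/Z fsbig_finite // e big_map /= mulrA.
by case: sig1 => ->; rewrite ?mulrNN !mul1r.
Qed.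
End Degree.

(** * Functions with a quadratic Taylor remainder *)

Section Taylor.
Variable R : realType.
Local Notation P := 'rV[R]_2.

Lemma planeBE (a b : P) i : (a - b) 0 i = a 0 i - b 0 i.
Proof. by rewrite !mxE. Qed.

Lemma continuous_mulmxr (J : 'M[R]_2) : continuous (mulmxr J : P -> P).
Proof.
move=> z; rewrite (_ : (mulmxr J : P -> P) = (fun u : P =>
   pt (u 0 0 * J 0 0 + u 0 1 * J 1 0) (u 0 0 * J 0 1 + u 0 1 * J 1 1))).
  have c i : {for z, continuous (fun u : P => u 0 i)} by exact: coord_continuous.
  have k i j : {for z, continuous (fun u : P => u 0 i * J i j)}.
    exact: (cvgM (c i) (cvg_cst (J i j))).
  exact: (pt_cont (cvgD (k 0 0) (k 1 0)) (cvgD (k 0 1) (k 1 1))).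
by apply/funext => u; apply: plane_eq; rewrite /= mulmx2E ?pt0 ?pt1.
Qed.

Lemma diff_of_expansion (g : P -> P) p (J : 'M[R]_2) :
  (forall e, 0 < e -> exists2 r, 0 < r & forall z, `|z - p| < r ->
    `|g z - g p - (z - p) *m J| <= e * `|z - p|) ->
  differentiable g p /\ jacobian g p = J.
Proof.
move=> h; have cJ := @continuous_mulmxr J.
have H e : 0 < e -> \forall z \near (0 : P), `|g (z + p) - (g p + z *m J)| <= e * `|z|.
  move=> /h[r r0 hr]; apply/nbhs_ballP; exists r => // z.
  rewrite -ball_normE /= sub0r normrN => zr.
  by have := hr (z + p); rewrite addrK opprD addrA => /(_ zr).
have dE : 'd g p = mulmxr J :> (P -> P).
  by apply: diff_unique => //; apply/eqaddoP => e e0; exact: H.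
have dg : differentiable g p.
  by apply/diff_locallyP; rewrite dE; split=> //; apply/eqaddoP => e e0; exact: H.
split=> //; apply/row_matrixP => i; rewrite !rowE /jacobian mul_rV_lin1.
by rewrite dE.
Qed.

(* The remainder bound is uniform on bounded sets. *)
Definition taylor (f : P -> R) (fx fy : P -> R) :=
  [/\ continuous f, continuous fx, continuous fy & forall M, 0 <= M -> exists2 K, 0 <= K &
    forall z w, `|z| <= M -> `|w| <= M ->
    `|f w - f z - (fx z * (w 0 0 - z 0 0) + fy z * (w 0 1 - z 0 1))| <= K * `|w - z| ^+ 2].

(** A quantitative substitute for C^2: it contains affine functions and is stable under sums and
    products, hence covers polynomials, and its remainder bound is what the count of critical values
    uses. *)
Definition smooth (f : P -> R) := exists fx fy, taylor f fx fy.

Lemma smooth_affine a b c : smooth (fun z => a + b * z 0 0 + c * z 0 1).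
Proof.
exists (cst b), (cst c); split=> [z|z|z|M M0]; [|exact: cst_continuous|exact: cst_continuous|].
  have k i : {for z, continuous (fun u : P => u 0 i)} by exact: coord_continuous.
  exact: (cvgD (cvgD (cvg_cst a) (cvgM (cvg_cst b) (k 0))) (cvgM (cvg_cst c) (k 1))).
exists 0 => // z w _ _; rewrite mul0r normr_le0; apply/eqP => /=; ring.
Qed.

Lemma smoothD f g : smooth f -> smooth g -> smooth (fun z => f z + g z).
Proof.
move=> [fx [fy [fc fxc fyc fK]]] [gx [gy [gc gxc gyc gK]]].
exists (fun z => fx z + gx z), (fun z => fy z + gy z); split.
- by move=> z; exact: (cvgD (fc z) (gc z)).
- by move=> z; exact: (cvgD (fxc z) (gxc z)).
- by move=> z; exact: (cvgD (fyc z) (gyc z)).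
move=> M M0; have [K K0 hK] := fK M M0; have [L L0 hL] := gK M M0.
exists (K + L); first exact: addr_ge0.
move=> z w zM wM; have := hK z w zM wM; have := hL z w zM wM => h1 h2.
have -> : f w + g w - (f z + g z) - ((fx z + gx z) * (w 0 0 - z 0 0) +
    (fy z + gy z) * (w 0 1 - z 0 1)) =
  (f w - f z - (fx z * (w 0 0 - z 0 0) + fy z * (w 0 1 - z 0 1))) +
  (g w - g z - (gx z * (w 0 0 - z 0 0) + gy z * (w 0 1 - z 0 1))) by ring.
by apply: le_trans (ler_normD _ _) _; rewrite mulrDl lerD.
Qed.

(** The remainder of a product is f (z) rg + g (z) rf + (f w - f z) (g w - g z). The last term is
    quadratic since f and g are Lipschitz on the square, with constants A and B obtained from |w -
    z| <= 2 M. *)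
Lemma smoothM f g : smooth f -> smooth g -> smooth (fun z => f z * g z).
Proof.
move=> [fx [fy [fc fxc fyc fK]]] [gx [gy [gc gxc gyc gK]]].
exists (fun z => fx z * g z + f z * gx z), (fun z => fy z * g z + f z * gy z); split.
- by move=> z; exact: (cvgM (fc z) (gc z)).
- by move=> z; exact: (cvgD (cvgM (fxc z) (gc z)) (cvgM (fc z) (gxc z))).
- by move=> z; exact: (cvgD (cvgM (fyc z) (gc z)) (cvgM (fc z) (gyc z))).
move=> M M0; have [K K0 hK] := fK M M0; have [L L0 hL] := gK M M0.
have cM := @compact_square R M.
have [b1 b10 h1] := compact_bound cM fc; have [b2 b20 h2] := compact_bound cM gc.
have [b3 b30 h3] := compact_bound cM fxc; have [b4 b40 h4] := compact_bound cM fyc.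
have [b5 b50 h5] := compact_bound cM gxc; have [b6 b60 h6] := compact_bound cM gyc.
pose A := b3 + b4 + K * (2 * M); pose B := b5 + b6 + L * (2 * M).
have MM : 0 <= 2 * M by rewrite mulr_ge0.
have A0 : 0 <= A by rewrite !addr_ge0 // mulr_ge0.
have B0 : 0 <= B by rewrite !addr_ge0 // mulr_ge0.
exists (b1 * L + b2 * K + A * B); first by rewrite !addr_ge0 ?mulr_ge0.
move=> z w zM wM.
set d0 := w 0 0 - z 0 0; set d1 := w 0 1 - z 0 1; set D := `|w - z|.
have D0 : 0 <= D by exact: normr_ge0.
have [d0D d1D] : `|d0| <= D /\ `|d1| <= D.
  by have /plane_normP := lexx D; rewrite !mxE.
have DM : D <= 2 * M.
  by apply: le_trans (ler_normB _ _) _; lra.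
set rf := f w - f z - (fx z * d0 + fy z * d1).
set rg := g w - g z - (gx z * d0 + gy z * d1).
have rfK : `|rf| <= K * D ^+ 2 by exact: hK.
have rgL : `|rg| <= L * D ^+ 2 by exact: hL.
have lin (a b c1 c2 : R) : `|a| <= c1 -> `|b| <= c2 -> `|a * d0 + b * d1| <= (c1 + c2) * D.
  move=> a1 b'; apply: le_trans (ler_normD _ _) _; rewrite !normrM mulrDl.
  by apply: lerD; apply: ler_pM.
have df : `|f w - f z| <= A * D.
  have -> : f w - f z = (fx z * d0 + fy z * d1) + rf by rewrite /rf; ring.
  apply: le_trans (ler_normD _ _) _; rewrite /A [X in _ <= X]mulrDl; apply: lerD.
    by apply: lin; [exact: h3|exact: h4].
  apply: le_trans rfK _; have -> : K * D ^+ 2 = K * D * D by rewrite expr2 mulrA.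
  apply: ler_wpM2r => //.
  by apply: ler_wpM2l.
have dg : `|g w - g z| <= B * D.
  have -> : g w - g z = (gx z * d0 + gy z * d1) + rg by rewrite /rg; ring.
  apply: le_trans (ler_normD _ _) _; rewrite /B [X in _ <= X]mulrDl; apply: lerD.
    by apply: lin; [exact: h5|exact: h6].
  apply: le_trans rgL _; have -> : L * D ^+ 2 = L * D * D by rewrite expr2 mulrA.
  apply: ler_wpM2r => //.
  by apply: ler_wpM2l.
have -> : f w * g w - f z * g z - ((fx z * g z + f z * gx z) * d0 + (fy z * g z + f z * gy z) * d1)
   = f z * rg + g z * rf + (f w - f z) * (g w - g z) by rewrite /rf /rg; ring.
have e1 : `|f z * rg| <= b1 * L * D ^+ 2.
  by rewrite normrM -mulrA; apply: ler_pM => //; exact: h1.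
have e2 : `|g z * rf| <= b2 * K * D ^+ 2.
  by rewrite normrM -mulrA; apply: ler_pM => //; exact: h2.
have e3 : `|(f w - f z) * (g w - g z)| <= A * B * D ^+ 2.
  by rewrite normrM expr2 mulrACA; apply: ler_pM.
apply: le_trans (ler_normD _ _) _; rewrite [leRHS]mulrDl; apply: lerD => //.
by apply: le_trans (ler_normD _ _) _; rewrite [leRHS]mulrDl; apply: lerD.
Qed.

Lemma smooth_ext f g : f =1 g -> smooth f -> smooth g.
Proof. by move=> /funext ->. Qed.

Lemma smooth_cst a : smooth (fun _ => a).
Proof. by apply: smooth_ext (smooth_affine a 0 0) => z; rewrite !mul0r !addr0. Qed.

(** Rows are indexed by the variables and columns by the components, as [jacobian] acts on row
    vectors from the right. *)
Definition jac2 (fx fy gx gy : P -> R) (z : P) : 'M[R]_2 :=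
  \matrix_(i < 2, j < 2) if i == 0 then (if j == 0 then fx z else gx z)
                         else (if j == 0 then fy z else gy z).

Lemma mx2_norm_le (A : 'M[R]_2) e : `|A 0 0| <= e -> `|A 0 1| <= e -> `|A 1 0| <= e ->
  `|A 1 1| <= e -> `|A| <= e.
Proof.
move=> h00 h01 h10 h11; rewrite /Num.norm /= mx_normrE; apply/bigmax_leP; split.
  exact: le_trans h00.
have I2 (k : 'I_2) : k = 0 \/ k = 1.
  by case: k => [[|[|]]] // ?; [left|right]; apply/val_inj.
by case=> i j _ /=; case: (I2 i) => ->; case: (I2 j) => ->.
Qed.

Lemma taylor_jacobian f fx fy g gx gy : taylor f fx fy -> taylor g gx gy ->
  (forall p, differentiable (fun z => pt (f z) (g z)) p) /\
  jacobian (fun z => pt (f z) (g z)) = jac2 fx fy gx gy.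
Proof.
move=> [fc fxc fyc fK] [gc gxc gyc gK].
have key p : differentiable (fun z => pt (f z) (g z)) p /\
   jacobian (fun z => pt (f z) (g z)) p = jac2 fx fy gx gy p.
  apply: diff_of_expansion => e e0.
  have M0 : 0 <= `|p| + 1 by rewrite addr_ge0.
  have [K K0 hK] := fK _ M0; have [L L0 hL] := gK _ M0.
  have KL : 0 < K + L + 1 by rewrite ltr_wpDl // addr_ge0.
  exists (Num.min 1 (e / (K + L + 1))); first by rewrite lt_min ltr01 divr_gt0.
  move=> z; rewrite lt_min => /andP[z1 ze].
  have pM : `|p| <= `|p| + 1 by rewrite lerDl.
  have zM : `|z| <= `|p| + 1.
    by rewrite -[z](subrK p) addrC; apply: le_trans (ler_normD _ _) _; rewrite lerD2l ltW.
  rewrite ltr_pdivlMr // in ze.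
  have sq k : 0 <= k -> k <= K + L + 1 -> k * `|z - p| ^+ 2 <= e * `|z - p|.
    move=> k0 kKL; rewrite expr2 mulrA; apply: ler_wpM2r => //.
    apply: le_trans (ltW ze); rewrite mulrC; exact: ler_wpM2l.
  apply/plane_normP; split.
    have -> : (pt (f z) (g z) - pt (f p) (g p) - (z - p) *m jac2 fx fy gx gy p) 0 0 =
       f z - f p - (fx p * (z 0 0 - p 0 0) + fy p * (z 0 1 - p 0 1)).
      by rewrite !planeBE mulmx2E !mxE /=; ring.
    by apply: le_trans (hK p z pM zM) _; apply: sq => //; lra.
  have -> : (pt (f z) (g z) - pt (f p) (g p) - (z - p) *m jac2 fx fy gx gy p) 0 1 =
       g z - g p - (gx p * (z 0 0 - p 0 0) + gy p * (z 0 1 - p 0 1)).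
    by rewrite !planeBE mulmx2E !mxE /=; ring.
  by apply: le_trans (hL p z pM zM) _; apply: sq => //; lra.
by split=> [p|]; [case: (key p)|apply/funext => p; case: (key p)].
Qed.

Lemma taylor_C1 f fx fy g gx gy : taylor f fx fy -> taylor g gx gy ->
  C1_field (fun z => pt (f z) (g z)).
Proof.
move=> tf tg; have [df je] := taylor_jacobian tf tg; split=> //; rewrite je.
case: tf tg => _ c1 c2 _ [_ c3 c4 _] p; apply/(@cvgrPdist_le _ _ _ (nbhs p)) => /= e e0.
have /cvgrPdist_le/(_ e e0) n1 := c1 p; have /cvgrPdist_le/(_ e e0) n2 := c2 p.
have /cvgrPdist_le/(_ e e0) n3 := c3 p; have /cvgrPdist_le/(_ e e0) n4 := c4 p.
apply: filterS (filterI (filterI n1 n2) (filterI n3 n4)) => z [[h1 h2] [h3 h4]].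
by apply: mx2_norm_le; rewrite !mxE.
Qed.
End Taylor.

(** * Bernstein approximation *)

Section Bernstein.
Variable R : realType.
Local Notation P := 'rV[R]_2.

(* The expectation of phi under the binomial law (n, x). *)
Fixpoint ber (n : nat) (x : R) (phi : nat -> R) : R :=
  if n is n'.+1 then (1 - x) * ber n' x phi + x * ber n' x (fun i => phi i.+1)
  else phi 0%N.

Lemma ber_affine n x a b phi : ber n x (fun i => a + b * phi i) = a + b * ber n x phi.
Proof.
elim: n phi => [//|n IH] phi /=.
by rewrite IH (IH (fun i => phi i.+1)); ring.
Qed.

Lemma ber_le n x phi chi : 0 <= x <= 1 -> (forall i, (i <= n)%N -> phi i <= chi i) ->
  ber n x phi <= ber n x chi.
Proof.
move=> /andP[x0 x1]; elim: n phi chi => [|n IH] phi chi h /=; first exact: h.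
apply: lerD; apply: ler_wpM2l; rewrite ?subr_ge0 //; apply: IH => i ni; apply: h => //.
exact: leqW.
Qed.

(** Second moment of the binomial law about - c. The shift is carried along because the recursion
    turns c into c + 1. *)
Lemma ber_sqr n x c : ber n x (fun i => (i%:R + c) ^+ 2) = n%:R * x * (1 - x) + (n%:R * x + c) ^+ 2.
Proof.
elim: n c => [|n IH] c /=; first by rewrite !mul0r !add0r.
have -> : (fun i => (i.+1%:R + c) ^+ 2) = (fun i : nat => (i%:R + (c + 1)) ^+ 2).
  by apply/funext => i; rewrite -natr1; ring.
by rewrite !IH -natr1; ring.
Qed.

Lemma ber_variance n x : (0 < n)%N -> 0 <= x <= 1 ->
  ber n x (fun i => (i%:R / n%:R - x) ^+ 2) <= n%:R^-1.
Proof.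
move=> n0 /andP[x0 x1]; have nR : (0 : R) < n%:R by rewrite ltr0n.
have -> : (fun i : nat => (i%:R / n%:R - x) ^+ 2) =
   (fun i : nat => 0 + n%:R ^- 2 * (i%:R + - (n%:R * x)) ^+ 2).
  by apply/funext => i; field; rewrite pnatr_eq0 -lt0n.
rewrite ber_affine ber_sqr subrr expr0n /= addr0 add0r.
have -> : n%:R ^- 2 * (n%:R * x * (1 - x)) = n%:R^-1 * (x * (1 - x)).
  by field; rewrite pnatr_eq0 -lt0n.
rewrite ger_pMr ?invr_gt0 //.
by have := mulr_ge0 x0 x0; lra.
Qed.

(** The values [phi i] may depend on z, so that the lemma applies twice: Bernstein sums in one
    coordinate are the coefficients of those in the other. *)
Lemma smooth_ber n (X : P -> R) (phi : nat -> P -> R) : smooth X ->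
  (forall i, smooth (phi i)) -> smooth (fun z => ber n (X z) (fun i => phi i z)).
Proof.
move=> sX; elim: n phi => [|n IH] phi sphi /=; first exact: sphi.
apply: smoothD; apply: smoothM => //; last by apply: (IH (fun i => phi i.+1)).
  apply: (@smooth_ext _ (fun z => 1 + (-1) * X z)).
    by move=> z; ring.
  by apply: smoothD; [exact: smooth_cst|apply: smoothM => //; exact: smooth_cst].
exact: IH.
Qed.

(** Nearby points are handled by uniform continuity; for |w - p| >= d the crude bound 2 B is at most
    2 B / d^2 times the squared distance. The bound is quadratic so that its binomial mean is a
    variance. *)
Lemma quadratic_modulus (F : P -> R) M e : continuous F -> 0 < e ->
  exists2 C, 0 <= C & forall p w, `|p| <= M -> `|w| <= M ->
   `|F w - F p| <= e + C * ((w 0 0 - p 0 0) ^+ 2 + (w 0 1 - p 0 1) ^+ 2).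
Proof.
move=> Fc e0.
have cM := @compact_square R M.
have nr (p : P) : \forall u \near (p, (0 : P)), `|F (u.1 + u.2) - F u.1| < e.
  have c1 : {for (p, (0 : P)), continuous (fun u : P * P => F (u.1 + u.2))}.
    by apply: (continuous_comp (f := fun u : P * P => u.1 + u.2)) (@Fc _); exact: (cvgD cvg_fst cvg_snd).
  have c2 : {for (p, (0 : P)), continuous (fun u : P * P => F u.1)}.
    exact: (continuous_comp (f := fun u : P * P => u.1) cvg_fst (@Fc _)).
  have c3 : {for (p, (0 : P)), continuous (fun u : P * P => `|F (u.1 + u.2) - F u.1|)}.
    exact: (cvg_norm (cvgB c1 c2)).
  by have /cvgr_lt := c3; apply; rewrite /= addr0 subrr normr0.
have /compact_near_coveringP /(_ P (nbhs (0 : P)) (fun d p => `|F (p + d) - F p| < e) _) := cM.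
move=> /(_ (fun p _ => nr p)) /nbhs_ballP[d /= d0 hd'].
have hd (u p : P) : `|u| < d -> `|p| <= M -> `|F (p + u) - F p| < e.
  by move=> ud pM; apply: (hd' u) => //; rewrite -ball_normE /= sub0r normrN.
have [B B0 hB] := compact_bound cM Fc.
have C0 : 0 <= 2 * B / d ^+ 2 by apply: divr_ge0; [exact: mulr_ge0|exact: sqr_ge0].
exists (2 * B / d ^+ 2) => //.
move=> p w pM wM; set S := _ + _ ^+ 2.
have S0 : 0 <= S by rewrite addr_ge0 ?sqr_ge0.
have [wd|wd] := ltP `|w - p| d.
  have := hd (w - p) p wd pM; rewrite [p + _]addrC subrK => /ltW h; apply: le_trans h _.
  by rewrite lerDl mulr_ge0.
have dS : d ^+ 2 <= S.
  have wp : `|w - p| ^+ 2 <= S.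
    have sq (y : R) : y ^+ 2 <= S -> `|y| <= Num.sqrt S.
      by move=> h; rewrite -sqrtr_sqr ler_wsqrtr.
    rewrite -(sqr_sqrtr S0) ler_sqr ?nnegrE ?sqrtr_ge0 //; apply/plane_normP.
    by rewrite !mxE; split; apply: sq; rewrite /S ?lerDl ?lerDr sqr_ge0.
  by apply: le_trans wp; rewrite ler_sqr ?nnegrE // ltW.
have d2 : 0 < d ^+ 2 by rewrite exprn_gt0.
apply: (@le_trans _ _ (2 * B)).
  by apply: le_trans (ler_normB _ _) _; have := hB p pM; have := hB w wM; lra.
apply: (@le_trans _ _ (2 * B / d ^+ 2 * S)); last by rewrite lerDr ltW.
by rewrite mulrAC ler_pdivlMr // ler_wpM2l // mulr_ge0.
Qed.

(** The binomial means of [quadratic_modulus] bound the error by e / 2 + 2 C / n, and n > 4 C /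
    e. *)
Lemma smooth_approx_unit (F : P -> R) e : continuous F -> 0 < e ->
  exists n : nat, forall x y, 0 <= x <= 1 -> 0 <= y <= 1 ->
   `|ber n x (fun i => ber n y (fun j => F (pt (i%:R / n%:R) (j%:R / n%:R)))) - F (pt x y)| <= e.
Proof.
move=> Fc e0; have e2 : 0 < e / 2 by rewrite divr_gt0.
have [C C0 hC] := quadratic_modulus 1 Fc e2.
pose n := (Num.trunc (4 * C / e)).+1.
have n0 : (0 < n)%N by [].
have nR : (0 : R) < n%:R by rewrite ltr0n.
have nC : C * (n%:R^-1 + n%:R^-1) <= e / 2.
  have : 4 * C / e < n%:R by exact: truncnS_gt.
  rewrite ltr_pdivrMr // => h.
  have -> : C * (n%:R^-1 + n%:R^-1) = 2 * C / n%:R by ring.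
  by rewrite ler_pdivrMr //; lra.
exists n => x y x01 y01.
set q := F (pt x y).
have unit z : 0 <= z <= 1 -> `|z| <= 1 by move=> /andP[a b]; rewrite ger0_norm.
have node i : (i <= n)%N -> 0 <= (i%:R / n%:R : R) <= 1.
  by move=> ni; rewrite divr_ge0 //= ler_pdivrMr // mul1r ler_nat.
pose Q i j := (i%:R / n%:R - x) ^+ 2 + (j%:R / n%:R - y) ^+ 2.
have hQ i j : (i <= n)%N -> (j <= n)%N ->
    `|F (pt (i%:R / n%:R) (j%:R / n%:R)) - q| <= e / 2 + C * Q i j.
  move=> ni nj; have := hC (pt x y) (pt (i%:R / n%:R) (j%:R / n%:R)).
  by rewrite !pt0 !pt1; apply; rewrite norm_pt ge_max !unit // ?node.
have EQ : ber n x (fun i => ber n y (fun j => Q i j)) <= n%:R^-1 + n%:R^-1.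
  have -> : (fun i => ber n y (fun j => Q i j)) = (fun i : nat =>
     ber n y (fun j => (j%:R / n%:R - y) ^+ 2) + 1 * (i%:R / n%:R - x) ^+ 2).
    apply/funext => i; rewrite mul1r [RHS]addrC.
    rewrite -[X in _ = _ + X]mul1r -ber_affine.
    by congr ber; apply/funext => j; rewrite mul1r.
  by rewrite ber_affine mul1r; apply: lerD; exact: ber_variance.
have two (a b : R) : ber n x (fun i => ber n y (fun j => a + b * Q i j)) =
    a + b * ber n x (fun i => ber n y (fun j => Q i j)).
  rewrite -ber_affine; congr ber; apply/funext => i; exact: ber_affine.
set E := ber _ _ _.
have up : E <= (q + e / 2) + C * (n%:R^-1 + n%:R^-1).
  apply: (@le_trans _ _ ((q + e / 2) + C * ber n x (fun i => ber n y (fun j => Q i j)))).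
    rewrite -two; apply: ber_le => // i ni; apply: ber_le => // j nj.
    by have := hQ i j ni nj; rewrite ler_norml => /andP[_]; lra.
  by rewrite lerD2l ler_wpM2l.
have lo : (q - e / 2) + (- C) * (n%:R^-1 + n%:R^-1) <= E.
  apply: (@le_trans _ _ ((q - e / 2) + (- C) * ber n x (fun i => ber n y (fun j => Q i j)))).
    by rewrite lerD2l !mulNr lerN2 ler_wpM2l.
  rewrite -two; apply: ber_le => // i ni; apply: ber_le => // j nj.
  by have := hQ i j ni nj; rewrite ler_norml => /andP[+ _]; lra.
by rewrite ler_norml; apply/andP; split; lra.
Qed.

Lemma smooth_approx (F : P -> R) M e : continuous F -> 0 < M -> 0 < e ->
  exists2 f, smooth f & forall z, `|z| <= M -> `|f z - F z| <= e.
Proof.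
move=> Fc M0 e0.
pose L (u : P) : P := pt (2 * M * u 0 0 - M) (2 * M * u 0 1 - M).
have Lc : continuous L.
  move=> u; have k i : {for u, continuous (fun u : P => u 0 i)} by exact: coord_continuous.
  have kk i : {for u, continuous (fun u : P => 2 * M * u 0 i - M)}.
    exact: (cvgB (cvgM (cvg_cst (2 * M)) (k i)) (cvg_cst M)).
  exact: (pt_cont (kk 0) (kk 1)).
have FLc : continuous (fun u => F (L u)).
  by move=> u; exact: (continuous_comp (Lc u) (Fc _)).
have [n hn] := smooth_approx_unit FLc e0.
pose X i (z : P) := (z 0 i / M + 1) / 2.
have sX : smooth (X 0).
  apply: smooth_ext (smooth_affine (2^-1) (M^-1 / 2) 0) => z.
  by rewrite /X; field; rewrite gt_eqF.
have sY : smooth (X 1).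
  apply: smooth_ext (smooth_affine (2^-1) 0 (M^-1 / 2)) => z.
  by rewrite /X; field; rewrite gt_eqF.
exists (fun z => ber n (X 0 z) (fun i => ber n (X 1 z) (fun j =>
   F (L (pt (i%:R / n%:R) (j%:R / n%:R)))))).
  apply: smooth_ber => // i; apply: (@smooth_ber n (X 1) (fun j _ => F (L (pt (i%:R / n%:R) (j%:R / n%:R))))) => // j.
  exact: smooth_cst.
move=> z /plane_normP[z0 z1].
have X01 i : `|z 0 i| <= M -> 0 <= X i z <= 1.
  rewrite ler_norml => /andP[a b].
  have a' : -1 <= z 0 i / M by rewrite ler_pdivlMr // mulN1r.
  have b' : z 0 i / M <= 1 by rewrite ler_pdivrMr // mul1r.
  by rewrite /X; apply/andP; split; lra.
have := hn (X 0 z) (X 1 z) (X01 _ z0) (X01 _ z1).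
have -> : L (pt (X 0 z) (X 1 z)) = z.
  by apply: plane_eq; rewrite /L ?pt0 ?pt1 /X; field; rewrite gt_eqF.
by [].
Qed.
End Bernstein.

(** * Regular values *)

Section Sard.
Variable R : realType.
Local Notation P := 'rV[R]_2.

Lemma count_interval n (s A r : R) : 0 < s -> 0 <= r ->
  #|[set a : 'I_n | `|a%:R * s - A| <= r]%SET|%:R <= 2 * r / s + 1.
Proof.
move=> s0 r0; set S := [set a | _]%SET.
have rs : 0 <= 2 * r / s by rewrite divr_ge0 ?mulr_ge0 // ltW.
have [->|[a0 a0S]] := set_0Vmem S; first by rewrite cards0 addr_ge0.
pose m := [arg min_(a < a0 in S) (a : nat)].
have [mS mmin] : m \in S /\ forall a, a \in S -> (m <= a)%N.
  by rewrite /m; case: arg_minnP => // i iS h; split.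
pose k := Num.trunc (2 * r / s).
have mk a : a \in S -> (a - m <= k)%N.
  move=> aS; rewrite /k truncn_ge_nat // ler_pdivlMr // natrB ?mmin //.
  by move: aS mS; rewrite !inE !ler_norml => /andP[_ h1] /andP[h2 _]; lra.
pose f (a : 'I_n) : 'I_k.+1 := inord (a - m).
have finj : {in S &, injective f}.
  move=> a b aS bS /(congr1 val); rewrite /f /= !inordK ?ltnS ?mk // => e.
  by apply: val_inj; rewrite /= -(subnK (mmin a aS)) e subnK // mmin.
rewrite -(card_in_imset finj).
apply: (@le_trans _ _ k.+1%:R).
  by rewrite ler_nat -[X in (_ <= X)%N]card_ord max_card.
by rewrite -natr1 lerD2r truncn_le.
Qed.

(** The centre [c] depends on the first index, as a slanted strip requires: each admissible abscissa
    carries at most 2 r2 / s + 1 ordinates. *)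
Lemma count_strip n (s A r1 r2 : R) (c : 'I_n -> R) : 0 < s -> 0 <= r1 -> 0 <= r2 ->
  #|[set ab : 'I_n * 'I_n | (`|ab.1%:R * s - A| <= r1) && (`|ab.2%:R * s - c ab.1| <= r2)]%SET|%:R
   <= (2 * r1 / s + 1) * (2 * r2 / s + 1).
Proof.
move=> s0 r10 r20.
rewrite -sum1_card (eq_bigl (fun ab : 'I_n * 'I_n => (`|ab.1%:R * s - A| <= r1) &&
   (`|ab.2%:R * s - c ab.1| <= r2))); last by move=> ab; rewrite inE.
rewrite -(pair_big_dep (fun a : 'I_n => `|a%:R * s - A| <= r1)
   (fun a b : 'I_n => `|b%:R * s - c a| <= r2) (fun _ _ => 1%N)) /= natr_sum.
apply: (@le_trans _ _ (\sum_(a < n | `|a%:R * s - A| <= r1) (2 * r2 / s + 1))).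
  apply: ler_sum => a _; rewrite sum1_card -[X in X%:R <= _]cardsE.
  exact: count_interval.
rewrite sumr_const -[leLHS]mulr_natl; apply: ler_wpM2r.
  by rewrite addr_ge0 // divr_ge0 ?mulr_ge0 // ltW.
by rewrite -cardsE; exact: count_interval.
Qed.

Lemma count_strip_swap n (s A r1 r2 : R) (c : 'I_n -> R) : 0 < s -> 0 <= r1 -> 0 <= r2 ->
  #|[set ab : 'I_n * 'I_n | (`|ab.2%:R * s - A| <= r1) && (`|ab.1%:R * s - c ab.2| <= r2)]%SET|%:R
   <= (2 * r1 / s + 1) * (2 * r2 / s + 1).
Proof.
move=> s0 r10 r20; pose sw (ab : 'I_n * 'I_n) := (ab.2, ab.1).
have swi : injective sw by move=> [a b] [a' b'] [-> ->].
rewrite -(card_imset _ swi).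
apply: le_trans (count_strip A c s0 r10 r20); rewrite ler_nat; apply: subset_leq_card.
by apply/fintype.subsetP => _ /imsetP[ab abS ->]; rewrite !inE in abS *.
Qed.

Lemma card_le_sum (I J : finType) (S : J -> {set I}) :
  (forall i, exists j, i \in S j) -> (#|I| <= \sum_(j : J) #|S j|)%N.
Proof.
move=> h; apply: (@leq_trans #|(\bigcup_(j : J) S j)%SET|).
  by rewrite -cardsT; apply: subset_leq_card; apply/fintype.subsetP => i _; have [j ij] := h i; apply/bigcupP; exists j.
elim/big_ind2: _ => [|a A b B hA hB|//]; first by rewrite cards0.
by apply: leq_trans (leq_card_setU _ _) _; exact: leq_add.
Qed.

(** A singular matrix has a nonzero annihilating covector, here scaled to have a coordinate 1 and
    the other at most 1 in absolute value, so that the strip transverse to it is a graph over a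
    coordinate axis. *)
Lemma kernel_covector (a b c d : R) : a * d - b * c = 0 ->
  exists l0 l1, [/\ l0 * a + l1 * b = 0, l0 * c + l1 * d = 0 &
    (l1 = 1 /\ `|l0| <= 1) \/ (l0 = 1 /\ `|l1| <= 1)].
Proof.
move=> e.
have norm p r : (p != 0) || (r != 0) -> p * a + r * b = 0 -> p * c + r * d = 0 ->
  exists l0 l1, [/\ l0 * a + l1 * b = 0, l0 * c + l1 * d = 0 &
    (l1 = 1 /\ `|l0| <= 1) \/ (l0 = 1 /\ `|l1| <= 1)].
  move=> pr e1 e2; have [pler|rltp] := leP `|p| `|r|.
    have r0 : r != 0.
      by apply: contraTneq pr => r0; rewrite r0 normr0 normr_le0 in pler; rewrite pler r0 eqxx.
    exists (p / r), 1; split.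
    - have -> : p / r * a + 1 * b = (p * a + r * b) / r by field.
      by rewrite e1 mul0r.
    - have -> : p / r * c + 1 * d = (p * c + r * d) / r by field.
      by rewrite e2 mul0r.
    by left; split=> //; rewrite normf_div ler_pdivrMr ?mul1r // normr_gt0.
  have p0 : p != 0 by rewrite -normr_gt0; exact: le_lt_trans rltp.
  exists 1, (r / p); split.
  - have -> : 1 * a + r / p * b = (p * a + r * b) / p by field.
    by rewrite e1 mul0r.
  - have -> : 1 * c + r / p * d = (p * c + r * d) / p by field.
    by rewrite e2 mul0r.
  by right; split=> //; rewrite normf_div ler_pdivrMr ?normr_gt0 // mul1r ltW.
have [n1|] := boolP ((b != 0) || (- a != 0)); first by apply: (norm b (- a)) => //; lra.
have [n2|] := boolP ((d != 0) || (- c != 0)); first by move=> _; apply: (norm d (- c)) => //; lra.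
rewrite !negb_or !negbK !oppr_eq0 => /andP[/eqP d0 /eqP c0] /andP[/eqP b0 /eqP a0].
exists 0, 1; rewrite a0 b0 c0 d0; split; rewrite ?mulr0 ?addr0 //.
by left; rewrite normr0 ler01.
Qed.

Variables (f fx fy g gx gy : P -> R) (M : R).
Hypotheses (M0 : 0 < M) (tf : taylor f fx fy) (tg : taylor g gx gy).

Definition critical z := \det (jac2 fx fy gx gy z) = 0.

Lemma taylor_constants : exists K L, [/\ 0 <= K, 0 <= L &
  forall z w, `|z| <= M -> `|w| <= M ->
  [/\ `|f w - f z - (fx z * (w 0 0 - z 0 0) + fy z * (w 0 1 - z 0 1))| <= K * `|w - z| ^+ 2,
      `|g w - g z - (gx z * (w 0 0 - z 0 0) + gy z * (w 0 1 - z 0 1))| <= K * `|w - z| ^+ 2,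
      `|f w - f z| <= L * `|w - z| & `|g w - g z| <= L * `|w - z|]].
Proof.
case: tf => fc fxc fyc /(_ M (ltW M0)) [K1 K10 h1].
case: tg => gc gxc gyc /(_ M (ltW M0)) [K2 K20 h2].
have cM := @compact_square R M.
have [b1 b10 hb1] := compact_bound cM fxc; have [b2 b20 hb2] := compact_bound cM fyc.
have [b3 b30 hb3] := compact_bound cM gxc; have [b4 b40 hb4] := compact_bound cM gyc.
have KK1 : 0 <= K1 * (2 * M) by rewrite !mulr_ge0 // ltW.
have KK2 : 0 <= K2 * (2 * M) by rewrite !mulr_ge0 // ltW.
exists (K1 + K2), (b1 + b2 + b3 + b4 + K1 * (2 * M) + K2 * (2 * M)); split; first exact: addr_ge0.
  by rewrite !addr_ge0.
move=> z w zM wM; have r1 := h1 z w zM wM; have r2 := h2 z w zM wM.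
have D0 : 0 <= `|w - z| := normr_ge0 _.
have DM : `|w - z| <= 2 * M by apply: le_trans (ler_normB _ _) _; lra.
have [d0D d1D] : `|w 0 0 - z 0 0| <= `|w - z| /\ `|w 0 1 - z 0 1| <= `|w - z|.
  by have /plane_normP := lexx `|w - z|; rewrite !mxE.
have D2 : 0 <= `|w - z| ^+ 2 := sqr_ge0 _.
have lip (u ux uy : P -> R) (K b b' : R) : 0 <= K -> `|ux z| <= b -> `|uy z| <= b' ->
   `|u w - u z - (ux z * (w 0 0 - z 0 0) + uy z * (w 0 1 - z 0 1))| <= K * `|w - z| ^+ 2 ->
   `|u w - u z| <= (b + b' + K * (2 * M)) * `|w - z|.
  move=> K0 hx hy hu.
  have -> : u w - u z = (u w - u z - (ux z * (w 0 0 - z 0 0) + uy z * (w 0 1 - z 0 1))) +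
     (ux z * (w 0 0 - z 0 0) + uy z * (w 0 1 - z 0 1)) by ring.
  have k1 : `|ux z * (w 0 0 - z 0 0)| <= b * `|w - z| by rewrite normrM; apply: ler_pM.
  have k2 : `|uy z * (w 0 1 - z 0 1)| <= b' * `|w - z| by rewrite normrM; apply: ler_pM.
  have k3 : K * `|w - z| ^+ 2 <= K * (2 * M) * `|w - z|.
    have -> : K * `|w - z| ^+ 2 = K * `|w - z| * `|w - z| by rewrite expr2 mulrA.
    by apply: ler_wpM2r => //; apply: ler_wpM2l.
  have := ler_normD (u w - u z - (ux z * (w 0 0 - z 0 0) + uy z * (w 0 1 - z 0 1)))
    (ux z * (w 0 0 - z 0 0) + uy z * (w 0 1 - z 0 1)).
  have := ler_normD (ux z * (w 0 0 - z 0 0)) (uy z * (w 0 1 - z 0 1)).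
  rewrite 2!mulrDl; lra.
split.
- by apply: le_trans r1 _; apply: ler_wpM2r => //; lra.
- by apply: le_trans r2 _; apply: ler_wpM2r => //; lra.
- apply: le_trans (lip f fx fy K1 b1 b2 K10 (hb1 z zM) (hb2 z zM) r1) _.
  by apply: ler_wpM2r => //; lra.
- apply: le_trans (lip g gx gy K2 b3 b4 K20 (hb3 z zM) (hb4 z zM) r2) _.
  by apply: ler_wpM2r => //; lra.
Qed.

(* On a cell of diameter 2h containing a critical point, the critical values lie
   in a strip of length O(h) and width O(h^2). *)
Lemma critical_cell K L n (s h : R) (c : P) : 0 <= K -> 0 <= L -> 0 < s -> 0 < h ->
  (forall z w, `|z| <= M -> `|w| <= M ->
  [/\ `|f w - f z - (fx z * (w 0 0 - z 0 0) + fy z * (w 0 1 - z 0 1))| <= K * `|w - z| ^+ 2,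
      `|g w - g z - (gx z * (w 0 0 - z 0 0) + gy z * (w 0 1 - z 0 1))| <= K * `|w - z| ^+ 2,
      `|f w - f z| <= L * `|w - z| & `|g w - g z| <= L * `|w - z|]) ->
  exists S : {set 'I_n * 'I_n},
    #|S|%:R <= (2 * (2 * L * h) / s + 1) * (2 * (8 * K * h ^+ 2) / s + 1) /\
    forall a b z, `|z| <= M -> `|z - c| <= h -> critical z ->
      f z = (a : 'I_n)%:R * s -> g z = (b : 'I_n)%:R * s -> (a, b) \in S.
Proof.
move=> K0 L0 s0 h0 hT.
have r10 : 0 <= 2 * L * h by rewrite !mulr_ge0 // ltW.
have r20 : 0 <= 8 * K * h ^+ 2 by rewrite !mulr_ge0 // ltW.
have [[z0 [z0M z0c cz0]]|no] := pselect (exists z0, [/\ `|z0| <= M, `|z0 - c| <= h & critical z0]);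
  last first.
  exists (finset.set0); split.
    have q1 : 0 <= 2 * (2 * L * h) / s by rewrite divr_ge0 ?(ltW s0) // mulr_ge0.
    have q2 : 0 <= 2 * (8 * K * h ^+ 2) / s by rewrite divr_ge0 ?(ltW s0) // mulr_ge0.
    by rewrite cards0 mulr_ge0 // addr_ge0.
  by move=> a b z zM zc cz; exfalso; apply: no; exists z.
have [l0 [l1 [e1 e2 hl]]] : exists l0 l1, [/\ l0 * fx z0 + l1 * gx z0 = 0,
    l0 * fy z0 + l1 * gy z0 = 0 & (l1 = 1 /\ `|l0| <= 1) \/ (l0 = 1 /\ `|l1| <= 1)].
  by apply: kernel_covector; move: cz0; rewrite /critical det2 !mxE /=; lra.
(* Points of the cell are within 2 h of z0. The combination with l0 and l1 has no linear part at z0,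
   so only two remainders K (2 h)^2 are left. *)
have near z : `|z| <= M -> `|z - c| <= h -> [/\ `|f z - f z0| <= 2 * L * h,
    `|g z - g z0| <= 2 * L * h & `|l0 * (f z - f z0) + l1 * (g z - g z0)| <= 8 * K * h ^+ 2].
  move=> zM zc; have D0 : 0 <= `|z - z0| := normr_ge0 _.
  have Dh : `|z - z0| <= 2 * h.
    have -> : z - z0 = (z - c) - (z0 - c) by rewrite opprB addrA subrK.
    by apply: le_trans (ler_normB _ _) _; lra.
  have [t1 t2 t3 t4] := hT z0 z z0M zM.
  have LD : L * `|z - z0| <= 2 * L * h by rewrite [2 * L]mulrC -mulrA; apply: ler_wpM2l.
  have D2 : `|z - z0| ^+ 2 <= 4 * h ^+ 2.
    have -> : 4 * h ^+ 2 = (2 * h) ^+ 2 by ring.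
    by rewrite ler_sqr ?nnegrE // mulr_ge0 // ltW.
  have KD : K * `|z - z0| ^+ 2 <= 4 * K * h ^+ 2.
    by rewrite [4 * K]mulrC -mulrA; apply: ler_wpM2l.
  split; [lra|lra|].
  set rf := f z - _ - _ in t1; set rg := g z - _ - _ in t2.
  have -> : l0 * (f z - f z0) + l1 * (g z - g z0) = l0 * rf + l1 * rg +
     ((l0 * fx z0 + l1 * gx z0) * (z 0 0 - z0 0 0) + (l0 * fy z0 + l1 * gy z0) * (z 0 1 - z0 0 1)).
    by rewrite /rf /rg; ring.
  rewrite e1 e2 !mul0r !addr0.
  have b0 : `|l0| <= 1 by case: hl => [[_ //]|[-> _]]; rewrite normr1.
  have b1 : `|l1| <= 1 by case: hl => [[-> _]|[_ //]]; rewrite normr1.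
  have m0 : `|l0 * rf| <= 4 * K * h ^+ 2.
    by rewrite normrM; apply: le_trans (le_trans t1 KD); rewrite ler_piMl.
  have m1 : `|l1 * rg| <= 4 * K * h ^+ 2.
    by rewrite normrM; apply: le_trans (le_trans t2 KD); rewrite ler_piMl.
  by apply: le_trans (ler_normD _ _) _; lra.
case: hl => -[le lb].
- exists [set ab : 'I_n * 'I_n | (`|ab.1%:R * s - f z0| <= 2 * L * h) &&
    (`|ab.2%:R * s - (g z0 - l0 * (ab.1%:R * s - f z0))| <= 8 * K * h ^+ 2)]%SET.
  split; first exact: (count_strip _ (fun a : 'I_n => g z0 - l0 * (a%:R * s - f z0))).
  move=> a b z zM zc _ fz gz; have [n1 _ n3] := near z zM zc.
  rewrite inE /= -fz -gz n1 /=; apply: le_trans n3; rewrite le mul1r.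
  by rewrite le_eqVlt; apply/orP; left; apply/eqP; congr `|_|; ring.
- exists [set ab : 'I_n * 'I_n | (`|ab.2%:R * s - g z0| <= 2 * L * h) &&
    (`|ab.1%:R * s - (f z0 - l1 * (ab.2%:R * s - g z0))| <= 8 * K * h ^+ 2)]%SET.
  split; first exact: (count_strip_swap _ (fun a : 'I_n => f z0 - l1 * (a%:R * s - g z0))).
  move=> a b z zM zc _ fz gz; have [_ n1 n3] := near z zM zc.
  rewrite inE /= -fz -gz n1 /=; apply: le_trans n3; rewrite le mul1r.
  by rewrite le_eqVlt; apply/orP; left; apply/eqP; congr `|_|; ring.
Qed.

(** The n^2 candidate values form a grid of step s in the square of side d. About N^2 cells of size
    h each spoil O (h / s) times O (h^2 / s) of them, altogether at most C h / s^2, less than n^2 =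
    d^2 / s^2 once C h < d^2. *)
Lemma regular_value d : 0 < d -> exists v0 v1, [/\ 0 <= v0 <= d, 0 <= v1 <= d &
  forall z, `|z| <= M -> f z = v0 -> g z = v1 -> ~ critical z].
Proof.
move=> d0; have [K [L [K0 L0 hT]]] := taylor_constants.
(* From (N + 1)^2 <= 4 N^2 and N h = 2 M: 4 N^2 h^2 = 16 M^2; the other factors come from
   [critical_cell]. *)
pose C := 16 * M ^+ 2 * (4 * L + 1) * (16 * K + 1).
have L1 : 0 < 4 * L + 1 by lra.
have K1 : 0 < 16 * K + 1 by lra.
have C0 : 0 < C by rewrite /C !mulr_gt0 // exprn_gt0.
(* The first term makes h <= 1, the second makes C h < d^2. *)
pose q := 2 * M + 2 * M * C / d ^+ 2.
have d2 : 0 < d ^+ 2 by rewrite exprn_gt0.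
have MCd : 0 < 2 * M * C / d ^+ 2 by rewrite divr_gt0 // !mulr_gt0.
pose N := (Num.trunc q).+1.
have NR : (0 : R) < N%:R by rewrite ltr0n.
have qN : q < N%:R by exact: truncnS_gt.
pose h := 2 * M / N%:R.
have h0 : 0 < h by rewrite divr_gt0 // mulr_gt0.
have h1 : h <= 1 by rewrite ler_pdivrMr // mul1r; move: qN; rewrite /q; lra.
have Ch : C * h < d ^+ 2.
  rewrite /h mulrA ltr_pdivrMr // mulrC -ltr_pdivrMl //.
  apply: le_lt_trans qN; rewrite /q.
  have -> : (d ^+ 2)^-1 * (2 * M * C) = 2 * M * C / d ^+ 2 by rewrite mulrC.
  by rewrite lerDr mulr_ge0 // ltW.
(* This forces s <= h^2 <= h, so the summands 1 of the counting bounds are absorbed into h / s and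
   h^2 / s. *)
pose n := (Num.trunc (d / h ^+ 2)).+1.
have nR : (0 : R) < n%:R by rewrite ltr0n.
have h2 : 0 < h ^+ 2 by rewrite exprn_gt0.
pose s := d / n%:R.
have s0 : 0 < s by rewrite divr_gt0.
have sh : s <= h ^+ 2.
  rewrite /s ler_pdivrMr // mulrC -ler_pdivrMr //; apply: ltW; exact: truncnS_gt.
apply: contrapT => no.
have bad (a b : 'I_n) : exists z, [/\ `|z| <= M, f z = a%:R * s, g z = b%:R * s & critical z].
  apply: contrapT => nz; apply: no; exists (a%:R * s), (b%:R * s).
  have box (e : 'I_n) : 0 <= e%:R * s <= d.
    rewrite mulr_ge0 ?(ltW s0) //= /s mulrCA ger_pMr // ler_pdivrMr // mul1r ler_nat.
    exact: ltnW.
  split; [exact: box|exact: box|].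
  by move=> z zM fz gz cz; apply: nz; exists z.
pose c (ij : 'I_N.+1 * 'I_N.+1) : P := pt (- M + ij.1%:R * h) (- M + ij.2%:R * h).
have /choice[S hS] := fun ij => critical_cell n (c ij) K0 L0 s0 h0 hT.
have cell (y : R) : `|y| <= M -> exists i : 'I_N.+1, `|y - (- M + i%:R * h)| <= h.
  rewrite ler_norml => /andP[y1 y2].
  have yM : 0 <= y + M by lra.
  have yh0 : 0 <= (y + M) / h by rewrite divr_ge0 // ltW.
  have tN : (Num.trunc ((y + M) / h) < N.+1)%N.
    rewrite ltnS truncn_le_nat; apply: (@le_lt_trans _ _ N%:R); last by rewrite ltr_nat.
    rewrite ler_pdivrMr // /h mulrC divfK ?gt_eqF //; lra.
  exists (Ordinal tN) => /=; have /andP[t1 t2] := truncn_itv yh0.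
  rewrite ler_pdivlMr // in t1; rewrite ltr_pdivrMr // -natr1 mulrDl mul1r in t2.
  by rewrite ler_norml; apply/andP; split; lra.
have cover (ab : 'I_n * 'I_n) : exists ij, ab \in S ij.
  case: ab => a b; have [z [zM fz gz cz]] := bad a b.
  have /plane_normP[z0 z1] := zM.
  have [i hi] := cell _ z0; have [j hj] := cell _ z1.
  exists (i, j); apply: (hS (i, j)).2 fz gz => //.
  by apply/plane_normP; rewrite !mxE.
have := card_le_sum cover; rewrite card_prod !card_ord -(ler_nat R) natr_sum.
apply/negP; rewrite -ltNge.
pose beta := (4 * L + 1) * h / s * ((16 * K + 1) * h ^+ 2 / s).
have hs1 : 1 <= h ^+ 2 / s by rewrite ler_pdivlMr // mul1r.
have hs2 : 1 <= h / s.
  by rewrite ler_pdivlMr // mul1r; apply: le_trans sh _; rewrite expr2 ler_piMr // ltW.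
have cb ij : #|S ij|%:R <= beta.
  apply: le_trans (hS ij).1 _; apply: ler_pM.
  - by rewrite addr_ge0 // divr_ge0 ?(ltW s0) // !mulr_ge0 // ltW.
  - by rewrite addr_ge0 // divr_ge0 ?(ltW s0) // !mulr_ge0 // ltW.
  - have -> : (4 * L + 1) * h / s = 2 * (2 * L * h) / s + h / s by ring.
    by rewrite lerD2l.
  - have -> : (16 * K + 1) * h ^+ 2 / s = 2 * (8 * K * h ^+ 2) / s + h ^+ 2 / s by ring.
    by rewrite lerD2l.
apply: (@le_lt_trans _ _ (\sum_(ij : 'I_N.+1 * 'I_N.+1) beta)).
  by apply: ler_sum => ij _; exact: cb.
rewrite sumr_const card_prod card_ord -[ltLHS]mulr_natl.
have beta0 : 0 <= beta.
  have b1 : 0 <= (4 * L + 1) * h / s by rewrite !mulr_ge0 ?invr_ge0 // ltW.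
  have b2 : 0 <= (16 * K + 1) * h ^+ 2 / s by rewrite !mulr_ge0 ?invr_ge0 // ltW.
  exact: mulr_ge0.
apply: (@le_lt_trans _ _ (4 * N%:R ^+ 2 * beta)).
  apply: ler_wpM2r => //; rewrite natrM.
  have N1 : (1 : R) <= N%:R by rewrite ler1n.
  have NN : N.+1%:R <= 2 * N%:R :> R by rewrite -natr1; lra.
  have -> : 4 * N%:R ^+ 2 = (2 * N%:R) * (2 * N%:R) :> R by ring.
  by apply: ler_pM.
have -> : 4 * N%:R ^+ 2 * beta = C * h / s ^+ 2.
  by rewrite /beta /C /h; field; rewrite !gt_eqF.
rewrite ltr_pdivrMr ?exprn_gt0 //.
have -> : (n * n)%:R * s ^+ 2 = d ^+ 2 :> R.
  by rewrite /s natrM; field; rewrite gt_eqF.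
exact: Ch.
Qed.
End Sard.

Section Existence.
Variable R : realType.
Local Notation P := 'rV[R]_2.

(** Each coordinate is approximated within m / 4 and then shifted by at most m / 4, so the total
    error m / 2 stays below the minimum m of |F| on the boundary. *)
Lemma exists_regular_approx (F : P -> P) (U : set P) m M : continuous F -> 0 < m -> 0 < M ->
  (forall y, boundary U y -> m <= `|F y|) -> (forall z, closure U z -> `|z| <= M) ->
  exists g, regular_approx F U g.
Proof.
move=> Fc m0 M0 hm hM.
have Fi i : continuous (fun z => F z 0 i).
  by move=> z; apply: (continuous_comp (g := fun p : P => p 0 i) (@Fc z)); exact: coord_continuous.
have m4 : 0 < m / 4 by rewrite divr_gt0.
have [f [fx [fy tf]] hf] := smooth_approx (Fi 0) M0 m4.
have [g [gx [gy tg]] hg] := smooth_approx (Fi 1) M0 m4.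
have [v0 [v1 [v0d v1d reg]]] := regular_value M0 tf tg m4.
have shift (u ux uy : P -> R) v : taylor u ux uy -> taylor (fun z => u z - v) ux uy.
  move=> [uc uxc uyc uK]; split=> //.
    by move=> z; exact: (cvgB (uc z) (cvg_cst v)).
  move=> B /uK[K K0 hK]; exists K => // z w zB wB; have := hK z w zB wB.
  by rewrite opprB addrA subrK.
have tf' := shift _ _ _ v0 tf; have tg' := shift _ _ _ v1 tg.
have [_ jE] := taylor_jacobian tf' tg'.
exists (fun z => pt (f z - v0) (g z - v1)); split.
- exact: taylor_C1 tf' tg'.
- move=> z y /hM zM /hm; apply: lt_le_trans.
  apply: (@le_lt_trans _ _ (m / 2)); last by lra.
  have h0 := hf z zM; have h1 := hg z zM.
  rewrite !ler_norml in h0 h1; apply/plane_normP; rewrite !mxE /= !ler_norml; split; lra.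
- move=> z Uz /rowP gz; rewrite jE; apply/eqP.
  have := gz 0; have := gz 1; rewrite !mxE /= => /eqP g1 /eqP g0.
  rewrite !subr_eq0 in g0 g1.
  by apply: reg; [apply: hM; exact: subset_closure|exact/eqP|exact/eqP].
Qed.
End Existence.

(** * The theorem *)

Section Antiperiodic.
Variable R : realType.

(** Started at th0, the loop has a real part vanishing on [0, T / 2] only at the ends, hence of
    constant sign in between; up to replacing the loop by its opposite, [wn_antiperiodic]
    applies. *)
Lemma wn_antiperiodic_zero (T th0 : R) (c : R -> R[i]) : 0 < T -> loop T c ->
  (forall t, c (t + T / 2) = - c t) -> 0 <= th0 < T / 2 -> cre (c th0) = 0 ->
  (forall t, 0 <= t < T / 2 -> cre (c t) = 0 -> t = th0) ->
  exists2 k : int, k = 1 \/ k = - 1 & wn T c k.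
Proof.
move=> T0 cl cA /andP[th00 th0T] c0 uniq.
pose d t := c (t + th0); have [cc cT cn] := cl.
have dc : ccont d.
  move=> t; have k : {for t, continuous (fun t : R => t + th0)} by exact: (cvgD cvg_id (cvg_cst th0)).
  exact: (cca_comp k (cc _)).
have dl : loop T d by split=> // t; [rewrite /d addrAC cT|exact: cn].
have dA t : d (t + T / 2) = - d t by rewrite /d addrAC cA.
have d0 : cre (d 0) = 0 by rewrite /d add0r.
have dz t : 0 < t -> t < T / 2 -> cre (d t) != 0.
  move=> t0 tT; apply/eqP; rewrite /d => e; have [h|h] := ltP (t + th0) (T / 2).
    by have := uniq (t + th0); rewrite h andbT => /(_ _ e); lra.
  have e' : cre (c (t + th0 - T / 2)) = 0.
    by apply: oppr_inj; rewrite -creN -cA subrK e oppr0.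
  have h' : 0 <= t + th0 - T / 2 < T / 2 by apply/andP; split; lra.
  by have := uniq _ h' e'; lra.
have rc : continuous (fun t => cre (d t)) by move=> t; case: (dc t).
have [n wn_] := wn_ex T0 cl.
have wd : wn T d n := wn_shift th0 T0 cl wn_.
have mixed t1 t2 : 0 <= t1 <= T / 2 -> 0 <= t2 <= T / 2 -> cre (d t1) < 0 -> 0 < cre (d t2) -> False.
  move=> /andP[a1 b1] /andP[a2 b2] n1 p2.
  have [t12|t21] := leP t1 t2.
    have [|s /andP[s1 s2] s0] := @ivt R (fun t => cre (d t)) t1 t2 0 t12 rc; first by left; rewrite !ltW.
    have s1' : t1 != s by apply: contraTneq n1 => ->; rewrite s0 ltxx.
    have s2' : s != t2 by apply: contraTneq p2 => <-; rewrite s0 ltxx.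
    suff : cre (d s) != 0 by rewrite s0 eqxx.
    apply: dz.
      by apply: le_lt_trans a1 _; rewrite lt_neqAle s1'.
    by apply: lt_le_trans b2; rewrite lt_neqAle s2'.
  have [|s /andP[s1 s2] s0] := @ivt R (fun t => cre (d t)) t2 t1 0 (ltW t21) rc; first by right; rewrite !ltW.
  have s1' : t2 != s by apply: contraTneq p2 => ->; rewrite s0 ltxx.
  have s2' : s != t1 by apply: contraTneq n1 => <-; rewrite s0 ltxx.
  suff : cre (d s) != 0 by rewrite s0 eqxx.
  apply: dz.
    by apply: le_lt_trans a2 _; rewrite lt_neqAle s1'.
  by apply: lt_le_trans b1; rewrite lt_neqAle s2'.
have res (e : R -> R[i]) : loop T e -> wn T e n -> (forall t, e (t + T / 2) = - e t) ->
    cre (e 0) = 0 -> (forall t, 0 <= t <= T / 2 -> 0 <= cre (e t)) ->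
    exists2 k : int, k = 1 \/ k = - 1 & wn T c k.
  move=> el we eA e0 ep; exists n => //.
  by case: (wn_antiperiodic T0 el eA e0 ep) => w; [left|right]; exact: wn_uniq (ltW T0) we w.
have [[t1 t1T n1]|no] := pselect (exists2 t, 0 <= t <= T / 2 & cre (d t) < 0).
  apply: (res (fun t => - d t)).
  - have [_ dT dn] := dl.
    split=> [t|t|t]; [by apply: ccaN; exact: dc|by rewrite dT|by rewrite oppr_eq0].
  - exact: wnN wd.
  - by move=> t; rewrite dA.
  - by rewrite creN d0 oppr0.
  - move=> t tT; rewrite creN oppr_ge0 leNgt; apply/negP; exact: mixed n1.
apply: (res d) => // t tT; rewrite leNgt; apply/negP => n1; apply: no.
by exists t.
Qed.
End Antiperiodic.

Unset Implicit Arguments.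

Theorem proposition1 (R : realType) (T : R)
    (psi : 'rV[R]_2 -> 'rV[R]_2) (phi : R -> 'rV[R]_2 -> R -> 'rV[R]_2)
    (x0 y1 z0 z1 : R -> 'rV[R]_2) (rho rhostar : R)
    (U0 : set 'rV[R]_2) (Ftilde : 'rV[R]_2 -> 'rV[R]_2) (theta0 : R)
    (hpsi : C1_field psi)
    (hphi : admissible_perturbation phi T)
    (hx0 : limit_cycle psi x0 T)
    (hsimple : simple_multiplier (linearization psi x0) T 1)
    (hy1 : eigenfunction (linearization psi x0) T rho y1)
    (hrho : rho <> 1)
    (hz0 : eigenfunction (adjoint_coef (linearization psi x0)) T 1 z0)
    (hz1 : eigenfunction (adjoint_coef (linearization psi x0)) T rhostar z1)
    (hrhostar : rhostar <> 1)
    (hU0 : jordan_interior (x0 @` `[0, T]) U0)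
    (hF : continuous Ftilde)
    (hFx0 : forall theta, 0 <= theta <= T ->
      Ftilde (x0 theta) =
        f0 phi x0 z0 T theta *: 'D_1 x0 theta
        + f1 phi x0 z1 T theta T *: perp ('D_1 x0 theta))
    (hxz0 : dotv ('D_1 x0 0) (z0 0) = 1)
    (hyz1 : dotv (y1 0) (z1 0) = 1)
    (hf0 : forall theta, 0 <= theta <= T ->
      f0 phi x0 z0 T theta = - f0 phi x0 z0 T (theta + T / 2))
    (hf1 : forall theta, 0 <= theta <= T ->
      f1 phi x0 z1 T theta T = - f1 phi x0 z1 T (theta + T / 2) T)
    (htheta0 : 0 <= theta0 < T / 2)
    (hzero : f0 phi x0 z0 T theta0 = 0)
    (huniq : forall theta, 0 <= theta < T / 2 ->
      f0 phi x0 z0 T theta = 0 -> theta = theta0)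
    (hmono : strictly_monotone_at (f0 phi x0 z0 T) theta0)
    (hf1theta0 : f1 phi x0 z1 T theta0 T <> 0) :
  brouwer_degree Ftilde U0 0 \/ brouwer_degree Ftilde U0 2.
Proof.
case: (hx0) => xsol xper _; have [T0 xT _] := xper.
pose v t := psi (x0 t).
have psic : continuous psi by move=> p; apply: differentiable_continuous; case: hpsi.
have xc : continuous x0 := x0_cont xsol.
have vc : continuous v by move=> t; exact: (continuous_comp (@xc t) (@psic _)).
have vT t : v (t + T) = v t by rewrite /v xT.
have v0 t : v t != 0 by exact: (x0_speed hpsi xsol xper).
have xinj := x0_inj hpsi xsol xper.
have Dx t : 'D_1 x0 t = v t by rewrite (derive_val (is_derive := xsol t)).
have hU : jordan_interior (range x0) U0 by rewrite -(curveE T0 xT).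
have [sig [sig1 ind wv Ux]] := interior_winding T0 xsol vc xT vT v0 xinj hU.
have Uo := U_open T0 xsol xT hU.
have Ub := U_bounded hU.
have Ucl := U_closure T0 xsol xT hU.
have Uoff := U_off hU.
have [q Uq] : exists q, U0 q.
  by have [_ [p pC UE]] := hU; exists p; rewrite UE; exact: connected_component_refl.
pose f0' := f0 phi x0 z0 T; pose f1' t := f1 phi x0 z1 T t T.
(* Clockwise rotation is multiplication by - i, so dividing by v gives f0 - i f1. Continuity and
   periodicity of c come from [Ftilde] and v; the integrals enter through [cval], on [0, T]. *)
pose c t := toC (Ftilde (x0 t)) / toC (v t).
have vn t : toC (v t) != 0 by rewrite toC_eq0.
have Fxc : continuous (fun t => Ftilde (x0 t)).
  by move=> t; exact: (continuous_comp (@xc t) (@hF _)).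
have cc : ccont c.
  move=> t; apply: ccaM; first exact: (cca_comp (@Fxc t) (@toC_cont R _)).
  by apply: ccaV => //; exact: (cca_comp (@vc t) (@toC_cont R _)).
have cT t : c (t + T) = c t by rewrite /c xT vT.
have cval t : 0 <= t <= T -> c t = f0' t +i* - f1' t.
  move=> tT; rewrite /c hFx0 // Dx toCD !toCZ toC_perp mulrA -mulrDl mulfK //.
  by apply: ceq; rewrite !cE /cre /cim /= /f0' /f1'; ring.
(* The hypotheses give this for t in [0, T / 2], where t + T / 2 is still in [0, T]. Since c (t + T
   / 2) + c t is T-periodic, the other half of the period follows by a shift of T / 2. *)
have cA t : c (t + T / 2) = - c t.
  have half u : 0 <= u <= T / 2 -> c (u + T / 2) = - c u.
    move=> /andP[u0 u1]; rewrite !cval; [|by apply/andP; split; lra..].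
    have uT : 0 <= u <= T by apply/andP; split; lra.
    by apply: ceq; rewrite !cE /cre /cim /= /f0' /f1' ?(hf0 u) ?(hf1 u) // ?opprK; lra.
  have hT r : c (r + T + T / 2) + c (r + T) = c (r + T / 2) + c r by rewrite addrAC !cT.
  apply/eqP; rewrite -addr_eq0; apply/eqP.
  have [s /andP[s0 sT] <-] := periodic_reduce T0 hT t.
  have [sh|sh] := leP s (T / 2); first by rewrite half ?s0 // addNr.
  have h' : 0 <= s - T / 2 <= T / 2 by apply/andP; split; lra.
  have e1 := half _ h'; rewrite subrK in e1.
  have -> : s + T / 2 = s - T / 2 + T by lra.
  by rewrite cT e1 subrr.
have cre0 t : 0 <= t < T / 2 -> cre (c t) = 0 -> t = theta0.
  move=> /andP[t0 t1]; rewrite cval; last by apply/andP; split; lra.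
  by apply: huniq; rewrite t0.
have th0T : 0 <= theta0 <= T by case/andP: htheta0 => a b; apply/andP; split; lra.
(* Modulo T / 2 a zero of c would be at theta0, the unique zero of f0, where f1 does not vanish. *)
have cn t : c t != 0.
  have [s /andP[s0 sT] <-] := periodic_reduce T0 cT t.
  have half u : 0 <= u < T / 2 -> c u != 0.
    move=> uT; apply/eqP => e; have eu := cre0 u uT (congr1 (@cre R) e).
    move: e; rewrite eu cval // => -[_ /eqP]; rewrite oppr_eq0 => /eqP; exact: hf1theta0.
  have [sh|sh] := ltP s (T / 2); first by apply: half; rewrite s0.
  rewrite -[s](subrK (T / 2)) cA oppr_eq0; apply: half.
  by apply/andP; split; lra.
have cl : loop T c by [].
have c0 : cre (c theta0) = 0 by rewrite cval.
have [k k1 wc] := wn_antiperiodic_zero T0 cl cA htheta0 c0 cre0.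
have Fn t : Ftilde (x0 t) != 0.
  by apply: contraNneq (cn t) => e; rewrite /c e (_ : toC 0 = 0) ?mul0r //; apply/eqP; rewrite toC_eq0.
have wF : wn T (fun t => toC (Ftilde (x0 t))) (k + sig).
  by have := wnM wc wv; apply: wn_ext => t _; rewrite /c divfK.
have dom : degree_domain Ftilde U0.
  split=> //; first by case: hU.
    exact: continuous_subspaceT.
  by move=> y; rewrite (boundaryE Uo Ucl Uoff Ux) => -[t _ <-].
have nFc : continuous (fun t => `|Ftilde (x0 t)|) by move=> t; exact: (cvg_norm (@Fxc t)).
have [tm _ hm] := EVT_min (ltW T0) (continuous_subspaceT nFc).
have [M M0 hM] := Ub.
have ex : exists g, regular_approx Ftilde U0 g.
  apply: (@exists_regular_approx R Ftilde U0 `|Ftilde (x0 tm)| (M + 1) hF).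
  - by rewrite normr_gt0.
  - by rewrite ltr_wpDl.
  - move=> y; rewrite (boundaryE Uo Ucl Uoff Ux) => -[t _ <-].
    have [s /andP[s0 sT] <-] := periodic_reduce T0 xT t.
    by apply: hm; rewrite in_itv /= s0 ltW.
  have cM : closed [set p : 'rV[R]_2 | `|p| <= M + 1].
    exact: (closed_comp (fun x _ => @norm_continuous _ _ x) (@closed_le R (M + 1))).
  have UM : U0 `<=` [set p : 'rV[R]_2 | `|p| <= M + 1] by move=> z /hM /= zM; rewrite (le_trans zM) // lerDl.
  by move=> z /(closure_subset UM); rewrite -(closure_id _).1.
have deg := degree_formula T0 xc xT xinj Uo Ub Ucl Uoff Ux Uq sig1 ind hF Fn wF.
have res (d : int) : sig * (k + sig) = d -> brouwer_degree Ftilde U0 d.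
  by move=> <-; split.
by case: sig1 k1 res => -> [] -> res; [right|left|left|right]; apply: res.
Qed.
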